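(* Let $m$ and $p$ be positive integers. Then for every integer $N\ge 1$ the $N$th colored Jones polynomial of the double twist knot $K_{(-m,-p)}$ is $$ \begin{aligned} J_N(K_{(-m,-p)};q) = {}& q^{(p-1)(N-1)}\sum_{N-1\ge n_{(2m+1)p-1}\ge\cdots\ge n_1\ge 0} (q^{1-N})_{n_{(2m+1)p-1}}\,(-1)^{n_{(2m+1)p-1}}\,q^{-\binom{n_{(2m+1)p-1}+1}{2}}\\ &\times \prod_{\substack{1\le i<j\le (2m+1)p-1\\ (2m+1)\nmid i\\ j\not\equiv m \ (\mathrm{mod}\ 2m+1)}} q^{\epsilon_{i,j,m}n_in_j}\ \prod_{\substack{1\le i\le (2m+1)p-2\\ i\equiv m \text{ or } 2m+1\ (\mathrm{mod}\ 2m+1)}} (-1)^{n_i}q^{Nn_i+\binom{n_i+1}{2}}\\ &\times \prod_{i=1}^{(2m+1)p-2} q^{-n_in_{i+1}+\gamma_{i,m}n_i}\begin{bmatrix} n_{i+1}\\ n_i\end{bmatrix}. \end{aligned} $$ Here, for $1\le i<j\le (2m+1)p-1$ with $(2m+1)\nmid i$ and $j\not\equiv m\pmod{2m+1}$, $$ \epsilon_{i,j,m}=\begin{cases}1 & \text{if } j\equiv -i \text{ or } -i-1 \pmod{2m+1},\\ -1 & \text{if } j\equiv i\text{ or } i-1\pmod{2m+1},\\ 0&\text{otherwise,}\end{cases} $$ and, for $1\le i\le (2m+1)p-2$, $$ \gamma_{i,m}=\begin{cases}1 & \text{if } i\equiv 1,\dots,m-1\pmod{2m+1},\\ -1&\text{if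 } i\equiv 0,m+1,\dots,2m\pmod{2m+1},\\ 0&\text{if } i\equiv m\pmod{2m+1}.\end{cases} $$
   Context: Notation: $(a)_n=(a;q)_n=\prod_{k=0}^{n-1}(1-aq^k)$, and for $0\le k\le n$, $\begin{bmatrix} n\\k\end{bmatrix}=\frac{(q)_n}{(q)_{n-k}(q)_k}$, where $(q)_n=(q;q)_n$. Empty products equal $1$. Knots: $K_{(m,p)}$ ($m,p\in\mathbb{Z}$, $p\neq 0$) is the double twist knot with two twist regions having $2m-1$ and $2p$ half-twists respectively, positive integers meaning right-handed and negative integers left-handed half-twists. In terms of 2-bridge knots $\mathfrak{b}(l,t)$: for integers $m\ge 0$, $p\ge 1$ one has $K_{(m+1,p)}=\mathfrak{b}(4mp+2p-1,\,4mp-1)$ and $K_{(m+1,-p)}=\mathfrak{b}(4mp+2p+1,\,4mp+1)$; the mirror image of $K_{(m+1,p)}$ is $K_{(-m,-p)}$ and the mirror image of $K_{(m+1,-p)}$ is $K_{(-m,p)}$. Here $\mathfrak{b}(l,t)$ is the 2-bridge knot whose double branched cover is the lens space $L(l,t)$, with the chirality convention that $\mathfrak{b}(2p+1,1)=K_{(1,-p)}$ is the left-handed torus knot $T(2,2p+1)$ (so $K_{(0,p)}$ is the right-handed one), and $\mathfrak{b}(l,-t)$ is the mirror image of $\mathfrak{b}(l,t)$. Colored Jones polynomial: $J_N(K;q)$ is the usual $N$th colored Jones polynomial of $K$ (coloring by the $N$-dimensional irreducible representation of quantum $\mathfrak{sl}_2$, zero framing), normalized to be $1$ for the unknot. With $K^*$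 the mirror image of $K$, $J_N(K;q^{-1})=J_N(K^*;q)$. The convention for $q$ versus $q^{-1}$ is the one in which the right-handed trefoil has $J_2=q^{-1}+q^{-3}-q^{-4}$. *)

(* Defs.v *)
From HB Require Import structures.
From mathcomp Require Import all_boot all_order all_algebra.

Set Implicit Arguments.
Unset Strict Implicit.
Unset Printing Implicit Defensive.

Import Order.TTheory GRing.Theory Num.Theory.
Local Open Scope ring_scope.

(* The colored Jones polynomial is the Reshetikhin-Turaev invariant of
   U_q(sl_2) (Hopf algebra conventions of Kassel, "Quantum groups"):
     K E = v^2 E K,  K F = v^-2 F K,  [E, F] = (K - K^-1) / (v - v^-1),
     Delta E = 1 (x) E + E (x) K,   Delta F = K^-1 (x) F + F (x) 1,
     S(E) = - E K^-1,   S(F) = - K F,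
   where v = q^(1/2).  Since the universal R-matrix involves q^(H (x) H / 4),
   everything is computed from s = q^(1/4); thus v = s^2 and q = s^4. *)

Section QuantumGroup.

Context {k : fieldType}.
Implicit Types (s : k) (N : nat).

Definition vq s : k := s ^+ 2.

Definition qint s n : k :=
  (vq s ^+ n - vq s ^- n) / (vq s - (vq s)^-1).

Definition qfact s n : k := \prod_(1 <= i < n.+1) qint s i.

(* The N-dimensional irreducible representation V, with basis e_0 .. e_(N-1):
     H e_j = (N-1-2j) e_j,  E e_j = [N-j] e_(j-1),  F e_j = [j+1] e_(j+1).
   Matrices act on column vectors: entry (i, j) is the e_i-coordinate of the
   image of e_j. *)
Definition weight N (i : 'I_N) : int := N%:Z - 1 - 2 * i%:Z.

Definition matE s N : 'M[k]_N :=
  \matrix_(i, j) if i.+1 == j :> nat then qint s (N - j) else 0.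

Definition matF s N : 'M[k]_N :=
  \matrix_(i, j) if i == j.+1 :> nat then qint s j.+1 else 0.

(* K = v^H for e = 1, and its inverse for e = -1 *)
Definition matK s N (e : int) : 'M[k]_N :=
  diag_mx (\row_i vq s ^ (e * weight i)).

(* An upward oriented strand (true) is colored by V, a downward oriented one
   (false) by the dual V^* in the dual basis, on which x acts as the transpose
   of S(x). *)
Definition repE s N (o : bool) : 'M[k]_N :=
  if o then matE s N else (- (matE s N *m matK s N (-1)))^T.

Definition repF s N (o : bool) : 'M[k]_N :=
  if o then matF s N else (- (matK s N 1 *m matF s N))^T.

Definition oweight N (o : bool) (i : 'I_N) : int :=
  if o then weight i else - weight i.

(* Coefficient of e_c (x) e_d in R (e_a (x) e_b), where
     R = q^(H (x) H / 4)
           \sum_l v^(l(l-1)/2) (v - v^-1)^l / [l]! E^l (x) F^l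
   acts on the representations given by the orientations o1, o2.
   The terms with l >= N vanish since E^N = 0. *)
Definition Rmx s N (o1 o2 : bool) (a b c d : 'I_N) : k :=
  s ^ (oweight o1 c * oweight o2 d) *
  \sum_(l < N) vq s ^+ 'C(l, 2) * (vq s - (vq s)^-1) ^+ l / qfact s l *
    (repE s N o1 ^+ l) c a * (repF s N o2 ^+ l) d b.

(* The same coefficient for
     R^-1 = (\sum_l (-1)^l v^(-l(l-1)/2) (v - v^-1)^l / [l]! E^l (x) F^l)
              q^(- H (x) H / 4). *)
Definition Rinvmx s N (o1 o2 : bool) (a b c d : 'I_N) : k :=
  (\sum_(l < N) (-1) ^+ l * vq s ^- 'C(l, 2) *
    (vq s - (vq s)^-1) ^+ l / qfact s l *
    (repE s N o1 ^+ l) c a * (repF s N o2 ^+ l) d b) *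
  s ^ (- (oweight o1 a * oweight o2 b)).

End QuantumGroup.

(* An oriented link diagram is cut by horizontal lines into elementary pieces,
   listed from bottom to top; strands are numbered from the left, from 0.
     Cup i o   : creates strands i, i+1, oriented up, down if o is true and
                 down, up otherwise;
     Cap i     : joins strands i, i+1;
     Cross i h : strands i, i+1 make a half-twist, right-handed if h is true
                 and left-handed otherwise (this does not depend on the
                 orientation of the strands). *)
Inductive piece : Type :=
  | Cup of nat & bool
  | Cap of nat
  | Cross of nat & bool.

Definition diagram := seq piece.

(* Sum of the signs of the crossings of D, given the orientations of the
   strands entering D from below.  A right-handed half-twist is a positive
   crossing if its two strands are parallel, a negative one otherwise. *)
Fixpoint writhe_from (D : diagram) (os : seq bool) : int :=
  match D with
  | [::] => 0
  | Cup i o :: D' => writhe_from D' (take i os ++ [:: o, ~~ o & drop i os])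
  | Cap i :: D' => writhe_from D' (take i os ++ drop i.+2 os)
  | Cross i h :: D' =>
      if drop i os is [:: o1, o2 & os'] then
        (if h == (o1 == o2) then 1 else -1)
        + writhe_from D' (take i os ++ [:: o2, o1 & os'])
      else 0
  end.

Definition writhe (D : diagram) : int := writhe_from D [::].

Section ReshetikhinTuraev.

Context {k : fieldType}.

(* Scalar obtained by applying the Reshetikhin-Turaev morphism of D (with no
   strand leaving at the top) to a basis vector; each strand carries its
   orientation and a basis index.  The elementary morphisms are
   - cups: 1 |-> \sum_a e_a (x) e^a and 1 |-> \sum_a e^a (x) K^-1 e_a;
   - caps: e^a (x) e_b |-> e^a(e_b) and e_a (x) e^b |-> e^b(K e_a);
   - right-handed half-twist of X (x) Y: tau o R;
   - left-handed half-twist of X (x) Y: the inverse R^-1 o tau of the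
     right-handed half-twist of Y (x) X.
   The value is 0 if D is ill-formed. *)
Fixpoint rt_from (s : k) (N : nat) (D : diagram) (x : seq (bool * 'I_N)) : k :=
  match D with
  | [::] => (nilp x)%:R
  | Cup i o :: D' =>
      \sum_(a < N) \sum_(b < N)
        (if o then (a == b)%:R else matK s N (-1) b a) *
        rt_from s D' (take i x ++ [:: (o, a), (~~ o, b) & drop i x])
  | Cap i :: D' =>
      if drop i x is [:: (o1, a), (o2, b) & y] then
        (if o1 == o2 then 0 else if o1 then matK s N 1 b a else (a == b)%:R) *
        rt_from s D' (take i x ++ y)
      else 0
  | Cross i h :: D' =>
      if drop i x is [:: (o1, a), (o2, b) & y] then
        if h then
          \sum_(c < N) \sum_(d < N) Rmx s o1 o2 a b c d *
            rt_from s D' (take i x ++ [:: (o2, d), (o1, c) & y])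
        else
          \sum_(c < N) \sum_(d < N) Rinvmx s o2 o1 b a c d *
            rt_from s D' (take i x ++ [:: (o2, c), (o1, d) & y])
      else 0
  end.

Definition rt (s : k) (N : nat) (D : diagram) : k := @rt_from s N D [::].

End ReshetikhinTuraev.

Definition unknot : diagram := [:: Cup 0 true; Cap 0].

(* Coefficients: rational functions over Q in an indeterminate s = q^(1/4) *)
Definition Qs : fieldType := {fraction {poly rat}}.
Definition sqrt4q : Qs := tofrac 'X.
Definition q : Qs := sqrt4q ^+ 4.

(* A positive curl acts on V by q^((N^2-1)/4) = s^(N^2-1), so the first factor
   makes the framing zero. *)
Definition colored_jones (N : nat) (D : diagram) : Qs :=
  sqrt4q ^ (- (writhe D * (N%:Z ^+ 2 - 1))) *
  (rt sqrt4q N D / rt sqrt4q N unknot).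

Definition half_twists (i : nat) (z : int) : diagram :=
  nseq `|z|%N (Cross i (0 < z)).

(* The double twist knot K_(m,p): a region of 2p half-twists and a region of
   2m-1 half-twists, in a 4-plat whose top is closed by nested arcs *)
Definition double_twist (m p : int) : diagram :=
  [:: Cup 0 false; Cup 2 true]
    ++ half_twists 1 (2 * p) ++ half_twists 0 (2 * m - 1)
    ++ [:: Cap 1; Cap 0].

Definition qpoch (a : Qs) (n : nat) : Qs := \prod_(0 <= i < n) (1 - a * q ^+ i).

Definition qbin (n k : nat) : Qs := qpoch q n / (qpoch q (n - k) * qpoch q k).

Definition epsilon (m i j : nat) : int :=
  let M : int := (2 * m + 1)%N%:Z in
  if (j == - i%:Z %[mod M])%Z || (j == - i%:Z - 1 %[mod M])%Z then 1
  else if (j == i %[mod M])%Z || (j == i%:Z - 1 %[mod M])%Z then -1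
  else 0.

Definition gamma (m i : nat) : int :=
  let r := (i %% (2 * m + 1))%N in
  if (1 <= r <= m - 1)%N then 1
  else if (r == 0%N) || (m + 1 <= r <= 2 * m)%N then -1
  else 0.

(* The component n_i of (n_1, ..., n_L), numbered from 1 *)
Definition part (N L : nat) (t : L.-tuple 'I_N) (i : nat) : nat :=
  nth 0%N [seq val x | x <- t] i.-1.

(* Main.v *)
Require Import Defs.
From HB Require Import structures.
From Stdlib Require Import FunctionalExtensionality.
From mathcomp Require Import all_boot all_order all_algebra.
From mathcomp Require Import ring lra zify.

Set Implicit Arguments.
Unset Strict Implicit.
Unset Printing Implicit Defensive.

Import Order.TTheory GRing.Theory Num.Theory.
Local Open Scope ring_scope.

(* Cutting the diagram between its two twist regions, one has to pair invariant
   tensors in V^* (x) V (x) V (x) V^*.  Such a tensor is determined by its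
   components with last index 0, and after normalization invariance is a
   two-term recursion for an array w(i, j), which is therefore determined by its
   first row or by its first column.  A half-twist maps one to the other, so a
   full twist is an explicit q-binomial transform.  With x = q^N this gives
     J_N = (x/q)^p sum_j q^-j (1 - x/q) ... (1 - x/q^j) f_p(j) g_m(j),
   where f_p and g_m are again q-binomial transforms; q-Vandermonde turns it into
   a double sum over z and A ([kern_pairing]).
   In the multisum, the variables are grouped into blocks of 2m+1, the last one
   being incomplete, and each block is translated by the last variable of the
   previous one.  The interaction between blocks is then the polarization of
   the quadratic exponent of a single block plus the exponent of a q-Vandermonde
   sum over chains, so that the blocks merge one after another.  What is left is
   the same double sum. *)

(** * q-binomial identities *)

(** Index 0 is used twice. Row 0 of E on the dual of V vanishes and no crossing touches the last
    strand, so invariance under E closes up on the components with last index 0. And F never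
    produces e_0, so a component with 0 at the place where F acts sees only the l = 0 term of R^-1:
    there a half-twist is a transposition times a monomial, and all q-series come from invariance.
    The exception is the first half-twist of a full twist in the second region, where the components
    [middiag] are needed and the whole series of R^-1 contributes. The two regions produce different
    Pochhammer factors. Those of the first are ratios of values of [bfac] and are divided out of the
    array; those of the second are moved by [gb_poch_swap], after which both regions have the shape
    [kern] that can be paired. The writhe correction cancels all powers of [kappa] and leaves
    (x/q)^p. Pairing consumes one factor x/q = q^(N-1), whence the exponent (p-1)(N-1); likewise
    [pcoef p] unfolds once, which matches p-1 complete blocks followed by one of length 2m. *)

Lemma bin2D a b : 'C(a + b, 2) = ('C(a, 2) + 'C(b, 2) + a * b)%N.
Proof.
elim: a => [|a IH]; first by rewrite add0n mul0n addn0.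
by rewrite addSn !binS IH !bin1; lia.
Qed.

Lemma bump0 i : bump 0 i = i.+1.
Proof. by []. Qed.

Section GaussianBinomials.

Context {F : fieldType} (q : F).

Definition poch (a : F) n : F := \prod_(i < n) (1 - a * q ^+ i).

(* Unlike [qbin], zero for [k > n]. *)
Definition gb n k : F :=
  if (k <= n)%N then poch q n / (poch q (n - k) * poch q k) else 0.

Lemma poch0 a : poch a 0 = 1.
Proof. by rewrite /poch big_ord0. Qed.

Lemma pochSr a n : poch a n.+1 = poch a n * (1 - a * q ^+ n).
Proof. by rewrite /poch big_ord_recr. Qed.

Lemma pochS a n : poch a n.+1 = (1 - a) * poch (a * q) n.
Proof.
rewrite /poch big_ord_recl expr0 mulr1; congr (_ * _).
by apply: eq_bigr => i _; rewrite lift0 exprS mulrA.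
Qed.

Lemma pochD a m n : poch a (m + n) = poch a m * poch (a * q ^+ m) n.
Proof.
elim: n => [|n IH]; first by rewrite addn0 poch0 mulr1.
by rewrite addnS !pochSr IH -!mulrA exprD.
Qed.

Context (q0 : q != 0).
Context (qroot : forall n, (0 < n)%N -> q ^+ n != 1).

Lemma poch_q_neq0 n : poch q n != 0.
Proof.
apply/prodf_neq0 => i _; rewrite -exprS subr_eq0 eq_sym; exact: qroot.
Qed.

Lemma gb_small n k : (n < k)%N -> gb n k = 0.
Proof. by rewrite /gb ltnNge => /negbTE->. Qed.

Lemma gbE n k : (k <= n)%N -> gb n k = poch q n / (poch q (n - k) * poch q k).
Proof. by rewrite /gb => ->. Qed.

Lemma gbDE n k : gb (n + k) k = poch q (n + k) / (poch q n * poch q k).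
Proof. by rewrite gbE ?leq_addl // addnK. Qed.

Lemma gbn0 n : gb n 0 = 1.
Proof. by rewrite gbE // subn0 poch0 mulr1 divff // poch_q_neq0. Qed.

Lemma gbnn n : gb n n = 1.
Proof. by rewrite gbE // subnn poch0 mul1r divff // poch_q_neq0. Qed.

Lemma gb_sub n k : (k <= n)%N -> gb n (n - k) = gb n k.
Proof. by move=> h; rewrite !gbE ?leq_subr // subKn // mulrC [_ * poch q k]mulrC mulrC. Qed.

Lemma gbSS n k : gb n.+1 k.+1 = gb n k + q ^+ k.+1 * gb n k.+1.
Proof.
case: (leqP k n) => [|h]; last first.
  by rewrite !gb_small ?mulr0 ?addr0 // ltnW.
move=> /subnK<-; set a := (n - k)%N; case: a => [|a].
  by rewrite add0n !gbnn gb_small // mulr0 addr0.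
rewrite -addnS !gbDE (_ : a.+1 + k = a + k.+1)%N; last by rewrite addnS.
rewrite gbDE.
have h1 := poch_q_neq0 a.+1; have h2 := poch_q_neq0 k.+1.
rewrite addSn (pochSr _ (a + k.+1)) -exprS.
have := h1; have := h2; rewrite !pochSr -!exprS !mulf_eq0 !negb_or.
move=> /andP[u1 u2] /andP[u3 u4].
rewrite (_ : q ^+ (a + k.+1).+1 = q ^+ a.+1 * q ^+ k.+1); last by rewrite -exprD addSn.
by field; rewrite u1 u2 u3 u4.
Qed.

Lemma gbSS' n k : gb n.+1 k.+1 = q ^+ (n - k) * gb n k + gb n k.+1.
Proof.
case: (leqP k n) => [|h]; last first.
  by rewrite !gb_small ?mulr0 ?addr0 // ltnW.
move=> /subnK<-; set a := (n - k)%N; rewrite addnK; case: a => [|a].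
  by rewrite add0n !gbnn gb_small // mul1r addr0.
rewrite -addnS !gbDE (_ : a.+1 + k = a + k.+1)%N; last by rewrite addnS.
rewrite gbDE.
have h1 := poch_q_neq0 a.+1; have h2 := poch_q_neq0 k.+1.
rewrite addSn (pochSr _ (a + k.+1)) -exprS.
have := h1; have := h2; rewrite !pochSr -!exprS !mulf_eq0 !negb_or.
move=> /andP[u1 u2] /andP[u3 u4].
rewrite (_ : q ^+ (a + k.+1).+1 = q ^+ a.+1 * q ^+ k.+1); last by rewrite -exprD addSn.
by field; rewrite u1 u2 u3 u4.
Qed.

Lemma gb_mul n j k : (k <= j)%N -> gb n j * gb j k = gb n k * gb (n - k) (j - k).
Proof.
move=> kj; case: (leqP j n) => [jn|nj]; last first.
  rewrite gb_small // mul0r; case: (leqP k n) => kn.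
    by rewrite (@gb_small (n - k)) ?mulr0 //; lia.
  by rewrite gb_small ?mul0r.
rewrite !gbE //; try lia.
rewrite (_ : n - k - (j - k) = n - j)%N; last lia.
by field; rewrite !poch_q_neq0.
Qed.

Lemma big_gb n B (f : nat -> F) : (n < B)%N ->
  \sum_(k < B) gb n k * f k = \sum_(k < n.+1) gb n k * f k.
Proof.
move=> nB; rewrite [RHS](big_ord_widen B (fun k => gb n k * f k)) //.
rewrite [RHS]big_mkcond; apply: eq_bigr => k _; case: ltnP => // h.
by rewrite gb_small ?mul0r.
Qed.

(** Trinomial revision makes the outer factor independent of j. Every composition of two transforms
    with kernel [gb] is reduced in this way to a single sum over t = j - k. *)
Lemma gb_conv n k B (f : nat -> F) : (n < B)%N ->
  \sum_(j < B) gb n j * gb j k * f j =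
  gb n k * \sum_(t < (n - k).+1) gb (n - k) t * f (k + t)%N.
Proof.
move=> nB; case: (leqP k n) => kn; last first.
  rewrite gb_small // mul0r big1 // => j _.
  case: (leqP j n) => jn; last by rewrite gb_small ?mul0r.
  by rewrite (@gb_small j) ?mulr0 ?mul0r //; lia.
under eq_bigr do rewrite -mulrA.
rewrite (big_gb (fun j => gb j k * f j) nB).
have -> : n.+1 = (k + (n - k).+1)%N by lia.
rewrite big_split_ord /= big1 ?add0r; last first.
  by move=> j _; rewrite (@gb_small j) ?mul0r ?mulr0 //=.
rewrite mulr_sumr; apply: eq_bigr => t _.
by rewrite !mulrA gb_mul ?leq_addr // addKn.
Qed.

(** The finite q-binomial theorem. *)
Lemma gb_binomial M y :
  \sum_(t < M.+1) gb M t * ((-1) ^+ t * q ^+ 'C(t, 2) * y ^+ t) = poch y M.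
Proof.
elim: M y => [|M IH] y.
  by rewrite big_ord_recl big_ord0 gbn0 poch0 bin_small // !expr0 !mulr1 addr0.
rewrite pochS -IH.
have IH' := IH (y * q); rewrite mulrBl mul1r.
rewrite big_ord_recl gbn0 [X in _ = X - _]big_ord_recl gbn0.
rewrite !expr0 !mulr1 -addrA; congr (_ + _).
under eq_bigr do rewrite lift0 gbSS mulrDl.
rewrite big_split /= addrC; congr (_ + _).
  rewrite big_ord_recr /= gb_small // mulr0 mul0r addr0.
  apply: eq_bigr => t _; rewrite ?bump0 ?lift0 exprMn; ring.
rewrite mulr_sumr -sumrN; apply: eq_bigr => t _.
rewrite binS bin1 exprD exprMn !exprS; ring.
Qed.

(** The q-Bernstein polynomials of degree M sum to 1. Pascal's rule splits the sum for M+1 into a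
    times the sum at a and 1 - a times the sum at a q. *)
Lemma gb_poch_sum M a : \sum_(t < M.+1) gb M t * (poch a t * a ^+ (M - t)) = 1.
Proof.
elim: M a => [|M IH] a.
  by rewrite big_ord_recl big_ord0 gbn0 poch0 !mulr1 addr0.
rewrite big_ord_recl gbn0 poch0 subn0 !mul1r.
under eq_bigr do rewrite lift0 gbSS' mulrDl.
rewrite big_split /= addrCA.
have -> : a ^+ M.+1 + \sum_(i < M.+1) gb M i.+1 * (poch a i.+1 * a ^+ (M.+1 - i.+1)) = a.
  rewrite -[RHS]mulr1 -(IH a) mulr_sumr big_ord_recr /= gb_small // mul0r addr0.
  rewrite [RHS]big_ord_recl gbn0 poch0 subn0 !mul1r -exprS; congr (_ + _).
  apply: eq_bigr => t _; rewrite ?bump0 ?lift0 (_ : M.+1 - t.+1 = (M - t.+1).+1)%N ?exprS; last by have :=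
    ltn_ord t; lia.
  ring.
have -> : \sum_(i < M.+1) q ^+ (M - i) * gb M i * (poch a i.+1 * a ^+ (M.+1 - i.+1)) = 1 - a.
  rewrite -[RHS]mulr1 -[X in _ = _ * X](IH (a * q)) mulr_sumr.
  apply: eq_bigr => t _; rewrite subSS pochS exprMn; ring.
by rewrite subrK.
Qed.

(** The inverse of the q-binomial theorem: b^M expanded in the basis [poch b t]. The induction uses
    b^(M+1) = b^M - (1-b) b^M and takes the second term from the expansion at b q. *)
Lemma gb_poch_alt M b :
  \sum_(t < M.+1) gb M t * ((-1) ^+ t * q ^ ('C(t.+1, 2)%:Z - (M * t)%N%:Z) * poch b t)
  = b ^+ M.
Proof.
elim: M b => [|M IH] b.
  by rewrite big_ord_recl big_ord0 gbn0 poch0 bin_small // mul0n subrr expr0z !mulr1 !expr0 addr0.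
have -> : b ^+ M.+1 = b ^+ M - (1 - b) * b ^+ M by rewrite exprS; ring.
rewrite big_ord_recl gbn0.
under eq_bigr do rewrite lift0 gbSS mulrDl.
rewrite big_split /= addrCA; rewrite [RHS]addrC; congr (_ + _).
  have -> : - ((1 - b) * b ^+ M) = - ((1 - b) * (q ^ (- M%:Z) * (b * q) ^+ M)).
    by rewrite exprMn -exprnN; congr (- (_ * _)); rewrite mulrCA mulVf ?expf_neq0 ?mulr1.
  rewrite -IH !mulr_sumr -sumrN; apply: eq_bigr => t _.
  rewrite pochS.
  have -> : q ^ ('C(t.+2, 2)%:Z - (M.+1 * t.+1)%N%:Z) =
            q ^ (- M%:Z) * q ^ ('C(t.+1, 2)%:Z - (M * t)%N%:Z).
    by rewrite -expfzDr //; congr (_ ^ _); rewrite binS bin1; lia.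
  rewrite exprS; ring.
rewrite -IH [RHS]big_ord_recl big_ord_recr /= gb_small // mulr0 mul0r addr0 gbn0.
congr (_ + _).
apply: eq_bigr => t _; rewrite ?bump0 ?lift0.
have -> : q ^ ('C(t.+2, 2)%:Z - (M * t.+1)%N%:Z) =
          q ^+ t.+1 * q ^ ('C(t.+2, 2)%:Z - (M.+1 * t.+1)%N%:Z).
  by rewrite exprnP -expfzDr //; congr (_ ^ _); lia.
ring.
Qed.

End GaussianBinomials.

Section GaussianSums.
Context {F : fieldType} (q : F).
Context (q0 : q != 0).
Context (qroot : forall n, (0 < n)%N -> q ^+ n != 1).
Notation gb := (gb q).
Notation poch := (poch q).

Lemma gb_conv1 M i (f : nat -> F) :
  \sum_(j < M.+1) gb M j * gb j i * f j =
  gb M i * \sum_(t < (M - i).+1) gb (M - i) t * f (i + t)%N.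
Proof. exact: gb_conv. Qed.

Lemma gb_rev M (f : nat -> F) :
  \sum_(t < M.+1) gb M t * f t = \sum_(t < M.+1) gb M t * f (M - t)%N.
Proof.
rewrite (reindex_inj rev_ord_inj) /=; apply: eq_bigr => t _.
by rewrite subSS gb_sub // -ltnS.
Qed.

(** A transformation of Heine type. Expanding both Pochhammer symbols by the q-binomial theorem and
    collecting powers of y gives the same double sum, up to reversal of the inner one. *)
Lemma gb_poch_swap M w y :
  \sum_(t < M.+1) gb M t * (w ^+ t * poch y t) =
  \sum_(t < M.+1) gb M t * (w ^+ t * poch (y * w) (M - t)).
Proof.
pose c i : F := (-1) ^+ i * q ^+ 'C(i, 2).
have pE z t : (t < M.+1)%N -> poch z t = \sum_(i < M.+1) gb t i * (c i * z ^+ i).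
  by move=> tM; rewrite -gb_binomial // -(@big_gb _ _ t M.+1 (fun i => c i * z ^+ i)).
transitivity (\sum_(i < M.+1) c i * y ^+ i * (gb M i *
    \sum_(s < (M - i).+1) gb (M - i) s * w ^+ (i + s))).
  under eq_bigr => t _ do rewrite pE // mulr_sumr mulr_sumr.
  rewrite exchange_big /=; apply: eq_bigr => i _.
  rewrite -gb_conv1 mulr_sumr; apply: eq_bigr => t _; ring.
rewrite [RHS](gb_rev _ (fun t => w ^+ t * poch (y * w) (M - t))).
under [RHS]eq_bigr => t _ do rewrite (subKn (ltn_ord t : t <= M)%N) pE // mulr_sumr mulr_sumr.
rewrite [RHS]exchange_big /=; apply: eq_bigr => i _.
transitivity (c i * (y * w) ^+ i * \sum_(j < M.+1) gb M j * gb j i * w ^+ (M - j)).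
  rewrite -mulrA exprMn -[RHS]mulrA; congr (_ * _); rewrite -mulrA; congr (_ * _).
  rewrite (@gb_conv1 _ _ (fun j => w ^+ (M - j))) mulrCA; congr (_ * _).
  rewrite (gb_rev _ (fun s => w ^+ (i + s))) mulr_sumr; apply: eq_bigr => s _.
  rewrite mulrCA exprD; congr (_ * (_ * _)).
  by rewrite subnDA.
rewrite mulr_sumr; apply: eq_bigr => t _; ring.
Qed.

Lemma gb_pascal_sum n (G : nat -> F) :
  \sum_(k < n.+2) gb n.+1 k * G k =
  \sum_(k < n.+1) gb n k * (q ^+ (n - k) * G k.+1 + G k).
Proof.
under [RHS]eq_bigr do rewrite mulrDr.
rewrite [RHS]big_split /= [LHS]big_ord_recl gbn0 //.
under [X in _ + X = _]eq_bigr do rewrite lift0 gbSS' // mulrDl.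
rewrite big_split /= addrCA; congr (_ + _).
  by apply: eq_bigr => k _; ring.
rewrite [RHS]big_ord_recl gbn0 // big_ord_recr /= gb_small // mul0r addr0.
by [].
Qed.

(** The test function [H] makes q-Vandermonde applicable inside nested sums; the usual form is the
    coefficient of [H r]. *)
Lemma gb_vandermonde a b (H : nat -> F) :
  \sum_(k < a.+1) gb a k * (\sum_(l < b.+1) gb b l * (q ^+ (k * (b - l)) * H (k + l)%N)) =
  \sum_(r < (a + b).+1) gb (a + b) r * H r.
Proof.
elim: a H => [|a IH] H.
  rewrite add0n big_ord_recl big_ord0 gbn0 // mul1r addr0.
  by apply: eq_bigr => l _; rewrite mul0n expr0 mul1r add0n.
rewrite (gb_pascal_sum _ (fun k => \sum_(l < b.+1) gb b l * (q ^+ (k * (b - l)) * H (k + l)%N))).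
rewrite addSn (gb_pascal_sum _ H).
rewrite -(IH (fun r => q ^+ (a + b - r) * H r.+1 + H r)); apply: eq_bigr => k _; congr (_ * _).
rewrite mulr_sumr -big_split /=; apply: eq_bigr => l _.
have -> : (a + b - (k + l) = (a - k) + (b - l))%N.
  by have := ltn_ord k; have := ltn_ord l; lia.
rewrite mulSn !exprD addSn; ring.
Qed.

(** q-Vandermonde for n = z + (n - z) expands [gb n A], with A - a taken from z and a from n - z;
    then [gb n z * gb (n - z) a] is regrouped as [gb n (z + a) * gb (z + a) z]. The product becomes
    linear in binomials of n, ready for summation over n. *)
Lemma gb_linear n z A :
  gb n z * gb n A =
  \sum_(a < A.+1) gb n (z + a)%N * gb (z + a)%N z * gb z (A - a)%N *
     q ^+ ((A - a) * (n - (z + a))).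
Proof.
case: (leqP z n) => zn; last first.
  rewrite gb_small // mul0r big1 // => a _.
  by rewrite (@gb_small _ _ n) ?mul0r //; lia.
transitivity (gb n z * \sum_(k < z.+1) \sum_(l < (n - z).+1)
   gb z k * gb (n - z) l * q ^+ (k * (n - z - l)) * (k + l == A)%N%:R).
  congr (_ * _); have := gb_vandermonde z (n - z) (fun r => (r == A)%N%:R : F).
  rewrite subnKC // => e.
  have -> : gb n A = \sum_(r < n.+1) gb n r * (r == A :> nat)%:R.
    case: (leqP A n) => An; last first.
      rewrite gb_small // big1 // => r _; case: eqP => [rA|_]; last by rewrite mulr0.
      by have := ltn_ord r; lia.
    rewrite (bigD1 (Ordinal (An : (A < n.+1)%N))) //= eqxx mulr1 big1 ?addr0 // => r.
    by rewrite -val_eqE /= => /negbTE->; rewrite mulr0.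
  rewrite -e; apply: eq_bigr => k _; rewrite mulr_sumr; apply: eq_bigr => l _; ring.
rewrite exchange_big /= mulr_sumr.
have inner (a : nat) : (a < (n - z).+1)%N ->
  \sum_(k < z.+1) gb z k * gb (n - z) a * q ^+ (k * (n - z - a)) * (k + a == A)%N%:R
  = if (a <= A)%N then gb z (A - a) * gb (n - z) a * q ^+ ((A - a) * (n - z - a)) else 0.
  move=> _; case: (leqP a A) => aA; last first.
    by rewrite big1 // => k _; case: eqP => [|_]; rewrite ?mulr0 //; lia.
  case: (leqP (A - a) z) => Az; last first.
    rewrite (@gb_small _ _ z (A - a)) // !mul0r big1 // => k _.
    by case: eqP => [|_]; rewrite ?mulr0 //; have := ltn_ord k; lia.
  rewrite (bigD1 (Ordinal (Az : (A - a < z.+1)%N))) //= subnK // eqxx mulr1 big1 ?addr0 // => k.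
  rewrite -val_eqE /= => h; case: eqP => [e|_]; rewrite ?mulr0 //.
  by case/eqP: h; lia.
transitivity (\sum_(a < (n - z).+1) gb n z * (if (a <= A)%N then gb z (A - a) * gb (n - z) a * q ^+ ((A -
  a) * (n - z - a)) else 0)).
  by apply: eq_bigr => a _; congr (_ * _); apply: inner.
have -> : \sum_(a < A.+1) gb n (z + a) * gb (z + a) z * gb z (A - a) * q ^+ ((A - a) * (n - (z + a)))
   = \sum_(a < (A + n).+1) gb n z * (if (a <= A)%N then gb z (A - a) * gb (n - z) a * q ^+ ((A - a) * (n -
     z - a)) else 0).
  rewrite (big_ord_widen (A + n).+1 (fun a => gb n (z + a)%N * gb (z + a)%N z * gb z (A - a)%N *
     q ^+ ((A - a) * (n - (z + a))))) ?ltnS ?leq_addr // big_mkcond /=.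
  apply: eq_bigr => a _; rewrite ltnS; case: leqP => _; last by rewrite mulr0.
  rewrite gb_mul ?leq_addr // addKn subnDA; ring.
rewrite (big_ord_widen (A + n).+1 (fun a => gb n z * (if (a <= A)%N then gb z (A - a) * gb (n - z) a * q ^+
  ((A - a) * (n - z - a)) else 0))); last by lia.
rewrite big_mkcond /=; apply: eq_bigr => a _; rewrite ltnS; case: leqP => // h.
by rewrite (@gb_small _ _ (n - z)) // mulr0 mul0r if_same mulr0.
Qed.

End GaussianSums.

(** * The two sums attached to the twist regions *)

(* Reduces an identity between monomials in [q] to one between integer exponents. *)
Ltac zpow q0 :=
  rewrite ?exprnP ?invr_expz -?[_^-1]exprN1 ?exprz_exp -?expfzDr //;
  congr (_ ^ _).

Section RegionSums.
Context {F : fieldType} (q : F).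
Context (q0 : q != 0).
Context (qroot : forall n, (0 < n)%N -> q ^+ n != 1).
Notation gb := (gb q).
Notation poch := (poch q).

Section RegionSumsLevel.
Context (N : nat) (x : F).
Context (xE : x = q ^+ N).

Definition bfac n : F := \prod_(i < n) (1 - x * q ^- i.+1).

Lemma bfac_ge n : (N <= n)%N -> (0 < N)%N -> bfac n = 0.
Proof.
move=> Nn N0; have h : (N.-1 < n)%N by lia.
rewrite /bfac (bigD1 (Ordinal h)) //= prednK // xE mulfV ?expf_neq0 //.
by rewrite subrr mul0r.
Qed.

Lemma gb_poch_succ M t : (t < M)%N ->
  gb M t.+1 * poch q t.+1 = gb M t * poch q t * (1 - q ^+ (M - t)).
Proof.
move=> tM; rewrite !gbE // ?(ltnW tM) //.
have e : (M - t = (M - t.+1).+1)%N by lia.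
rewrite e (pochSr _ _ (M - t.+1)) -exprS.
have h1 := poch_q_neq0 qroot (M - t.+1); have h2 := poch_q_neq0 qroot t.
have h3 := poch_q_neq0 qroot t.+1.
have h4 : 1 - q ^+ (M - t.+1).+1 != 0 by rewrite subr_eq0 eq_sym qroot.
by field; rewrite h1 h2 h3 h4.
Qed.

Lemma bfacD r t : (r + t < N)%N -> bfac (r + t) = bfac r * (gb (N.-1 - r) t * poch q t).
Proof.
elim: t => [|t IH] h; first by rewrite addn0 gbn0 // poch0 !mulr1.
rewrite gb_poch_succ; last lia.
rewrite addnS /bfac big_ord_recr /= -/(bfac _) IH; last lia.
rewrite !mulrA; congr (_ * (1 - _)).
rewrite xE (_ : N = (N.-1 - r - t) + (r + t).+1)%N ?exprD ?mulfK ?expf_neq0 //; last lia.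
by congr (_ ^+ _); lia.
Qed.

(** With n = r + t the terms are, up to the monomial on the right, q-Bernstein polynomials of degree
    N-1-r at the point q^(r+1). *)
Lemma bfac_sum r : (0 < N)%N ->
  (x / q) * \sum_(n < N) q ^- n * bfac n * gb n r * q ^- (r * n.+1) = x ^- r * bfac r.
Proof.
move=> N0; case: (leqP N r) => [Nr|rN].
  rewrite big1 ?mulr0 => [|n _]; last by rewrite gb_small ?mulr0 ?mul0r // (leq_trans (ltn_ord n)).
  by rewrite bfac_ge ?mulr0.
have [M eN] : exists M, N = (r + M.+1)%N by exists (N.-1 - r)%N; lia.
rewrite [in X in _ * X]eN big_split_ord /= big1 ?add0r => [|n _]; last first.
  by rewrite gb_small ?mulr0 ?mul0r.
have h := gb_poch_sum q0 qroot M (q ^+ r.+1).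
rewrite -[RHS]mulr1 -[X in _ = _ * X]h !mulr_sumr; apply: eq_bigr => -[t /=]; rewrite ltnS => tM _.
rewrite bfacD; last by rewrite eN; lia.
have -> : (N.-1 - r)%N = M by rewrite eN; lia.
have -> : x / q * (q ^- (r + t) * (bfac r * (gb M t * poch q t)) * gb (r + t) r * q ^- (r * (r + t).+1))
  = x / q * q ^- (r + t) * q ^- (r * (r + t).+1) * (bfac r * gb M t * (gb (r + t) r * poch q t)).
  ring.
have -> : gb (r + t) r * poch q t = poch (q ^+ r.+1) t.
  rewrite addnC gbDE addnC pochD -exprS.
  by field; rewrite !poch_q_neq0.
have -> : x / q * q ^- (r + t) * q ^- (r * (r + t).+1) = x ^- r * q ^+ r.+1 ^+ (M - t).
  have [u eu] : exists u, M = (u + t)%N by exists (M - t)%N; rewrite subnK.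
  rewrite xE eN eu addnK; zpow q0; lia.
ring.
Qed.

(** After [gb_linear], the powers of q that involve n recombine into the weight of [bfac_sum] for r
    = z + a. *)
Lemma bfac_bilinear z A : (0 < N)%N ->
  (x / q) * \sum_(n < N) q ^- n * bfac n * (gb n z * q ^- (z * n.+1)) *
                                          (gb n A * q ^- (A * n.+1)) =
  \sum_(a < A.+1) x ^- (z + a) * bfac (z + a) * gb (z + a)%N z * gb z (A - a)%N *
     q ^- ((A - a) * (z + a).+1).
Proof.
move=> N0.
transitivity (\sum_(a < A.+1) ((x / q) *
     \sum_(n < N) q ^- n * bfac n * gb n (z + a)%N * q ^- ((z + a) * n.+1)) *
     gb (z + a)%N z * gb z (A - a)%N * q ^- ((A - a) * (z + a).+1)); last first.
  by apply: eq_bigr => a _; rewrite bfac_sum.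
rewrite mulr_sumr.
under [RHS]eq_bigr do rewrite mulr_sumr !mulr_suml.
rewrite [RHS]exchange_big /=; apply: eq_bigr => n _.
have -> : x / q * (q ^- n * bfac n * (gb n z * q ^- (z * n.+1)) * (gb n A * q ^- (A * n.+1)))
  = x / q * q ^- n * bfac n * q ^- (z * n.+1) * q ^- (A * n.+1) * (gb n z * gb n A) by ring.
rewrite gb_linear // mulr_sumr; apply: eq_bigr => -[a /=]; rewrite ltnS => aA _.
case: (leqP (z + a) n) => h; last by rewrite (@gb_small _ _ n) //; ring.
have e : q ^- (z * n.+1) * q ^- (A * n.+1) * q ^+ ((A - a) * (n - (z + a))) =
   q ^- ((z + a) * n.+1) * q ^- ((A - a) * (z + a).+1); last first.
  transitivity (x / q * q ^- n * bfac n * (gb n (z + a) * gb (z + a) z * gb z (A - a)) *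
    (q ^- (z * n.+1) * q ^- (A * n.+1) * q ^+ ((A - a) * (n - (z + a))))); first by ring.
  by rewrite e; ring.
have [u ->] : exists u, A = (u + a)%N by exists (A - a)%N; rewrite subnK.
have [w ->] : exists w, nat_of_ord n = (w + (z + a))%N by exists (n - (z + a))%N; rewrite subnK.
rewrite !addnK; zpow q0; lia.
Qed.

Definition kern (f : nat -> F) (n : nat) : F :=
  \sum_(k < N) gb n k * q ^- (k * n.+1) * f k.

(* Up to a scalar and the factor [bfac], the first row of the array of the cup
   state after [p] full twists (see [nhwcoef_twists]). *)
Fixpoint pcoef p : nat -> F :=
  if p is p'.+1 then kern (fun k => x ^+ (2 * k) * pcoef p' k)
  else fun n => (n == 0%N)%:R.

(** The preimage of [mcoef m] under [kern], see [mcoef_kern]: the base of the Pochhammer factor now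
    depends on the inner index instead of the outer one. *)
Fixpoint mkern m : nat -> F :=
  if m is m'.+1 then fun a =>
    \sum_(k < N) gb a k * q ^- (k * a.+1) * poch (x * q ^+ k.+1) (a - k) * mkern m' k
  else fun a => (a == 0%N)%:R.

(* The linear form obtained by closing [m] full twists of the second region
   with the caps. *)
Fixpoint mcoef m : nat -> F :=
  if m is m'.+1 then fun n =>
    \sum_(j < N) gb n j * q ^- (j * n.+1) * poch (x * q ^- n) (n - j) * mcoef m' j
  else fun _ => 1.

Lemma kern_delta n : (0 < N)%N -> kern (fun k => (k == 0%N)%:R) n = 1.
Proof.
move=> N0; rewrite /kern (bigD1 (Ordinal N0)) //= gbn0 // mul0n expr0 invr1 !mulr1.
rewrite big1 ?addr0 // => k; rewrite -val_eqE /= => /negbTE->; exact: mulr0.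
Qed.

(** By induction, [kern] is moved through one full twist. After [gb_conv] the two inner sums are the
    two sides of [gb_poch_swap] with w = q^-(n+k+1) and y = x q^(k+1), so that y w = x q^-n. *)
Lemma mcoef_kern m n : (n < N)%N -> mcoef m n = kern (mkern m) n.
Proof.
elim: m n => [|m IH] n nN; first by rewrite /= kern_delta //; lia.
rewrite /= /kern.
under eq_bigr do rewrite IH // mulr_sumr.
under [RHS]eq_bigr do rewrite mulr_sumr.
rewrite exchange_big /= [RHS]exchange_big /=; apply: eq_bigr => k _.
transitivity (\sum_(j < N) gb n j * gb j k * (q ^- (j * n.+1) * q ^- (k * j.+1) *
   poch (x * q ^- n) (n - j)) * mkern m k); first by apply: eq_bigr => j _; ring.
transitivity (\sum_(j < N) gb n j * gb j k * (q ^- (j * n.+1) * q ^- (k * j.+1) *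
   poch (x * q ^+ k.+1) (j - k)) * mkern m k); last by apply: eq_bigr => j _; ring.
rewrite -!mulr_suml; congr (_ * _).
rewrite (gb_conv q0 qroot k (fun j => q ^- (j * n.+1) * q ^- (k * j.+1) * poch (x * q ^- n) (n - j)) nN).
rewrite (gb_conv q0 qroot k (fun j => q ^- (j * n.+1) * q ^- (k * j.+1) * poch (x * q ^+ k.+1) (j - k)) nN).
case: (leqP k n) => kn; last by rewrite gb_small // !mul0r.
congr (_ * _).
pose w := q ^- (n + k).+1.
transitivity (q ^- (k * n.+1 + k * k.+1) *
   \sum_(t < (n - k).+1) gb (n - k) t * (w ^+ t * poch (x * q ^+ k.+1) t)); last first.
  rewrite mulr_sumr; apply: eq_bigr => t _; rewrite addKn.
  have -> : q ^- ((k + t) * n.+1) * q ^- (k * (k + t).+1) =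
     q ^- (k * n.+1 + k * k.+1) * w ^+ t; last by ring.
  rewrite /w; zpow q0; lia.
rewrite gb_poch_swap // mulr_sumr; apply: eq_bigr => t _.
have -> : x * q ^+ k.+1 * w = x * q ^- n.
  rewrite /w -mulrA; congr (_ * _); zpow q0; lia.
rewrite subnDA.
have -> : q ^- ((k + t) * n.+1) * q ^- (k * (k + t).+1) =
     q ^- (k * n.+1 + k * k.+1) * w ^+ t; last by ring.
rewrite /w; zpow q0; lia.
Qed.

Lemma kern_pairing f g : (0 < N)%N ->
  (x / q) * \sum_(n < N) q ^- n * bfac n * kern f n * kern g n =
  \sum_(z < N) \sum_(A < N) f z * g A *
    \sum_(a < A.+1) x ^- (z + a) * bfac (z + a) * gb (z + a)%N z * gb z (A - a)%N *
     q ^- ((A - a) * (z + a).+1).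
Proof.
move=> N0.
under [RHS]eq_bigr do under eq_bigr do rewrite -bfac_bilinear // mulrCA mulr_sumr.
under [RHS]eq_bigr do rewrite -mulr_sumr exchange_big /=.
rewrite -mulr_sumr; congr (_ * _); rewrite [RHS]exchange_big /=.
apply: eq_bigr => n _; rewrite /kern -mulrA mulr_suml mulr_sumr.
apply: eq_bigr => z _; rewrite !mulr_sumr; apply: eq_bigr => A _; ring.
Qed.

End RegionSumsLevel.
End RegionSums.

(** * q-series satisfied by the half-twists *)

Lemma bin2_sq k : ('C(k, 2) * 2 + k = k * k)%N.
Proof. by elim: k => // k IH; rewrite binS bin1; lia. Qed.

Section FullTwist.
Context {F : fieldType} (q : F).
Context (q0 : q != 0).
Context (qroot : forall n, (0 < n)%N -> q ^+ n != 1).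
Notation gb := (gb q).
Notation poch := (poch q).

Lemma gb_pascal_sum' n (G : nat -> F) :
  \sum_(k < n.+2) gb n.+1 k * G k =
  \sum_(k < n.+1) gb n k * (G k.+1 + q ^+ k * G k).
Proof.
under [RHS]eq_bigr do rewrite mulrDr.
rewrite [RHS]big_split /= [LHS]big_ord_recl gbn0 //.
under [X in _ + X = _]eq_bigr do rewrite lift0 gbSS // mulrDl.
rewrite big_split /= addrCA; congr (_ + _).
rewrite [RHS]big_ord_recl gbn0 // big_ord_recr /= gb_small // mulr0 mul0r addr0.
rewrite expr0 !mul1r; congr (_ + _); apply: eq_bigr => k _; rewrite bump0; ring.
Qed.

Lemma poch_flip b k : b != 0 ->
  poch b k = (-1) ^+ k * b ^+ k * q ^+ 'C(k, 2) * poch (q / (b * q ^+ k)) k.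
Proof.
move=> b0.
have -> : (-1) ^+ k * b ^+ k * q ^+ 'C(k, 2) = \prod_(i < k) (- b * q ^+ i).
  elim: k => [|k IH]; first by rewrite big_ord0 bin_small // !expr0 !mulr1.
  by rewrite big_ord_recr /= -IH binS bin1 exprD !exprS; ring.
rewrite /poch [X in _ = _ * X](reindex_inj rev_ord_inj) /= -big_split /=.
apply: eq_bigr => i _; rewrite mulrBr mulr1.
have -> : - b * q ^+ i * (q / (b * q ^+ k) * q ^+ (k - i.+1)) = -1; last by ring.
have -> : q ^+ k = q ^+ i.+1 * q ^+ (k - i.+1) by rewrite -exprD subnKC.
by rewrite exprS; field; rewrite ?b0 ?q0 ?expf_neq0.
Qed.

Lemma poch_negpow M t : (t <= M)%N ->
  poch (q ^- M) t = (-1) ^+ t * q ^ ('C(t, 2)%:Z - (M * t)%N%:Z) * (gb M t * poch q t).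
Proof.
elim: t => [|t IH] tM.
  by rewrite !poch0 gbn0 // bin_small // muln0 subrr expr0z !mulr1.
rewrite pochSr IH ?(ltnW tM) // gb_poch_succ //.
have [u ->] : exists u, M = (u + t)%N by exists (M - t)%N; rewrite subnK // ltnW.
rewrite addnK.
have -> : q ^- (u + t) * q ^+ t = q ^- u by zpow q0; lia.
have -> : q ^ ('C(t.+1, 2)%:Z - ((u + t) * t.+1)%N%:Z) =
   q ^ ('C(t, 2)%:Z - ((u + t) * t)%N%:Z) * q ^- u.
  by zpow q0; rewrite binS bin1; lia.
rewrite exprS.
have -> : 1 - q ^- u = - q ^- u * (1 - q ^+ u) by rewrite mulrBr mulr1 mulNr [_ * _]mulVf ?expf_neq0 //; ring.
ring.
Qed.

Section FullTwistLevel.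
Context (N : nat) (x : F).
Context (xE : x = q ^+ N).

Lemma x_neq0 : x != 0. Proof. by rewrite xE expf_neq0. Qed.

Lemma bfac_split n k : (k <= n)%N -> bfac q x n = bfac q x k * poch (x * q ^- n) (n - k).
Proof.
move=> kn; have -> : n = (k + (n - k))%N by lia.
set t := (n - k)%N; rewrite addKn /bfac big_split_ord /=; congr (_ * _).
rewrite /poch (reindex_inj rev_ord_inj) /=; apply: eq_bigr => i _.
congr (1 - _); rewrite -mulrA; congr (_ * _).
have := ltn_ord i; move: (nat_of_ord i) => {}i it.
have [u ->] : exists u, t = (u + i.+1)%N by exists (t - i.+1)%N; rewrite subnK.
rewrite addnK; zpow q0; lia.
Qed.

(* What invariance under E says about normalized highest weight coefficients. *)
Definition invariant_array (w : nat -> nat -> F) :=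
  forall i j, ((i + j).+1 < N)%N -> w i j = w i j.+1 + q ^- j * w i.+1 j.

(** Iterates w(i, n+1) = w(i, n) - q^-n w(i+1, n), which lowers the second index until only the
    first column remains. *)
Lemma array_column w i n : invariant_array w -> (i + n < N)%N ->
  w i n = \sum_(l < n.+1) gb n l * ((-1) ^+ l * q ^ ('C(l.+1, 2)%:Z - (l * n)%N%:Z) * w (i + l)%N 0%N).
Proof.
move=> inv; elim: n i => [|n IH] i h.
  by rewrite big_ord_recl big_ord0 gbn0 // bin_small // mul0n subrr expr0z !mul1r addn0 addr0.
rewrite (gb_pascal_sum' _ (fun l => (-1) ^+ l * q ^ ('C(l.+1, 2)%:Z - (l * n.+1)%N%:Z) * w (i + l)%N 0%N)).
have -> : w i n.+1 = w i n - q ^- n * w i.+1 n by rewrite (inv i n) ?addrK //; lia.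
rewrite IH ?IH; [|lia|lia].
rewrite mulr_sumr -sumrB; apply: eq_bigr => l _.
have -> : q ^+ l * ((-1) ^+ l * q ^ ('C(l.+1, 2)%:Z - (l * n.+1)%N%:Z) * w (i + l)%N 0%N) =
  (-1) ^+ l * q ^ ('C(l.+1, 2)%:Z - (l * n)%N%:Z) * w (i + l)%N 0%N.
  rewrite mulrA mulrCA -!mulrA; congr (_ * _); rewrite !mulrA; congr (_ * _); zpow q0; lia.
have -> : q ^ ('C(l.+2, 2)%:Z - (l.+1 * n.+1)%N%:Z) = q ^- n * q ^ ('C(l.+1, 2)%:Z - (l * n)%N%:Z).
  zpow q0; rewrite (binS l.+1) bin1; lia.
rewrite addSnnS exprS; ring.
Qed.

(** The same recursion solved for w(i+1, j), which lowers the first index. *)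
Lemma array_row w i j : invariant_array w -> (i + j < N)%N ->
  w i j = \sum_(k < i.+1) gb i k * ((-1) ^+ k * q ^+ ('C(k, 2) + i * j) * w 0%N (j + k)%N).
Proof.
move=> inv; elim: i j => [|i IH] j h.
  by rewrite big_ord_recl big_ord0 gbn0 // bin_small // !mul1r addn0 addr0.
rewrite (gb_pascal_sum qroot _ (fun k => (-1) ^+ k * q ^+ ('C(k, 2) + i.+1 * j) * w 0%N (j + k)%N)) //.
have -> : w i.+1 j = q ^+ j * w i j - q ^+ j * w i j.+1.
  by rewrite (inv i j); [field; rewrite expf_neq0 | lia].
rewrite IH ?IH; [|lia|lia].
rewrite !mulr_sumr -sumrB; apply: eq_bigr => -[k /= ki] _.
have -> : q ^+ (i - k) * ((-1) ^+ k.+1 * q ^+ ('C(k.+1, 2) + i.+1 * j) * w 0%N (j + k.+1)%N)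
  = - ((-1) ^+ k * (q ^+ j * q ^+ ('C(k, 2) + i * j.+1)) * w 0%N (j.+1 + k)%N).
  rewrite addSnnS.
  have -> : q ^+ j * q ^+ ('C(k, 2) + i * j.+1) = q ^+ (i - k) * q ^+ ('C(k.+1, 2) + i.+1 * j).
    rewrite -!exprD; congr (_ ^+ _); rewrite binS bin1; lia.
  rewrite exprS; ring.
have -> : q ^+ ('C(k, 2) + i.+1 * j) = q ^+ j * q ^+ ('C(k, 2) + i * j).
  rewrite -exprD; congr (_ ^+ _); lia.
ring.
Qed.

(** Each half-twist turns the first row of an array into the first column of the next, and
    [array_column] recovers the first row. The composition of two such transforms has an inner sum
    that the q-binomial theorem evaluates to the Pochhammer factor. *)
Lemma full_twist kappa w0 w1 w2 n :
  invariant_array w1 -> invariant_array w2 ->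
  (forall i, (i < N)%N -> w1 i 0%N = kappa * x ^+ i * q ^- i * w0 0%N i) ->
  (forall i, (i < N)%N -> w2 i 0%N = kappa * x ^+ i * q ^- i * w1 0%N i) ->
  (n < N)%N ->
  w2 0%N n = kappa ^+ 2 * \sum_(k < N) gb n k * (q ^- (k * n.+1) * x ^+ (2 * k) *
     poch (x * q ^- n) (n - k) * w0 0%N k).
Proof.
move=> inv1 inv2 e1 e2 nN.
(* The kernel of a single half-twist on first rows, apart from the binomial. *)
pose c (l n' : nat) : F := (-1) ^+ l * q ^ ('C(l.+1, 2)%:Z - (l * n')%N%:Z) * (kappa * x ^+ l * q ^- l).
have half w w' n' : invariant_array w' ->
  (forall i, (i < N)%N -> w' i 0%N = kappa * x ^+ i * q ^- i * w 0%N i) -> (n' < N)%N ->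
  w' 0%N n' = \sum_(l < N) gb n' l * (c l n' * w 0%N l).
  move=> inv' e' n'N; rewrite (array_column inv') // (@big_gb _ _ n' N (fun l => c l n' * w 0%N l)) //.
  apply: eq_bigr => -[l /= ln] _; rewrite e' ?mulrA //; lia.
rewrite (half w1 w2) //.
under eq_bigr => l _ do rewrite (half w0 w1) // !mulr_sumr.
rewrite exchange_big /= mulr_sumr; apply: eq_bigr => k _.
transitivity ((\sum_(l < N) gb n l * gb l k * (c l n * c k l)) * w0 0%N k).
  rewrite mulr_suml; apply: eq_bigr => l _; ring.
rewrite (gb_conv q0 qroot k (fun l => c l n * c k l) nN).
case: (leqP k n) => kn; last by rewrite gb_small // !mul0r mulr0.
rewrite -(gb_binomial qroot (n - k) (x * q ^- n)).
transitivity (gb n k * (kappa ^+ 2 * q ^- (k * n.+1) * x ^+ (2 * k) *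
  \sum_(t < (n - k).+1) gb (n - k) t * ((-1) ^+ t * q ^+ 'C(t, 2) * (x * q ^- n) ^+ t)) * w0 0%N k); last
    by ring.
congr (_ * _ * _); rewrite mulr_sumr; apply: eq_bigr => t _.
have -> : c (k + t)%N n * c k (k + t)%N = kappa ^+ 2 * (x ^+ (2 * k) * x ^+ t) * (-1) ^+ t *
  (q ^- (k * n.+1) * (q ^+ 'C(t, 2) * q ^- (n * t))).
  rewrite /c.
  have -> : q ^- (k * n.+1) * (q ^+ 'C(t, 2) * q ^- (n * t)) =
     q ^ ('C((k + t).+1, 2)%:Z - ((k + t) * n)%N%:Z) * q ^ ('C(k.+1, 2)%:Z - (k * (k + t))%N%:Z) *
     q ^- (k + t) * q ^- k.
    zpow q0; rewrite !(binS _ 1) !bin1 bin2D; have := bin2_sq k; lia.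
  rewrite mul2n -addnn !exprD; have : (-1) ^+ k * (-1) ^+ k = 1 :> F by rewrite -expr2 sqrr_sign.
  move=> e; transitivity (((-1) ^+ k * (-1) ^+ k) * (kappa ^+ 2 * (x ^+ k * x ^+ k * x ^+ t) * (-1) ^+ t *
    (q ^ ('C((k + t).+1, 2)%:Z - ((k + t) * n)%N%:Z) * q ^ ('C(k.+1, 2)%:Z - (k * (k + t))%N%:Z) *
     (q ^- (k + t) * q ^- k)))); last by rewrite e mul1r exprD; ring.
  by rewrite exprD; ring.
rewrite exprMn exprVn -exprM; ring.
Qed.

End FullTwistLevel.
End FullTwist.

(** * Transforms of the second twist region and of the caps *)

Section CapTwist.
Context {F : fieldType} (q : F).
Context (q0 : q != 0).
Context (qroot : forall n, (0 < n)%N -> q ^+ n != 1).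
Notation gb := (gb q).
Notation poch := (poch q).
Context (N : nat) (x : F).
Context (xE : x = q ^+ N).
Notation x0 := (x_neq0 q0 xE).

(** Since q^(n+1)/x = q^-M, the Pochhammer factor is a signed multiple of [gb M t * poch q t], and
    [gb (n + t) n * poch q t] equals [poch (q ^+ n.+1) t]. The sum is then [gb_poch_alt] at b =
    q^(n+1). *)
Lemma gb_poch_geom n M : N = (n + M.+1)%N ->
  \sum_(t < M.+1) gb (n + t)%N n * (poch (q ^+ n.+1 / x) t * q ^+ t) = q ^+ (n.+1 * M).
Proof.
move=> eN; rewrite exprM -(gb_poch_alt q0 qroot M (q ^+ n.+1)).
apply: eq_bigr => -[t /=]; rewrite ltnS => tM _.
have -> : q ^+ n.+1 / x = q ^- M by rewrite xE eN; zpow q0; lia.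
rewrite poch_negpow //.
have -> : q ^ ('C(t.+1, 2)%:Z - (M * t)%N%:Z) = q ^ ('C(t, 2)%:Z - (M * t)%N%:Z) * q ^+ t.
  by zpow q0; rewrite binS bin1; lia.
transitivity (gb M t * ((-1) ^+ t * q ^ ('C(t, 2)%:Z - (M * t)%N%:Z) * q ^+ t * (gb (n + t) n * poch q t))).
  by ring.
have -> : gb (n + t) n * poch q t = poch (q ^+ n.+1) t.
  rewrite addnC gbDE addnC pochD -exprS.
  by field; rewrite !poch_q_neq0.
ring.
Qed.

(** The left side is what the series of R^-1 produces in [middiag], see [twist_coef]; it involves a
    whole column of the array. Expanding w(l, j) by [array_row] gives a double sum over n = j + l
    and k, whose sum over n is evaluated by [gb_poch_geom]. *)
Lemma cap_twist w j : invariant_array q N w -> (j < N)%N ->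
  \sum_(l < N - j) gb (j + l)%N l * poch (q ^+ j.+1 / x) l * (q ^+ (l + j) * q ^- (j * l)) * w l j =
  x ^+ j.+1 * \sum_(n < N) gb n j * (q ^- (n * j.+1).+1 * poch (x * q ^- n) (n - j) * w 0%N n).
Proof.
move=> inv jN.
pose g n k := (-1) ^+ k * q ^+ 'C(k, 2) * q ^+ (n - j) * q ^+ j * poch (q ^+ j.+1 / x) (n - j) * w 0%N (j +
  k)%N.
transitivity (\sum_(n < N) \sum_(k < N) gb n (j + k)%N * gb (j + k)%N j * g n k).
  have -> : \sum_(n < N) \sum_(k < N) gb n (j + k)%N * gb (j + k)%N j * g n k =
     \sum_(l < N - j) \sum_(k < N) gb (j + l)%N (j + k)%N * gb (j + k)%N j * g (j + l)%N k.
    have [u ->] : exists u, N = (j + u)%N by exists (N - j)%N; rewrite subnKC // ltnW.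
    rewrite addKn big_split_ord /= big1 ?add0r // => n _; rewrite big1 // => k _.
    by rewrite gb_small ?mul0r //; have := ltn_ord n; lia.
  apply: eq_bigr => -[l /= lN] _.
  rewrite (array_row q0 qroot inv) ?mulr_sumr; last by lia.
  have e k : gb (j + l) (j + k) * gb (j + k) j * g (j + l)%N k =
    gb l k * (gb (j + l) l * g (j + l)%N k).
    rewrite gb_mul ?leq_addr // !addKn.
    have -> : gb (j + l) j = gb (j + l) l by rewrite -(@gb_sub _ q _ _ (leq_addl j l)) addnK.
    ring.
  under [RHS]eq_bigr do rewrite e.
  rewrite (@big_gb _ q l N (fun k => gb (j + l) l * g (j + l)%N k)); last by lia.
  apply: eq_bigr => k _; rewrite /g addKn.
  have -> : q ^+ ('C(k, 2) + l * j) = q ^+ 'C(k, 2) * q ^+ (j * l) by rewrite exprD mulnC.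
  by rewrite exprD; field; rewrite expf_neq0.
rewrite exchange_big /= mulr_sumr.
have -> : \sum_(n < N) x ^+ j.+1 * (gb n j * (q ^- (n * j.+1).+1 * poch (x * q ^- n) (n - j) * w 0%N n))
  = \sum_(k < N) if (j + k < N)%N then x ^+ j.+1 * (gb (j + k)%N j * (q ^- ((j + k) * j.+1).+1 * poch (x *
    q ^- (j + k)) k * w 0%N (j + k)%N)) else 0.
  have [u ->] : exists u, N = (j + u)%N by exists (N - j)%N; rewrite subnKC // ltnW.
  rewrite big_split_ord /= big1 ?add0r => [|n _]; last by rewrite gb_small ?mul0r ?mulr0.
  under [RHS]eq_bigr do rewrite ltn_add2l.
  pose G k := x ^+ j.+1 * (gb (j + k)%N j * (q ^- ((j + k) * j.+1).+1 *
    poch (x * q ^- (j + k)) k * w 0%N (j + k)%N)).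
  rewrite -big_mkcond /= -(big_ord_widen (j + u)%N G) ?leq_addl //.
  by apply: eq_bigr => k _; rewrite addKn.
apply: eq_bigr => -[k /= _] _; case: ltnP => [jkN|jkN]; last first.
  by rewrite big1 // => n _; rewrite gb_small ?mul0r // (leq_trans (ltn_ord n)).
have [M eN] : exists M, N = (j + k + M.+1)%N by exists (N - (j + k)).-1; lia.
transitivity (gb (j + k) j * ((-1) ^+ k * q ^+ 'C(k, 2) * q ^+ j * w 0%N (j + k)%N) *
   (q ^+ k * poch (q ^+ j.+1 / x) k * q ^+ ((j + k).+1 * M))).
  rewrite -(gb_poch_geom eN) !mulr_sumr.
  rewrite [in LHS]eN big_split_ord /= big1 ?add0r => [|n _]; last by rewrite gb_small ?mul0r.
  apply: eq_bigr => t _; rewrite /g.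
  have -> : (j + k + t - j = k + t)%N by lia.
  rewrite pochD exprD.
  have -> : q ^+ j.+1 / x * q ^+ k = q ^+ (j + k).+1 / x by rewrite mulrAC -exprD addSn.
  ring.
(* Reversing the product changes the base from q^(j+1)/x to x q^-(j+k). *)
rewrite poch_flip //; last by rewrite mulf_neq0 ?invr_eq0 ?expf_neq0 ?x0.
have -> : q / (q ^+ j.+1 / x * q ^+ k) = x * q ^- (j + k).
  rewrite exprS exprD; field; by rewrite x0 q0 !expf_neq0.
have -> : gb (j + k) j * ((-1) ^+ k * q ^+ 'C(k, 2) * q ^+ j * w 0%N (j + k)%N) *
  (q ^+ k * ((-1) ^+ k * (q ^+ j.+1 / x) ^+ k * q ^+ 'C(k, 2) * poch (x * q ^- (j + k)) k) * q ^+ ((j +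
    k).+1 * M))
  = ((-1) ^+ k * (-1) ^+ k) * (q ^+ 'C(k, 2) * q ^+ j * q ^+ k * (q ^+ j.+1 / x) ^+ k * q ^+ 'C(k, 2) * q
    ^+ ((j + k).+1 * M)) *
  (gb (j + k) j * (poch (x * q ^- (j + k)) k * w 0%N (j + k)%N)) by ring.
rewrite -expr2 sqrr_sign mul1r.
have -> : q ^+ 'C(k, 2) * q ^+ j * q ^+ k * (q ^+ j.+1 / x) ^+ k * q ^+ 'C(k, 2) * q ^+ ((j + k).+1 * M)
  = x ^+ j.+1 * q ^- ((j + k) * j.+1).+1; last by ring.
have -> : q ^+ j.+1 / x = q ^- (k + M) by rewrite xE eN; zpow q0; lia.
rewrite exprVn xE eN; zpow q0; have := bin2_sq k; lia.
Qed.

(** For fixed n the factor x^(j+1) completes the sum over j to the q-Bernstein sum at x q^-n, so the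
    caps undo the last transform. *)
Lemma cap_total (f : nat -> F) :
  \sum_(j < N) x ^+ j.+1 *
     \sum_(n < N) gb n j * (q ^- (n * j.+1).+1 * poch (x * q ^- n) (n - j) * f n) =
  (x / q) * \sum_(n < N) q ^- n * f n.
Proof.
under eq_bigr do rewrite mulr_sumr.
rewrite exchange_big /= mulr_sumr; apply: eq_bigr => n _.
have h := gb_poch_sum q0 qroot n (x * q ^- n).
rewrite (gb_rev q n (fun t => poch (x * q ^- n) t * (x * q ^- n) ^+ (n - t))) in h.
rewrite -[RHS]mul1r -{1}h.
rewrite -(@big_gb _ q n N (fun j => poch (x * q ^- n) (n - j) * (x * q ^- n) ^+ (n - (n - j))) (ltn_ord n)).
rewrite mulr_suml; apply: eq_bigr => j _.
case: (leqP j n) => jn; last by rewrite gb_small // !mul0r mulr0.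
rewrite subKn // exprMn.
have -> : q ^- (n * j.+1).+1 = q ^- 1 * q ^- n * q ^- n ^+ j by zpow q0; lia.
rewrite expr1 exprS; ring.
Qed.

Definition cap_step (f : nat -> F) (j : nat) : F :=
  (x / q) * \sum_(n < N) gb n j * (q ^- (n * j.+1) * poch (x * q ^- n) (n - j) * f n).

(** For the weight q^-j, the adjoint of [cap_step] is the recursion of [mcoef]: full twists can be
    moved from the tensor to the linear form of the caps. *)
Lemma cap_step_dual m (f : nat -> F) :
  \sum_(j < N) q ^- j * mcoef q N x m j * cap_step f j =
  (x / q) * \sum_(n < N) q ^- n * mcoef q N x m.+1 n * f n.
Proof.
rewrite /cap_step; under eq_bigr do rewrite mulrCA mulr_sumr.
rewrite -mulr_sumr; congr (_ * _); rewrite exchange_big /=.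
apply: eq_bigr => n _; rewrite mulr_sumr mulr_suml; apply: eq_bigr => j _.
have e : q ^- j * q ^- (n * j.+1) = q ^- n * q ^- (j * n.+1) by zpow q0; lia.
transitivity (gb n j * poch (x * q ^- n) (n - j) * mcoef q N x m j * f n * (q ^- j * q ^- (n * j.+1)));
  first by ring.
by rewrite e; ring.
Qed.

End CapTwist.

(** * The R-matrix *)

Section Graded.
Context {F : fieldType} (N : nat).
Implicit Types (A : 'M[F]_N) (w : 'I_N -> int).

Lemma graded_exp w c A l : (forall i j, A i j != 0 -> w i = w j + c) ->
  forall i j, (A ^+ l) i j != 0 -> w i = w j + l%:Z * c.
Proof.
move=> gA; elim: l => [|l IH] i j.
  rewrite expr0 mxE; case: (i =P j) => [->|_]; rewrite ?eqxx //; lia.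
rewrite exprS -mulmxE mxE => /eqP h.
have [m hm] : exists m, A i m * (A ^+ l) m j != 0.
  apply/existsP; apply: contraT; rewrite negb_exists => /forallP h'.
  by case: h; apply: big1 => m _; apply/eqP; move: (h' m); rewrite negbK.
move: hm; rewrite mulf_eq0 negb_or => /andP[/gA-> /IH->]; lia.
Qed.

End Graded.

(** * Matrices of E, F and K on V and on its dual *)

Section Representations.
Context {F : fieldType} (s : F).
Context (s0 : s != 0) (sroot : forall n, (0 < n)%N -> s ^+ n != 1).
Context (N : nat).
Notation v := (vq s).
Notation z := (vq s - (vq s)^-1).
Notation E := (repE s N).
Notation Fm := (repF s N).

Lemma v0 : v != 0. Proof. by rewrite expf_neq0. Qed.

Lemma vroot n : (0 < n)%N -> v ^+ n != 1.
Proof. by move=> n0; rewrite -exprM sroot // muln_gt0. Qed.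

Lemma z0 : z != 0.
Proof.
apply: contra (@vroot 2 isT) => /eqP h.
have : v * z = 0 by rewrite h mulr0.
by rewrite mulrBr mulfV ?v0 // -expr2 => /eqP; rewrite subr_eq0.
Qed.

Lemma qint_neq0 n : (0 < n)%N -> qint s n != 0.
Proof.
move=> n0; rewrite /qint mulf_neq0 ?invr_eq0 ?z0 //.
apply: contra (@vroot (n * 2) _); last by rewrite muln_gt0 n0.
move/eqP => h; have : v ^+ n * (v ^+ n - v ^- n) = 0 by rewrite h mulr0.
by rewrite mulrBr mulfV ?expf_neq0 ?v0 // -expr2 -exprM => /eqP; rewrite subr_eq0.
Qed.

Lemma qfactS n : qfact s n.+1 = qfact s n * qint s n.+1.
Proof. by rewrite /qfact big_nat_recr. Qed.

Lemma qfact0 : qfact s 0 = 1.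
Proof. by rewrite /qfact big_geq. Qed.

Lemma qfact_neq0 n : qfact s n != 0.
Proof. by elim: n => [|n IH]; rewrite ?qfact0 ?oner_eq0 // qfactS mulf_neq0 ?qint_neq0. Qed.

Definition repK (o : bool) (e : int) : 'M[F]_N := diag_mx (\row_i v ^ (e * oweight o i)).

Lemma mul_repK o e (A : 'M_N) i j : (repK o e *m A) i j = v ^ (e * oweight o i) * A i j.
Proof. by rewrite mul_diag_mx !mxE. Qed.

Lemma mul_mx_repK o e (A : 'M_N) i j : (A *m repK o e) i j = A i j * v ^ (e * oweight o j).
Proof. by rewrite mul_mx_diag !mxE. Qed.

Lemma tr_repK o e : (repK o e)^T = repK o e.
Proof. by rewrite tr_diag_mx. Qed.

Lemma repKVK o : repK o 1 *m repK o (-1) = 1%:M.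
Proof.
apply/matrixP => i j; rewrite mul_repK !mxE.
case: eqP => [->|_]; rewrite ?mulr1n ?mulr0n ?mulr0 //.
by rewrite -expfzDr ?v0 // mul1r mulN1r subrr.
Qed.

Lemma matK_repK e : matK s N e = repK true e.
Proof. by []. Qed.

Lemma matEK i j : (matE s N *m matK s N (-1)) i j = matE s N i j * v ^ (- weight j).
Proof. by rewrite matK_repK mul_mx_repK mulN1r. Qed.

Lemma matKF i j : (matK s N 1 *m matF s N) i j = v ^ weight i * matF s N i j.
Proof. by rewrite matK_repK mul_repK mul1r. Qed.

Lemma repE_graded o i j : E o i j != 0 -> oweight o i = oweight o j + 2.
Proof.
case: o; rewrite /repE /oweight.
  by rewrite mxE; case: ifP => [/eqP e _|_]; rewrite ?eqxx // /weight -e; lia.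
rewrite mxE mxE matEK mxE; case: ifP => [/eqP e _|_]; rewrite ?mul0r ?oppr0 ?eqxx //.
by rewrite /weight -e; lia.
Qed.

Lemma repF_graded o i j : Fm o i j != 0 -> oweight o i = oweight o j + (-2).
Proof.
case: o; rewrite /repF /oweight.
  by rewrite mxE; case: ifP => [/eqP e _|_]; rewrite ?eqxx // /weight e; lia.
rewrite mxE mxE matKF mxE; case: ifP => [/eqP e _|_]; rewrite ?mulr0 ?oppr0 ?eqxx //.
by rewrite /weight e; lia.
Qed.

Lemma repE_nilp o : E o ^+ N = 0.
Proof.
apply/matrixP => i j; rewrite [RHS]mxE; apply/eqP; apply: contraT => h.
have := graded_exp (@repE_graded o) h; have := ltn_ord i; have := ltn_ord j.
by rewrite /oweight /weight; case: o h => _; lia.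
Qed.

Lemma qintE n : qint s n = (v ^ n%:Z - v ^ (- n%:Z)) / z.
Proof. by rewrite /qint exprnP -exprnN. Qed.

Lemma matEF_entry i j : (matE s N *m matF s N) i j =
  if i == j then qint s (N - i.+1) * qint s i.+1 else 0.
Proof.
rewrite mxE; case: (ltnP i.+1 N) => iN.
  rewrite (bigD1 (Ordinal iN)) //= big1 ?addr0 => [|m].
    rewrite !mxE /= eqxx eqSS -val_eqE /=; case: eqP => [->|_] //; exact: mulr0.
  rewrite -val_eqE /= => mi; rewrite mxE eq_sym.
  by case: eqP mi => [->|_ _]; rewrite ?eqxx ?mul0r.
have -> : (N - i.+1 = 0)%N by lia.
rewrite {1}/qint expr0 invr1 subrr !mul0r if_same big1 // => m _.
by rewrite mxE; case: eqP => [e|_]; rewrite ?mul0r //; have := ltn_ord m; lia.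
Qed.

Lemma matFE_entry i j : (matF s N *m matE s N) i j =
  if i == j then qint s i * qint s (N - i) else 0.
Proof.
rewrite mxE; case: (posnP i) => i0.
  rewrite i0 {1}/qint expr0 invr1 subrr !mul0r if_same big1 // => m _.
  by rewrite mxE; case: eqP => [e|_]; rewrite ?mul0r //; lia.
have iN : (i.-1 < N)%N by have := ltn_ord i; lia.
rewrite (bigD1 (Ordinal iN)) //= big1 ?addr0 => [|m].
  rewrite !mxE /= prednK // eqxx -val_eqE /=; case: eqP => [->|_] //; exact: mulr0.
rewrite -val_eqE /= => mi; rewrite mxE; case: eqP => [e|_]; rewrite ?mul0r //.
by case/eqP: mi; lia.
Qed.

Lemma matEF_comm :
  matE s N *m matF s N - matF s N *m matE s N = z^-1 *: (repK true 1 - repK true (-1)).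
Proof.
apply/matrixP => i j; rewrite mxE [X in _ + X = _]mxE matEF_entry matFE_entry !mxE.
have [_|ij] := eqVneq i j; last by rewrite !mulr0n !subr0 mulr0.
rewrite !mulr1n !qintE mul1r mulN1r /oweight /weight.
have iN := ltn_ord i.
have -> : (N - i.+1)%N%:Z = N%:Z - i%:Z - 1 by lia.
have -> : (N - i)%N%:Z = N%:Z - i%:Z by lia.
have -> : i.+1%:Z = i%:Z + 1 by lia.
rewrite (_ : N%:Z - 1 - 2 * i%:Z = N%:Z + - i%:Z + - i%:Z + -1); last by lia.
rewrite !opprD !opprK !expfzDr ?v0 //.
rewrite !exprN1 expr1z.
have nz (t : int) : v ^ t != 0 by rewrite expfz_neq0 ?v0.
have eN (t : int) : v ^ (- t) = (v ^ t)^-1 by rewrite invr_expz.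
rewrite !eN; move: (nz N%:Z) (nz i%:Z); move: (v ^ N%:Z) (v ^ i%:Z) => a b a0 b0.
have vz := z0; have vv := v0.
field; rewrite a0 b0 vv /=.
apply: contra vz => /eqP h; rewrite -(mulfK vv (v - v^-1)) mulrBl mulVf // h mul0r //.
Qed.

Lemma repEF_comm o :
  E o *m Fm o - Fm o *m E o = z^-1 *: (repK o 1 - repK o (-1)).
Proof.
case: o; first exact: matEF_comm.
rewrite /repE /repF -!trmx_mul !mulNmx !mulmxN !opprK.
have -> : matK s N 1 *m matF s N *m (matE s N *m matK s N (-1)) = matF s N *m matE s N.
  apply/matrixP => i j; rewrite -mulmxA (mulmxA (matF s N)) !matK_repK mul_repK mul_mx_repK matFE_entry.
  case: eqP => [->|_]; rewrite ?mul0r ?mulr0 // mulrCA -expfzDr ?v0 //.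
  by rewrite mul1r mulN1r subrr mulr1.
have -> : matE s N *m matK s N (-1) *m (matK s N 1 *m matF s N) = matE s N *m matF s N.
  rewrite -mulmxA (mulmxA (matK s N (-1))).
  have -> : matK s N (-1) *m matK s N 1 = 1%:M by rewrite !matK_repK; exact: (mulmx1C (repKVK true)).
  by rewrite mul1mx.
rewrite -raddfB /= -opprB matEF_comm; apply/matrixP => i j; rewrite !mxE /oweight.
rewrite !mul1r !mulN1r opprK eq_sym; case: eqP => [->|_]; rewrite ?mulr1n ?mulr0n; ring.
Qed.

End Representations.

(** * The left-handed half-twist as an intertwiner *)

Section HalfTwists.
Context {F : fieldType} (s : F).
Context (s0 : s != 0) (sroot : forall n, (0 < n)%N -> s ^+ n != 1).
Context (N : nat).
Notation v := (vq s).
Notation z := (vq s - (vq s)^-1).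
Notation E := (repE s N).
Notation Fm := (repF s N).
Notation K := (repK s N).

Lemma repF_exp_K o l : Fm o ^+ l *m K o 1 = v ^+ (2 * l) *: (K o 1 *m Fm o ^+ l).
Proof.
apply/matrixP => i j; rewrite [RHS]mxE mul_mx_repK mul_repK.
have [->|h] := eqVneq ((Fm o ^+ l) i j) 0; first by rewrite mulr0 mul0r mulr0.
rewrite (graded_exp (@repF_graded _ s s0 N o) h) mulrCA mulrA mulrC; congr (_ * _).
by rewrite exprnP -expfzDr ?v0 //; congr (_ ^ _); lia.
Qed.

Lemma repK_F o : K o (-1) *m Fm o = v ^+ 2 *: (Fm o *m K o (-1)).
Proof.
apply/matrixP => i j; rewrite [RHS]mxE mul_mx_repK mul_repK.
have [->|h] := eqVneq ((Fm o) i j) 0; first by rewrite mulr0 mul0r mulr0.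
rewrite (repF_graded s0 h) mulrCA; rewrite mulrC; congr (_ * _).
by rewrite exprnP -expfzDr ?v0 //; congr (_ ^ _); lia.
Qed.

Lemma v2_neq1 : v * v - 1 != 0.
Proof. by rewrite subr_eq0 -expr2 vroot. Qed.

Lemma repEF_exp_comm o l :
  E o *m Fm o ^+ l.+1 - Fm o ^+ l.+1 *m E o =
  (v ^+ l * qint s l.+1 / z) *: (K o 1 *m Fm o ^+ l - Fm o ^+ l *m K o (-1)).
Proof.
have vv := v0 s0; have vz := z0 s0 sroot.
elim: l => [|l IH].
  rewrite expr1 repEF_comm // expr0 mulmx1 mul1mx; congr (_ *: _).
  by rewrite mul1r /qint !expr1 divff // mul1r.
rewrite [in LHS]exprSr -!mulmxE.
have -> : E o *m (Fm o ^+ l.+1 *m Fm o) - Fm o ^+ l.+1 *m Fm o *m E o =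
  (E o *m Fm o ^+ l.+1 - Fm o ^+ l.+1 *m E o) *m Fm o + Fm o ^+ l.+1 *m (E o *m Fm o - Fm o *m E o).
  by rewrite mulmxBl mulmxBr !mulmxA addrA subrK.
rewrite IH repEF_comm // -scalemxAl -scalemxAr mulmxBl mulmxBr.
rewrite -!mulmxA repK_F // -scalemxAr !mulmxA repF_exp_K //.
have -> : K o 1 *m Fm o ^+ l *m Fm o = K o 1 *m Fm o ^+ l.+1 by rewrite -mulmxA exprSr.
have -> : Fm o ^+ l *m Fm o = Fm o ^+ l.+1 by rewrite exprSr.
set A := K o 1 *m _; set B := Fm o ^+ l.+1 *m K o (-1).
rewrite !scalerBr !scalerA addrACA -opprD -!scalerDl; congr (_ *: _ - _ *: _).
  rewrite /qint; have -> : v ^+ (2 * l.+1) = v ^+ l.+1 * v ^+ l.+1 by rewrite -exprD; congr (_ ^+ _); lia.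
  rewrite !exprS; set a := v ^+ l; have a0 : a != 0 by rewrite expf_neq0.
  have v1 := v2_neq1; move: vv v1 a0; move: v a => y a vv v1 a0.
  by field; rewrite vv v1 a0.
rewrite /qint !exprS; set a := v ^+ l; have a0 : a != 0 by rewrite expf_neq0.
have v1 := v2_neq1; move: vv v1 a0; move: v a => y a vv v1 a0.
by field; rewrite vv v1 a0.
Qed.

(* The l-th coefficient of R^-1. *)
Definition rcoef l : F := (-1) ^+ l * v ^- 'C(l, 2) * z ^+ l / qfact s l.

(** The left factor is the scalar in the commutator of E with F^(l+1). This ratio of coefficients
    makes consecutive terms of R^-1 cancel in [twist_actE]. *)
Lemma rcoefS l : rcoef l.+1 * (v ^+ l * qint s l.+1 / z) = - rcoef l.
Proof.
have h1 := qint_neq0 s0 sroot (ltn0Sn l); have h2 := qfact_neq0 s0 sroot l.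
have h3 := z0 s0 sroot; have h4 := v0 s0.
rewrite /rcoef qfactS binS bin1 exprD !exprS.
have h5 : v ^+ 'C(l, 2) != 0 by rewrite expf_neq0.
have h6 : v ^+ l != 0 by rewrite expf_neq0.
move: h1 h2 h3 h5 h6; move: (qint s l.+1) (qfact s l) z (v ^+ 'C(l, 2)) (v ^+ l) => a b c d e h1 h2 h3 h5 h6.
by field; rewrite h1 h2 h3 h5 h6.
Qed.

(* The flip followed by the factor q^(- H (x) H / 4) of R^-1. *)
Definition hadamard o2 o1 (X : 'M[F]_N) : 'M[F]_N :=
  \matrix_(i, j) (s ^ (- (oweight o2 i * oweight o1 j)) * X j i).

(** A tensor with two legs is stored as a matrix, on which a tensor product of A and B acts by X ->
    A X B^T. This is the left-handed half-twist in that form, see [twistE]. *)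
Definition twist o1 o2 (X : 'M[F]_N) : 'M[F]_N :=
  \sum_(l < N) rcoef l *: (E o2 ^+ l *m hadamard o2 o1 X *m (Fm o1 ^+ l)^T).

(** The coproduct of E in the same matrix form. *)
Definition actE o1 o2 (X : 'M[F]_N) : 'M[F]_N :=
  X *m (E o2)^T + E o1 *m X *m K o2 1.

Lemma twistE o1 o2 X c d :
  twist o1 o2 X c d = \sum_(a < N) \sum_(b < N) X a b * Rinvmx s o2 o1 b a c d.
Proof.
rewrite exchange_big /=.
transitivity (\sum_(l < N) \sum_(b < N) \sum_(a < N) rcoef l *
   ((E o2 ^+ l) c b * (s ^ (- (oweight o2 b * oweight o1 a)) * X a b) * (Fm o1 ^+ l) d a)).
  rewrite /twist summxE; apply: eq_bigr => l _; rewrite mxE mxE mulr_sumr.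
  under eq_bigr do rewrite mxE mulr_suml mulr_sumr.
  rewrite exchange_big /=; apply: eq_bigr => b _; apply: eq_bigr => a _.
  by rewrite !mxE.
rewrite exchange_big /=; apply: eq_bigr => b _.
rewrite exchange_big /=; apply: eq_bigr => a _.
rewrite /Rinvmx mulr_suml mulr_sumr; apply: eq_bigr => l _; rewrite /rcoef; ring.
Qed.

(** E shifts weights by 2, so passing the factor q^(- H (x) H / 4) multiplies each summand by a
    power of K on the other leg: it removes K from one summand and creates K^-1 in the other. *)
Lemma hadamard_actE o1 o2 X : hadamard o2 o1 (actE o1 o2 X) =
  E o2 *m hadamard o2 o1 X *m K o1 (-1) + hadamard o2 o1 X *m (E o1)^T.
Proof.
apply/matrixP => i j; rewrite [LHS]mxE [actE _ _ _ _ _]mxE mul_mx_repK [RHS]mxE mul_mx_repK.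
rewrite mulrDr !mxE; congr (_ + _).
  rewrite mulr_sumr mulr_suml; apply: eq_bigr => m _; rewrite !mxE.
  have [->|h] := eqVneq (E o2 i m) 0; first by rewrite mulr0 !mul0r mulr0.
  rewrite (repE_graded s0 h) (_ : s ^ (- ((oweight o2 m + 2) * oweight o1 j)) =
     s ^ (- (oweight o2 m * oweight o1 j)) * v ^ (-1 * oweight o1 j)); first ring.
  by rewrite /vq exprnP exprz_exp -expfzDr //; congr (_ ^ _); lia.
rewrite mulr_suml mulr_sumr; apply: eq_bigr => m _; rewrite !mxE.
have [->|h] := eqVneq (E o1 j m) 0; first by rewrite !mul0r !mulr0.
rewrite (repE_graded s0 h) (_ : s ^ (- (oweight o2 i * oweight o1 m)) =
   s ^ (- (oweight o2 i * (oweight o1 m + 2))) * v ^ (1 * oweight o2 i)); first ring.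
by rewrite /vq exprnP exprz_exp -expfzDr //; congr (_ ^ _); lia.
Qed.

(** The difference of the two sides is a sum of terms [f l], with the commutator of E and F^l, and
    [g l], with one more power of E. By [repEF_exp_comm] and [rcoefS], [f l.+1] cancels [g l]. *)
Lemma twist_actE o1 o2 X : twist o1 o2 (actE o1 o2 X) = actE o2 o1 (twist o1 o2 X).
Proof.
rewrite /twist hadamard_actE; set Y := hadamard o2 o1 X.
apply/eqP; rewrite -subr_eq0; apply/eqP.
pose f l := rcoef l *: (E o2 ^+ l *m Y *m (Fm o1 ^+ l *m E o1 - E o1 *m Fm o1 ^+ l)^T).
pose g l := rcoef l *: (E o2 ^+ l.+1 *m Y *m (Fm o1 ^+ l *m K o1 (-1) - K o1 1 *m Fm o1 ^+ l)^T).
transitivity (\sum_(l < N) (f l + g l)).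
  rewrite /actE mulmx_suml mulmx_sumr mulmx_suml -big_split -sumrB /=; apply: eq_bigr => l _.
  rewrite /f /g -scalerDr -scalemxAl -scalemxAr -scalemxAl -scalerDr -scalerBr; congr (_ *: _).
  rewrite ![(_ - _)^T]raddfB /= !trmx_mul !tr_repK !mulmxBr mulmxDr mulmxDl.
  have -> : E o2 *m (E o2 ^+ l *m Y *m (Fm o1 ^+ l)^T) = E o2 ^+ l.+1 *m Y *m (Fm o1 ^+ l)^T.
    by rewrite exprS -mulmxE !mulmxA.
  have -> : E o2 ^+ l *m (E o2 *m Y *m K o1 (-1)) = E o2 ^+ l.+1 *m Y *m K o1 (-1).
    by rewrite exprSr -mulmxE !mulmxA.
  by rewrite !mulmxA opprD [X in X + _ = _]addrC addrACA.
have fS l : f l.+1 = - g l.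
  rewrite /f /g -opprB raddfN /= mulmxN scalerN repEF_exp_comm [(_ *: _)^T]linearZ /=.
  rewrite -scalemxAr scalerA rcoefS scaleNr opprK.
  by rewrite -opprB raddfN /= mulmxN scalerN.
have tele n : (0 < n)%N -> \sum_(l < n) (f l + g l) = f 0%N + g n.-1.
  case: n => // n _; elim: n => [|n IH]; first by rewrite big_ord1.
  by rewrite big_ord_recr IH /= fS addrA addrK.
have [N0|N0] := posnP N.
  rewrite big1 // => -[l lN] _; exfalso; move: lN; by rewrite N0.
(* The ends vanish too: [f 0] contains the commutator of E with 1, and the last [g] contains E^N =
   0. *)
rewrite tele // /f /g prednK // repE_nilp // !mul0mx scaler0 addr0.
by rewrite expr0 !mulmx1 !mul1mx subrr trmx0 mulmx0 scaler0.
Qed.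

Lemma Rinvmx_graded o1 o2 (a b c d : 'I_N) : Rinvmx s o1 o2 a b c d != 0 ->
  oweight o1 c + oweight o2 d = oweight o1 a + oweight o2 b :> int.
Proof.
rewrite /Rinvmx mulf_eq0 negb_or => /andP[/eqP h _].
have [l hl] : exists l : 'I_N, ((repE s N o1 ^+ l) c a != 0) && ((repF s N o2 ^+ l) d b != 0).
  apply/existsP; apply: contraT; rewrite negb_exists => /forallP h'.
  case: h; apply: big1 => l _; move: (h' l); rewrite negb_and !negbK.
  by case/orP => /eqP->; rewrite ?mulr0 ?mul0r.
case/andP: hl => /(graded_exp (@repE_graded _ s s0 N o1))-> /(graded_exp (@repF_graded _ s s0 N o2))->.
lia.
Qed.

Lemma twist_K o1 o2 X :
  twist o1 o2 (K o1 1 *m X *m K o2 1) = K o2 1 *m twist o1 o2 X *m K o1 1.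
Proof.
apply/matrixP => c d; rewrite mul_mx_repK mul_repK !twistE mulr_sumr mulr_suml.
apply: eq_bigr => a _; rewrite mulr_sumr mulr_suml; apply: eq_bigr => b _.
rewrite mul_mx_repK mul_repK !mul1r.
have [->|h] := eqVneq (Rinvmx s o2 o1 b a c d) 0; first by rewrite !mulr0 mul0r.
have e : v ^ oweight o1 a * v ^ oweight o2 b = v ^ oweight o2 c * v ^ oweight o1 d.
  by rewrite -!expfzDr ?v0 // (Rinvmx_graded h) addrC.
transitivity ((v ^ oweight o1 a * v ^ oweight o2 b) * (X a b * Rinvmx s o2 o1 b a c d)); first by ring.
by rewrite e; ring.
Qed.

Lemma twist_is_linear o1 o2 : linear (twist o1 o2).
Proof.
move=> a X Y; apply/matrixP => c d; rewrite [RHS]mxE [X in _ = X + _]mxE !twistE.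
rewrite mulr_sumr -big_split; apply: eq_bigr => i _.
rewrite mulr_sumr -big_split; apply: eq_bigr => j _; rewrite !mxE /=; ring.
Qed.

HB.instance Definition _ o1 o2 :=
  GRing.isLinear.Build F _ _ _ (twist o1 o2) (twist_is_linear o1 o2).

Lemma twist_lin_sum o1 o2 (c : 'I_N -> F) (X : 'I_N -> 'M[F]_N) :
  twist o1 o2 (\sum_x c x *: X x) = \sum_x c x *: twist o1 o2 (X x).
Proof. by rewrite linear_sum; apply: eq_bigr => x _; rewrite linearZ. Qed.

(* A tensor with four strands; [half_twist12] and [half_twist01] are the
   left-handed half-twists of strands 1, 2 and of strands 0, 1. *)
Definition state := 'I_N -> 'I_N -> 'I_N -> 'I_N -> F.

Definition half_twist12 o2 o3 (U : state) : state := fun a b c d =>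
  twist o2 o3 (\matrix_(x, y) U a x y d) b c.

Definition half_twist01 o1 o2 (U : state) : state := fun a b c d =>
  twist o1 o2 (\matrix_(x, y) U x y c d) a b.

Definition Kw o (i : 'I_N) : F := v ^ oweight o i.

(** The iterated coproduct puts E on one strand and K on all strands to its right. *)
Definition invariant o1 o2 o3 o4 (U : state) := forall a b c d,
  (\sum_x E o1 a x * U x b c d) * Kw o2 b * Kw o3 c * Kw o4 d
  + (\sum_x E o2 b x * U a x c d) * Kw o3 c * Kw o4 d
  + (\sum_x E o3 c x * U a b x d) * Kw o4 d
  + \sum_x E o4 d x * U a b c x = 0.

Lemma actE_entry o1 o2 (U : 'I_N -> 'I_N -> F) b c :
  actE o1 o2 (\matrix_(x, y) U x y) b c =
  \sum_x E o2 c x * U b x + (\sum_x E o1 b x * U x c) * Kw o2 c.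
Proof.
rewrite [LHS]mxE mul_mx_repK mul1r !mxE; congr (_ + _ * _).
  by apply: eq_bigr => x _; rewrite !mxE mulrC.
by apply: eq_bigr => x _; rewrite !mxE.
Qed.

(** With the outer indices fixed, the condition is a matrix equation in strands 1 and 2: E on strand
    0 contributes K on both of them, E on one of them gives [actE], and E on strand 3 leaves them
    alone. Each kind of term is carried along by [twist]. *)
Lemma invariant_half_twist12 o1 o2 o3 o4 U :
  invariant o1 o2 o3 o4 U -> invariant o1 o3 o2 o4 (half_twist12 o2 o3 U).
Proof.
move=> inv a b c d.
pose X a' d' : 'M[F]_N := \matrix_(x, y) U a' x y d'.
have h : Kw o4 d *: (K o2 1 *m (\sum_x E o1 a x *: X x d) *m K o3 1)
   + Kw o4 d *: actE o2 o3 (X a d) + \sum_x E o4 d x *: X a x = 0.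
  apply/matrixP => i j; rewrite mxE [X in X + _]mxE [X in X + _ + _]mxE [X in _ + X + _]mxE.
  rewrite mul_mx_repK mul_repK actE_entry !summxE [RHS]mxE -[RHS](inv a i j d).
  under eq_bigr do rewrite !mxE.
  under [X in _ + _ + X = _]eq_bigr do rewrite !mxE.
  rewrite !mul1r -/(Kw o2 i) -/(Kw o3 j); ring.
have := congr1 (twist o2 o3) h; rewrite linear0 2!linearD 2!linearZ /= twist_K.
rewrite twist_actE !twist_lin_sum.
move/matrixP/(_ b c); rewrite [RHS]mxE mxE [X in X + _]mxE [X in X + _ + _]mxE [X in _ + X + _]mxE.
rewrite mul_mx_repK mul_repK !summxE => e; rewrite -[RHS]e {e}.
have -> : twist o2 o3 (X a d) = \matrix_(x, y) half_twist12 o2 o3 U a x y d.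
  by apply/matrixP => x y; rewrite [RHS]mxE.
rewrite actE_entry.
under [X in _ = _ * (_ * X * _) + _ + _]eq_bigr do rewrite mxE.
under [X in _ = _ + _ + X]eq_bigr do rewrite mxE.
rewrite !mul1r -/(Kw o3 b) -/(Kw o2 c) /half_twist12 -/(X _ _); ring.
Qed.

Lemma invariant_half_twist01 o1 o2 o3 o4 U :
  invariant o1 o2 o3 o4 U -> invariant o2 o1 o3 o4 (half_twist01 o1 o2 U).
Proof.
move=> inv a b c d.
pose X c' d' : 'M[F]_N := \matrix_(x, y) U x y c' d'.
have h : (Kw o3 c * Kw o4 d) *: actE o1 o2 (X c d)
   + Kw o4 d *: (\sum_x E o3 c x *: X x d) + \sum_x E o4 d x *: X c x = 0.
  apply/matrixP => i j; rewrite mxE [X in X + _]mxE [X in X + _ + _]mxE [X in _ + X + _]mxE.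
  rewrite actE_entry !summxE [RHS]mxE -[RHS](inv i j c d).
  under [X in _ + _ * X + _ = _]eq_bigr do rewrite !mxE.
  under [X in _ + _ + X = _]eq_bigr do rewrite !mxE.
  ring.
have := congr1 (twist o1 o2) h; rewrite linear0 2!linearD 2!linearZ /= twist_actE !twist_lin_sum.
move/matrixP/(_ a b); rewrite [RHS]mxE mxE [X in X + _]mxE [X in X + _ + _]mxE [X in _ + X + _]mxE.
rewrite !summxE => e; rewrite -[RHS]e {e}.
have -> : twist o1 o2 (X c d) = \matrix_(x, y) half_twist01 o1 o2 U x y c d.
  by apply/matrixP => x y; rewrite [RHS]mxE.
rewrite actE_entry.
under [X in _ = _ + _ * X + _]eq_bigr => x _ do rewrite mxE.
under [X in _ = _ + _ + X]eq_bigr do rewrite mxE.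
rewrite /half_twist01 -/(X _ _); ring.
Qed.

End HalfTwists.

(** * Evaluation of the double twist diagram *)

Lemma exchange_big4 (R : nmodType) (I : finType) (G : I -> I -> I -> I -> R) :
  \sum_b \sum_c \sum_e \sum_f G b c e f = \sum_e \sum_f \sum_b \sum_c G b c e f.
Proof.
under eq_bigr do rewrite exchange_big.
rewrite exchange_big; apply: eq_bigr => e _ /=.
by under eq_bigr do rewrite exchange_big; rewrite exchange_big.
Qed.

Section Evaluation.
Context {F : fieldType} (s : F) (N : nat).
Notation v := (vq s).
Implicit Types (U : @state F N) (D : diagram).

(** The tensor of the part of the diagram already read, contracted with the remaining part;
    crossings move from [D] into [U] one at a time. *)
Definition evald D o1 o2 o3 o4 U : F :=
  \sum_a \sum_b \sum_c \sum_d
    U a b c d * rt_from s D [:: (o1, a); (o2, b); (o3, c); (o4, d)].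

Lemma evald_cross1 D o1 o2 o3 o4 U :
  evald (Cross 1 false :: D) o1 o2 o3 o4 U = evald D o1 o3 o2 o4 (half_twist12 s o2 o3 U).
Proof.
rewrite /evald; apply: eq_bigr => a _ /=.
pose G b c e f := \sum_d U a b c d * Rinvmx s o3 o2 c b e f *
  rt_from s D [:: (o1, a); (o3, e); (o2, f); (o4, d)].
transitivity (\sum_b \sum_c \sum_e \sum_f G b c e f).
  apply: eq_bigr => b _; apply: eq_bigr => c _.
  transitivity (\sum_d \sum_e \sum_f U a b c d * Rinvmx s o3 o2 c b e f *
     rt_from s D [:: (o1, a); (o3, e); (o2, f); (o4, d)]).
    apply: eq_bigr => d _; rewrite mulr_sumr; apply: eq_bigr => e _.
    by rewrite mulr_sumr; apply: eq_bigr => f _; rewrite mulrA.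
  rewrite exchange_big; apply: eq_bigr => e _ /=.
  by rewrite exchange_big.
rewrite exchange_big4; apply: eq_bigr => e _; apply: eq_bigr => f _.
transitivity (\sum_b \sum_d \sum_c U a b c d * Rinvmx s o3 o2 c b e f *
  rt_from s D [:: (o1, a); (o3, e); (o2, f); (o4, d)]).
  by apply: eq_bigr => b _; rewrite exchange_big.
rewrite exchange_big; apply: eq_bigr => d _ /=; rewrite /half_twist12 twistE mulr_suml.
apply: eq_bigr => b _; rewrite mulr_suml; apply: eq_bigr => c _.
by rewrite mxE.
Qed.

Lemma evald_cross0 D o1 o2 o3 o4 U :
  evald (Cross 0 false :: D) o1 o2 o3 o4 U = evald D o2 o1 o3 o4 (half_twist01 s o1 o2 U).
Proof.
rewrite /evald /=.
pose G a b e f := \sum_c \sum_d U a b c d * Rinvmx s o2 o1 b a e f *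
  rt_from s D [:: (o2, e); (o1, f); (o3, c); (o4, d)].
transitivity (\sum_a \sum_b \sum_e \sum_f G a b e f).
  apply: eq_bigr => a _; apply: eq_bigr => b _; rewrite exchange_big4.
  apply: eq_bigr => c _; apply: eq_bigr => d _; rewrite mulr_sumr; apply: eq_bigr => e _.
  by rewrite mulr_sumr; apply: eq_bigr => f _; rewrite mulrA.
rewrite exchange_big4; apply: eq_bigr => e _; apply: eq_bigr => f _.
rewrite exchange_big4; apply: eq_bigr => c _; apply: eq_bigr => d _.
rewrite /half_twist01 twistE mulr_suml.
apply: eq_bigr => a _; rewrite mulr_suml; apply: eq_bigr => b _.
by rewrite mxE.
Qed.

Definition inner_cap U a d : F := \sum_b U a b b d.

Lemma evald_caps U :
  evald [:: Cap 1; Cap 0] true false true false U = \sum_a inner_cap U a a * v ^ weight a.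
Proof.
rewrite /evald; apply: eq_bigr => a _; rewrite /inner_cap mulr_suml; apply: eq_bigr => b _.
rewrite (bigD1 b) //= [X in _ + X]big1 ?addr0 => [|c cb]; last first.
  by rewrite big1 // => d _; rewrite eq_sym (negbTE cb) mul0r mulr0.
rewrite (bigD1 a) //= [X in _ + X]big1 ?addr0 => [|d da]; last first.
  by rewrite !mxE (negbTE da) mulr0n mul0r !mulr0.
by rewrite !mxE !eqxx mulr1n !mul1r mulr1.
Qed.

Definition cup_state : @state F N := fun a b c d =>
  matK s N (-1) b a * (c == d)%:R.

Lemma rt_cups D :
  rt s N (Cup 0 false :: Cup 2 true :: D) = evald D false true true false cup_state.
Proof.
rewrite /rt /evald /=; apply: eq_bigr => a _; apply: eq_bigr => b _.
rewrite mulr_sumr; apply: eq_bigr => c _; rewrite mulr_sumr; apply: eq_bigr => d _.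
by rewrite mulrA.
Qed.

Lemma rt_unknot : rt s N unknot = \sum_(a < N) v ^ weight a.
Proof.
rewrite /rt /=; apply: eq_bigr => a _; rewrite (bigD1 a) //= big1 ?addr0 => [|b ba].
  by rewrite !mxE !eqxx mulr1n !mul1r mulr1.
by rewrite eq_sym (negbTE ba) mul0r.
Qed.

Fixpoint half_twists01 n U : @state F N :=
  if n is n'.+1 then half_twist01 s false true (half_twist01 s true false (half_twists01 n' U)) else
    half_twist01 s false true U.

Lemma evald_twist1 D n U :
  evald (nseq n (Cross 1 false) ++ D) false true true false U =
  evald D false true true false (iter n (half_twist12 s true true) U).
Proof.
elim: n U => //= n IH U; rewrite evald_cross1 IH; congr evald; by rewrite -iterSr.
Qed.

Lemma evald_twist0 D m U :
  evald (nseq (2 * m + 1) (Cross 0 false) ++ D) false true true false U =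
  evald D true false true false (half_twists01 m U).
Proof.
(* The recursion adds pairs of half-twists at the top, whereas the diagram is read from the
   bottom. *)
have -> : half_twists01 m U = half_twist01 s false true (iter m (fun V => half_twist01 s true false
  (half_twist01 s false true V)) U).
  by elim: m => [//|m IH]; rewrite iterS -IH.
elim: m U => [|m IH] U; first by rewrite /= evald_cross0.
have -> : (2 * m.+1 + 1 = (2 * m + 1).+2)%N by lia.
by rewrite [nseq _.+2 _]/= !cat_cons !evald_cross0 IH -iterSr.
Qed.

End Evaluation.

(** The two middle strands are parallel, so a left-handed half-twist is a negative crossing; in
    [writhe_twist0] the strands are antiparallel and the crossings positive. *)
Lemma writhe_twist1 n D :
  writhe_from (nseq n (Cross 1 false) ++ D) [:: false; true; true; false] =
  - n%:Z + writhe_from D [:: false; true; true; false].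
Proof. by elim: n => [|n IH] /=; rewrite ?IH ?oppr0 ?add0r //; lia. Qed.

Lemma writhe_twist0 m D : writhe_from (nseq (2 * m + 1) (Cross 0 false) ++ D)
    [:: false; true; true; false] =
  (2 * m + 1)%:Z + writhe_from D [:: true; false; true; false].
Proof.
elim: m => [//|m IH].
have -> : (2 * m.+1 + 1 = (2 * m + 1).+2)%N by lia.
rewrite [nseq _.+2 _]/= /= IH; lia.
Qed.

Lemma double_twistE m p : double_twist (- m%:Z) (- p%:Z) =
  Cup 0 false :: Cup 2 true :: nseq (2 * p) (Cross 1 false) ++
    (nseq (2 * m + 1) (Cross 0 false) ++ [:: Cap 1; Cap 0]).
Proof.
rewrite /double_twist /half_twists /=; congr [:: _, _ & _].
have -> : absz (2 * - p%:Z) = (2 * p)%N by lia.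
have -> : absz (2 * - m%:Z - 1)%R = (2 * m + 1)%N by lia.
have -> : (0 < 2 * - p%:Z :> int) = false by lia.
by have -> : (0 < 2 * - m%:Z - 1 :> int) = false by lia.
Qed.

Lemma writhe_double_twist m p :
  writhe (double_twist (- m%:Z) (- p%:Z)) = (2 * m + 1)%:Z - (2 * p)%:Z.
Proof. by rewrite double_twistE /writhe /= writhe_twist1 writhe_twist0 /=; lia. Qed.

Local Arguments repE : simpl never.
Local Arguments repF : simpl never.

Definition wt (n i : nat) : int := n%:Z - 2 * i%:Z.

Lemma weightE n (i : 'I_n.+1) : weight i = wt n i.
Proof. by rewrite /weight /wt; lia. Qed.

(** * Invariant tensors and reduction to a single entry *)

Section Invariance.
Context {F : fieldType} (s : F).
Context (s0 : s != 0) (sroot : forall n, (0 < n)%N -> s ^+ n != 1).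
Context (n : nat).
Notation N := n.+1.
Notation v := (vq s).
Notation z := (vq s - (vq s)^-1).
Notation q := (s ^+ 4).
Notation E := (repE s N).
Implicit Types (U : @state F N).

Notation wt := (wt n).

Lemma q_neq0 : q != 0. Proof. by rewrite expf_neq0. Qed.

Lemma q_root k : (0 < k)%N -> q ^+ k != 1.
Proof. by move=> k0; rewrite -exprM sroot // muln_gt0. Qed.

Lemma matE_row (i : nat) (f : 'I_N -> F) : (i < N)%N ->
  \sum_y matE s N (inord i) y * f y = if (i.+1 < N)%N then qint s (N - i.+1) * f (inord i.+1) else 0.
Proof.
move=> iN; case: ltnP => h; last first.
  by rewrite big1 // => y _; rewrite mxE inordK //; case: eqP => [e|_]; rewrite ?mul0r //; have := ltn_ord
    y; lia.
rewrite (bigD1 (inord i.+1)) //= mxE !inordK // eqxx big1 ?addr0 // => y yi.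
rewrite mxE inordK //; case: eqP => [e|_]; rewrite ?mul0r //.
by case/eqP: yi; apply: val_inj; rewrite /= inordK.
Qed.

Lemma repEdual_entry (i j : 'I_N) :
  E false i j = if j.+1 == i :> nat then - (qint s (N - i) * v ^ (- weight i)) else 0.
Proof. by rewrite /repE mxE mxE matEK mxE; case: ifP; rewrite ?mul0r ?oppr0. Qed.

Lemma repEdual_row0 (f : 'I_N -> F) : \sum_y E false ord0 y * f y = 0.
Proof. by rewrite big1 // => y _; rewrite repEdual_entry mul0r. Qed.

Lemma repEdual_row (i : nat) (f : 'I_N -> F) : (i.+1 < N)%N ->
  \sum_y E false (inord i.+1) y * f y = - (qint s (N - i.+1) * v ^ (- wt i.+1)) * f (inord i).
Proof.
move=> iN; have iN' : (i < N)%N by apply: ltnW.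
rewrite (bigD1 (inord i)) //= repEdual_entry weightE !inordK // eqxx big1 ?addr0 // => y yi.
rewrite repEdual_entry inordK //; case: eqP => [[e]|_]; rewrite ?mul0r //.
by case/eqP: yi; apply: val_inj; rewrite /= inordK.
Qed.

(** An instance of Schur's lemma. Invariance at the components (i, b, b, i+1) is summed over b: the
    terms with E on the two middle strands cancel, and the other two compare consecutive diagonal
    entries. *)
Lemma inner_cap_const U : invariant s true false true false U ->
  forall i, (i < N)%N -> inner_cap U (inord i) (inord i) = inner_cap U ord0 ord0.
Proof.
move=> inv; elim=> [|i IH] iN.
  by have -> : inord 0 = ord0 :> 'I_N by apply: val_inj; rewrite /= inordK.
rewrite -IH; last by apply: ltnW.
have h : \sum_b ((\sum_y E true (inord i) y * U y b b (inord i.+1)) * Kw s false b * Kw s true b * @Kw F s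
  N false (inord i.+1)
  + (\sum_y E false b y * U (inord i) y b (inord i.+1)) * Kw s true b * @Kw F s N false (inord i.+1)
  + (\sum_y E true b y * U (inord i) b y (inord i.+1)) * @Kw F s N false (inord i.+1)
  + \sum_y E false (inord i.+1) y * U (inord i) b b y) = 0.
  by apply: big1 => b _; apply: inv.
have iN' : (i < N)%N by apply: ltnW.
move: h; rewrite !big_split /=.
have -> : \sum_b (\sum_y E false b y * U (inord i) y b (inord i.+1)) * Kw s true b * @Kw F s N false (inord
  i.+1)
  = - \sum_b (\sum_y E true b y * U (inord i) b y (inord i.+1)) * @Kw F s N false (inord i.+1).
  rewrite -!mulr_suml -mulNr; congr (_ * _).
  under eq_bigr do rewrite mulr_suml.
  rewrite exchange_big /= -sumrN; apply: eq_bigr => b _; rewrite -sumrN; apply: eq_bigr => y _.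
  rewrite repEdual_entry /repE mxE /Kw /oweight.
  have [e|_] := eqVneq b.+1 (y : nat); last by rewrite !mul0r oppr0.
  have e' : v ^ (- weight y) * v ^ weight y = 1 by rewrite -expfzDr ?v0 // addNr.
  rewrite !mulNr; congr (- _).
  transitivity (qint s (N - y) * U (inord i) b y (inord i.+1) * (v ^ (- weight y) * v ^ weight y)); first
    by ring.
  by rewrite e' mulr1.
rewrite subrK.
have -> : \sum_b (\sum_y E true (inord i) y * U y b b (inord i.+1)) * Kw s false b * Kw s true b * @Kw F s
  N false (inord i.+1)
  = qint s (N - i.+1) * v ^ (- wt i.+1) * inner_cap U (inord i.+1) (inord i.+1).
  rewrite /inner_cap mulr_sumr; apply: eq_bigr => b _; rewrite matE_row // iN /Kw /oweight !weightE inordK //.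
  have e' : v ^ (- wt b) * v ^ wt b = 1 by rewrite -expfzDr ?v0 // addNr.
  transitivity (qint s (N - i.+1) * v ^ (- wt i.+1) * U (inord i.+1) b b (inord i.+1) * (v ^ (- wt b) * v ^
    wt b)); first by ring.
  by rewrite e' mulr1.
have -> : \sum_b \sum_y E false (inord i.+1) y * U (inord i) b b y =
  - (qint s (N - i.+1) * v ^ (- wt i.+1)) * inner_cap U (inord i) (inord i).
  by rewrite /inner_cap mulr_sumr; apply: eq_bigr => b _; rewrite repEdual_row.
rewrite mulNr => /eqP; rewrite subr_eq0 => /eqP; apply: mulfI.
by rewrite mulf_neq0 ?expfz_neq0 ?v0 // qint_neq0 //; lia.
Qed.

(** Multiplied by v - 1/v, the quantum dimension telescopes to v^N - v^-N. *)
Lemma qdim_neq0 : \sum_(a < N) v ^ weight a != 0.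
Proof.
have h k : z * \sum_(a < k) v ^ wt a = v ^ (n%:Z + 1) - v ^ (n%:Z + 1 - 2 * k%:Z).
  elim: k => [|k IH]; first by rewrite big_ord0 !mulr0 subr0 subrr.
  rewrite big_ord_recr /= mulrDr IH mulrBl /wt.
  have -> : v * v ^ (n%:Z - 2 * k%:Z) = v ^ (n%:Z + 1 - 2 * k%:Z).
    by rewrite -{1}[v]expr1z -expfzDr ?v0 //; congr (_ ^ _); lia.
  have -> : v^-1 * v ^ (n%:Z - 2 * k%:Z) = v ^ (n%:Z + 1 - 2 * k.+1%:Z).
    by rewrite -exprN1 -expfzDr ?v0 //; congr (_ ^ _); lia.
  by rewrite addrA subrK.
apply: contra (vroot sroot (isT : (0 < 2 * n.+1)%N)) => /eqP h0.
have := h N; under eq_bigr do rewrite -weightE.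
rewrite h0 mulr0 => /esym/eqP; rewrite subr_eq0 => /eqP e.
have : v ^ (n%:Z + 1) * v ^ (n%:Z + 1) = v ^ (n%:Z + 1 - 2 * N%:Z) * v ^ (n%:Z + 1) by rewrite {1}e.
rewrite -!expfzDr ?v0 // (_ : n%:Z + 1 - 2 * N%:Z + (n%:Z + 1) = 0); last by lia.
rewrite expr0z => e2; apply/eqP; rewrite exprnP -[RHS]e2; congr (_ ^ _); lia.
Qed.

(** The dual representation is defined through the antipode, so the contributions of the two legs of
    each cup cancel. *)
Lemma invariant_cup : invariant s false true true false (@cup_state F s N).
Proof.
move=> a b c d; rewrite /cup_state.
have hab : (\sum_y E false a y * (matK s N (-1) b y * (c == d)%:R)) * Kw s true b =
  - \sum_y E true b y * (matK s N (-1) y a * (c == d)%:R).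
  rewrite (bigD1 b) //= big1 ?addr0 => [|y yb]; last first.
    by rewrite !mxE eq_sym (negbTE yb) mulr0n mul0r mulr0.
  rewrite (bigD1 a) //= big1 ?addr0 => [|y yb]; last first.
    by rewrite !mxE (negbTE yb) mulr0n mul0r mulr0.
  rewrite repEdual_entry !mxE !eqxx !mulr1n /Kw /oweight !mulN1r.
  have [e|_] := eqVneq b.+1 (a : nat); last by rewrite !mul0r oppr0.
  have e' : v ^ (- weight b) * v ^ weight b = 1 by rewrite -expfzDr ?v0 // addNr.
  rewrite !mulNr; congr (- _).
  transitivity (qint s (N - a) * v ^ (- weight a) * (c == d)%:R * (v ^ (- weight b) * v ^ weight b)); first
    by ring.
  by rewrite e' mulr1; ring.
have hcd : (\sum_y E true c y * (matK s N (-1) b a * (y == d)%:R)) * Kw s false d =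
  - \sum_y E false d y * (matK s N (-1) b a * (c == y)%:R).
  rewrite (bigD1 d) //= big1 ?addr0 => [|y yd]; last by rewrite (negbTE yd) !mulr0.
  rewrite (bigD1 c) //= big1 ?addr0 => [|y yd]; last by rewrite eq_sym (negbTE yd) !mulr0.
  rewrite repEdual_entry /repE mxE !eqxx /Kw /oweight.
  by have [e|_] := eqVneq c.+1 (d : nat); rewrite ?mul0r ?oppr0 //; ring.
rewrite hab hcd; ring.
Qed.

Lemma invariant_half_twists12 k U : invariant s false true true false U ->
  invariant s false true true false (iter k (half_twist12 s true true) U).
Proof. by move=> h; elim: k => //= k IH; apply: invariant_half_twist12. Qed.

Definition full_twist01 U := half_twist01 s true false (half_twist01 s false true U).

Lemma invariant_full_twists01 k U : invariant s false true true false U ->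
  invariant s false true true false (iter k full_twist01 U).
Proof. by move=> h; elim: k => //= k IH; do 2 apply: invariant_half_twist01 => //. Qed.

Lemma half_twists01E k U : half_twists01 s k U = half_twist01 s false true (iter k full_twist01 U).
Proof. by elim: k => [//|k IH]; rewrite /= IH. Qed.

Lemma rt_ratio m p : rt s N (double_twist (- m%:Z) (- p%:Z)) / rt s N unknot =
  inner_cap (half_twists01 s m (iter (2 * p) (half_twist12 s true true) (@cup_state F s N))) ord0 ord0.
Proof.
rewrite double_twistE rt_cups evald_twist1 evald_twist0 evald_caps rt_unknot.
set W := half_twists01 _ _ _.
have inv : invariant s true false true false W.
  rewrite /W half_twists01E; apply: invariant_half_twist01 => //; apply: invariant_full_twists01.
  by apply: invariant_half_twists12; apply: invariant_cup.
under eq_bigr => a _ do rewrite -[a in inner_cap _ a]inord_val -[a in inner_cap _ _ a]inord_val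
  inner_cap_const //.
by rewrite -mulr_sumr mulfK ?qdim_neq0.
Qed.

End Invariance.

(** * Highest weight coefficients of the invariant tensors *)

Section HighestWeight.
Context {F : fieldType} (s : F).
Context (s0 : s != 0) (sroot : forall n, (0 < n)%N -> s ^+ n != 1).
Context (n : nat).
Notation N := n.+1.
Notation v := (vq s).
Notation z := (vq s - (vq s)^-1).
Notation q := (s ^+ 4).
Notation x := (s ^+ 4 ^+ n.+1).
Notation Fm := (repF s N).
Notation gb := (gb q).
Notation poch := (poch q).
Notation wt := (wt n).
Implicit Types (U V : @state F N).

Definition qint_fall k : F := \prod_(j < k) qint s (n - j).

Lemma qint_fallS k : qint_fall k.+1 = qint_fall k * qint s (n - k).
Proof. by rewrite /qint_fall big_ord_recr. Qed.

Lemma qint_fall_neq0 k : (k <= n)%N -> qint_fall k != 0.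
Proof.
move=> kn; apply/prodf_neq0 => j _; apply: qint_neq0 => //.
by have := ltn_ord j; lia.
Qed.

(* Chosen so that invariance becomes the recursion [invariant_array]. *)
Definition hwnorm i j : F := qint_fall (i + j) / (qint_fall i * qint_fall j) * v ^+ (n.+2 * j + 2 * i).

Lemma hwnorm_neq0 i j : (i + j <= n)%N -> hwnorm i j != 0.
Proof.
by move=> h; rewrite !mulf_neq0 ?invr_eq0 ?mulf_neq0 ?expf_neq0 ?qint_fall_neq0 ?v0 //; lia.
Qed.

Lemma hwnorm_i0 i : (i <= n)%N -> hwnorm i 0 = v ^+ (2 * i).
Proof.
move=> h; rewrite /hwnorm addn0 muln0 add0n {3}/qint_fall big_ord0 mulr1 divff ?mul1r //.
exact: qint_fall_neq0.
Qed.

Lemma hwnorm_0j j : (j <= n)%N -> hwnorm 0 j = v ^+ (n.+2 * j).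
Proof.
move=> h; rewrite /hwnorm add0n muln0 addn0 {2}/qint_fall big_ord0 mul1r divff ?mul1r //.
exact: qint_fall_neq0.
Qed.

(* For an invariant tensor, components with last index 0 vanish unless the
   first index is the sum of the middle ones, and they determine the tensor. *)
Definition hwcoef V i j : F := V (inord (i + j)) (inord i) (inord j) ord0.

Definition nhwcoef V i j : F := hwcoef V i j / hwnorm i j.

Lemma hwcoef_nhwcoef V i j : (i + j <= n)%N -> hwcoef V i j = hwnorm i j * nhwcoef V i j.
Proof. by move=> h; rewrite /nhwcoef mulrC mulfVK ?hwnorm_neq0. Qed.

(** Invariance is read at the component (i+j+1, i, j, 0), where E on the last strand contributes
    nothing. *)
Lemma nhwcoef_invariant V : invariant s false true true false V ->
  invariant_array q N (nhwcoef V).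
Proof.
move=> inv i j h; have := inv (inord (i + j).+1) (inord i) (inord j) ord0.
rewrite repEdual_row0 addr0 repEdual_row // !matE_row; try lia.
rewrite !ifT; try lia.
rewrite -[V (inord (i + j)) _ _ _]/(hwcoef V i j).
have -> : V (inord (i + j).+1) (inord i.+1) (inord j) ord0 = hwcoef V i.+1 j by [].
have -> : V (inord (i + j).+1) (inord i) (inord j.+1) ord0 = hwcoef V i j.+1 by rewrite /hwcoef addnS.
rewrite -!mulrDl => /eqP; rewrite mulf_eq0 [Kw _ _ _ == 0](negbTE _); last by rewrite expfz_neq0 ?v0.
rewrite orbF /Kw /oweight !weightE !inordK; try lia.
rewrite !subSS !hwcoef_nhwcoef; try lia.
(* [e1], [e2] and [e3] bring the three coefficients to a common nonzero factor, which is cancelled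
   at the end. *)
have e1 : qint s (n - i) * hwnorm i.+1 j * v ^ wt j = qint s (n - (i + j)) * v ^+ n.+2 * hwnorm i j * q ^- j.
  rewrite /hwnorm addSn !qint_fallS.
  have -> : v ^ wt j = v ^+ n * v ^- (2 * j).
    by rewrite /wt exprnN exprnP -expfzDr ?v0 //; congr (_ ^ _); lia.
  have -> : q ^- j = v ^- (2 * j) by rewrite /vq -!exprM; congr (_ ^- _); lia.
  have -> : v ^+ (n.+2 * j + 2 * i.+1) = v ^+ (n.+2 * j + 2 * i) * v ^+ 2 by rewrite -exprD; congr (_ ^+
    _); lia.
  have -> : v ^+ n.+2 = v ^+ n * v ^+ 2 by rewrite -exprD addn2.
  have h1 := qint_fall_neq0 (_ : i <= n)%N; have h2 := qint_fall_neq0 (_ : j <= n)%N.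
  field; rewrite ?expf_neq0 ?v0 ?h1 ?h2 ?qint_neq0 //; lia.
have e2 : qint s (n - j) * hwnorm i j.+1 = qint s (n - (i + j)) * v ^+ n.+2 * hwnorm i j.
  rewrite /hwnorm addnS !qint_fallS.
  have -> : v ^+ (n.+2 * j.+1 + 2 * i) = v ^+ (n.+2 * j + 2 * i) * v ^+ n.+2 by rewrite -exprD; congr (_ ^+
    _); lia.
  have h1 := qint_fall_neq0 (_ : i <= n)%N; have h2 := qint_fall_neq0 (_ : j <= n)%N.
  field; rewrite ?expf_neq0 ?v0 ?h1 ?h2 ?qint_neq0 //; lia.
have e3 : v ^ (- wt (i + j).+1) * v ^ wt i * v ^ wt j = v ^+ n.+2.
  by rewrite exprnP -!expfzDr ?v0 // /wt; congr (_ ^ _); lia.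
move=> /eqP e.
have {}e : qint s (n - (i + j)) * v ^+ n.+2 * hwnorm i j * (nhwcoef V i j.+1 + q ^- j * nhwcoef V i.+1 j -
  nhwcoef V i j) = 0.
  transitivity (qint s (n - j) * hwnorm i j.+1 * nhwcoef V i j.+1 +
    qint s (n - i) * hwnorm i.+1 j * v ^ wt j * nhwcoef V i.+1 j -
    qint s (n - (i + j)) * (v ^ (- wt (i + j).+1) * v ^ wt i * v ^ wt j) * hwnorm i j * nhwcoef V i j).
    by rewrite e1 e2 e3; ring.
  by rewrite -[RHS]e; ring.
have h0 : qint s (n - (i + j)) * v ^+ n.+2 * hwnorm i j != 0.
  apply: mulf_neq0; last by apply: hwnorm_neq0; lia.
  by apply: mulf_neq0; [apply: qint_neq0 => //; lia | rewrite expf_neq0 ?v0].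
by move/eqP: e; rewrite mulf_eq0 (negbTE h0) /= subr_eq0 => /eqP.
Qed.

Lemma repF_row0 l y : (Fm true ^+ l.+1) ord0 y = 0.
Proof.
rewrite exprS -mulmxE mxE big1 // => m _; rewrite [repF _ _ _ _ _]mxE.
by rewrite mul0r.
Qed.

(** Row 0 of every positive power of F vanishes, so only the term l = 0 of R^-1 is left. *)
Lemma twist_col0 o2 (X : 'M[F]_N) c :
  twist s true o2 X c ord0 = s ^ (- (oweight o2 c * wt 0)) * X ord0 c.
Proof.
rewrite /twist big_ord_recl mxE summxE big1 ?addr0 => [|l _]; last first.
  rewrite mxE mxE big1 ?mulr0 // => m _.
  by rewrite [X in _ * X]mxE lift0 repF_row0 mulr0.
rewrite mxE expr0 mul1mx trmx1 mulmx1 mxE.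
have -> : oweight true (ord0 : 'I_N) = wt 0 by rewrite /oweight weightE.
by rewrite /rcoef bin_small // !expr0 qfact0 invr1 !mulr1 !mul1r.
Qed.

(** The eigenvalue of q^(- H (x) H / 4) on the tensor square of e_0. *)
Definition kappa : F := s ^ (- (n * n)%N%:Z).

Lemma nhwcoef_half_twist12 V i : (i < N)%N ->
  nhwcoef (half_twist12 s true true V) i 0 = kappa * x ^+ i * q ^- i * nhwcoef V 0 i.
Proof.
move=> iN; rewrite /nhwcoef hwnorm_i0 ?hwnorm_0j // /hwcoef addn0 add0n.
have -> : inord 0 = ord0 :> 'I_N by apply: val_inj; rewrite /= inordK.
rewrite /half_twist12 twist_col0 mxE /oweight weightE inordK //.
set y := V _ _ _ _.
have e : s ^ (- (wt i * wt 0)) / v ^+ (2 * i) = kappa * x ^+ i * q ^- i / v ^+ (n.+2 * i).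
  by rewrite /kappa /vq; zpow s0; rewrite /wt; lia.
transitivity (s ^ (- (wt i * wt 0)) / v ^+ (2 * i) * y); first by ring.
by rewrite e; ring.
Qed.

(** The components summed by [inner_cap] at [ord0 ord0]; they are also all that the second
    half-twist of a full twist reads, see [nhwcoef_half_twist01]. *)
Definition middiag V j : F := V ord0 (inord j) (inord j) ord0.

Lemma nhwcoef_half_twist01 V j : (j < N)%N ->
  nhwcoef (half_twist01 s true false V) 0 j = kappa ^-1 * x ^- j * middiag V j.
Proof.
move=> jN; rewrite /nhwcoef hwnorm_0j // /hwcoef add0n.
have -> : inord 0 = ord0 :> 'I_N by apply: val_inj; rewrite /= inordK.
rewrite /half_twist01 twist_col0 mxE /oweight weightE inordK // -/(middiag V j).
have e : s ^ (- (- wt j * wt 0)) / v ^+ (n.+2 * j) = kappa^-1 * x ^- j.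
  by rewrite /kappa /vq; zpow s0; rewrite /wt; lia.
by rewrite mulrAC e.
Qed.

Lemma matE_exp_row0 l y : (matE s N ^+ l) ord0 y = if y == l :> nat then qint_fall l else 0.
Proof.
elim: l y => [|l IH] y.
  by rewrite expr0 mxE /qint_fall big_ord0 -val_eqE /= eq_sym; case: eqP.
rewrite exprSr -mulmxE mxE.
under eq_bigr do rewrite IH mxE.
case: (ltnP l N) => lN; last first.
  rewrite big1 => [|m _]; last by case: eqP => [e|_]; rewrite ?mul0r //; have := ltn_ord m; lia.
  by case: eqP => // e; have := ltn_ord y; lia.
rewrite (bigD1 (Ordinal lN)) //= eqxx big1 ?addr0 => [|m ml]; last first.
  by case: eqP => [e|_]; rewrite ?mul0r //; case/eqP: ml; apply: val_inj.
rewrite eq_sym; case: eqP => [->|_]; last by rewrite mulr0.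
by rewrite qint_fallS subSS.
Qed.

Definition dual_rise j l : F := \prod_(c < l) (- (v ^ wt (j + c).+1 * qint s (j + c).+1)).

Lemma repFdual_exp_row j l y : (j < N)%N ->
  (Fm false ^+ l) (inord j) y = if y == (j + l)%N :> nat then dual_rise j l else 0.
Proof.
move=> jN; elim: l y => [|l IH] y.
  rewrite expr0 mxE /dual_rise big_ord0 addn0 -val_eqE /= inordK // eq_sym.
  by case: eqP.
rewrite exprSr -mulmxE mxE.
under eq_bigr do rewrite IH.
case: (ltnP (j + l) N) => lN; last first.
  rewrite big1 => [|m _]; last by case: eqP => [e|_]; rewrite ?mul0r //; have := ltn_ord m; lia.
  by case: eqP => // e; have := ltn_ord y; lia.
rewrite (bigD1 (Ordinal lN)) //= eqxx big1 ?addr0 => [|m ml]; last first.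
  by case: eqP => [e|_]; rewrite ?mul0r //; case/eqP: ml; apply: val_inj.
rewrite /repF mxE mxE matKF mxE /= addnS; case: eqP => [e|_]; last by rewrite mulr0 oppr0 mulr0.
by rewrite /dual_rise big_ord_recr /= weightE e.
Qed.

Lemma z_qint t : (t <= n)%N -> z * qint s (n - t) = v ^ (n%:Z - t%:Z) * (1 - q ^+ t.+1 / x).
Proof.
move=> tn; rewrite qintE mulrC mulfVK ?z0 // mulrBr mulr1; congr (_ - _).
  by congr (_ ^ _); lia.
by rewrite /vq; zpow s0; lia.
Qed.

Lemma qint_q t : qint s t = v ^ (- t%:Z) * (q ^+ t - 1) / z.
Proof.
rewrite qintE mulrBr mulr1; congr ((_ - _) / _).
by rewrite /vq; zpow s0; lia.
Qed.

(** The weight with which [nhwcoef V l j] enters [middiag] of the half-twisted tensor. By induction,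
    both sides change by the same factor from l to l+1. *)
Lemma twist_coef j l : (j + l <= n)%N ->
  rcoef s l * dual_rise j l * (qint_fall (l + j) / qint_fall j) * s ^ (wt l * wt (j + l)) * v ^+ (n.+2 * j
    + 2 * l) =
  kappa^-1 * (gb (j + l)%N l * poch (q ^+ j.+1 / x) l * (q ^+ (l + j) * q ^- (j * l))).
Proof.
have q0 := q_neq0 s0; have qr := q_root sroot.
elim: l => [|l IH] h.
  rewrite /dual_rise big_ord0 /rcoef bin_small // !expr0 qfact0 invr1 !mulr1 add0n divff ?qint_fall_neq0
    //; last by lia.
  rewrite gbn0 // poch0 !muln0 expr0 invr1 !addn0 !mul1r !mulr1 /kappa /vq.
  by zpow s0; rewrite /wt; lia.
have hl : (j + l <= n)%N by lia.
have {}IH := IH hl; rewrite (addnC l j) in IH.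
rewrite addSn qint_fallS (addnC l j) addnS.
set t := (j + l)%N in h hl IH *.
have -> : dual_rise j l.+1 = dual_rise j l * - (v ^ wt t.+1 * qint s t.+1) by rewrite /dual_rise big_ord_recr.
have er : rcoef s l.+1 = - rcoef s l * z / (v ^+ l * qint s l.+1).
  rewrite -(rcoefS s0 sroot); field.
  by rewrite qint_neq0 // expf_neq0 ?v0 // (v2_neq1 sroot).
have eg : gb t.+1 l.+1 = gb t l * ((1 - q ^+ t.+1) / (1 - q ^+ l.+1)).
  rewrite -addnS !gbDE /t addnS !pochSr -!exprS; field.
  by rewrite !poch_q_neq0 // subr_eq0 eq_sym qr.
have -> : q ^+ t.+1 * q ^- (j * l.+1) = q ^+ t * q ^- (j * l) * (q * q ^- j).
  by rewrite -[in q * _](expr1 q); zpow q0; lia.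
rewrite pochSr eg.
have -> : q ^+ j.+1 / x * q ^+ l = q ^+ t.+1 / x by rewrite mulrAC -exprD addSn.
transitivity (kappa^-1 * (gb t l * poch (q ^+ j.+1 / x) l * (q ^+ t * q ^- (j * l))) *
  ((1 - q ^+ t.+1) / (1 - q ^+ l.+1) * (1 - q ^+ t.+1 / x) * (q * q ^- j))); last by ring.
rewrite -IH.
have es : s ^ (wt l.+1 * wt t.+1) = s ^ (wt l * wt t) * v ^ (- wt l - wt t + 2).
  by rewrite /vq; zpow s0; rewrite /wt; lia.
rewrite es er.
have -> : v ^+ (n.+2 * j + 2 * l.+1) = v ^+ (n.+2 * j + 2 * l) * v ^+ 2 by rewrite -exprD; congr (_ ^+ _); lia.
transitivity (rcoef s l * dual_rise j l * (qint_fall t / qint_fall j) * s ^ (wt l * wt t) * v ^+ (n.+2 * j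
  + 2 * l) *
   ((z * qint s (n - t)) * (qint s t.+1 / qint s l.+1) * (v ^ wt t.+1 * v ^ (- wt l - wt t + 2) * v ^+ 2 *
     v ^- l))).
  field.
  by rewrite qint_fall_neq0 ?expf_neq0 ?v0 // ?qint_neq0 //; lia.
congr (_ * _); rewrite z_qint // !qint_q.
have hz := z0 s0 sroot.
have hl1 : 1 - q ^+ l.+1 != 0 by rewrite subr_eq0 eq_sym qr.
have hl2 : q ^+ l.+1 - 1 != 0 by rewrite -opprB oppr_eq0.
transitivity ((v ^ (n%:Z - t%:Z) * v ^ (- t.+1%:Z) / v ^ (- l.+1%:Z) * (v ^ wt t.+1 * v ^ (- wt l - wt t +
  2) * v ^+ 2 * v ^- l)) *
  ((1 - q ^+ t.+1) / (1 - q ^+ l.+1) * (1 - q ^+ t.+1 / x))).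
  have hv : v ^ (- l.+1%:Z) != 0 by rewrite expfz_neq0 ?v0.
  move: hz hl1 hl2 hv; move: z (q ^+ l.+1) (v ^ (- l.+1%:Z)) (q ^+ t.+1 / x) => a b c d hz hl1 hl2 hv.
  by field; rewrite hz hl1 hl2 hv ?expf_neq0 ?v0.
rewrite mulrC; congr (_ * _).
by rewrite /vq; zpow s0; rewrite /wt /t; lia.
Qed.

End HighestWeight.

(** * The twist regions on highest weight coefficients *)

Section TwistRegions.
Context {F : fieldType} (s : F).
Context (s0 : s != 0) (sroot : forall n, (0 < n)%N -> s ^+ n != 1).
Context (n : nat).
Notation N := n.+1.
Notation v := (vq s).
Notation q := (s ^+ 4).
Notation x := (s ^+ 4 ^+ n.+1).
Notation E := (repE s N).
Notation Fm := (repF s N).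
Notation gb := (gb q).
Notation poch := (poch q).
Notation wt := (wt n).
Notation kappa := (kappa s n).
Notation cup := (@cup_state F s N).
Implicit Types (U V : @state F N).

(** In the term l, row 0 of E^l selects the index l, and row j of F^l on the dual selects j + l, so
    only [hwcoef V l j] occurs; [cap_twist] then returns to the first row. *)
Lemma middiag_half_twist01 V j : invariant s false true true false V -> (j < N)%N ->
  middiag (half_twist01 s false true V) j = kappa^-1 * (x ^+ j.+1 *
    \sum_(m < N) gb m j * (q ^- (m * j.+1).+1 * poch (x * q ^- m) (m - j) * nhwcoef s V 0 m)).
Proof.
move=> inv jN; have q0 := q_neq0 s0; have qr := q_root sroot.
have eE : E true = matE s N by [].
rewrite -(cap_twist q0 qr (erefl x) (nhwcoef_invariant s0 sroot inv) jN) mulr_sumr.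
pose g l := kappa^-1 * (gb (j + l) l * poch (q ^+ j.+1 / x) l * (q ^+ (l + j) * q ^- (j * l)) * nhwcoef s V
  l j).
transitivity (\sum_(l < N) if (l < N - j)%N then g l else 0); last first.
  by rewrite -big_mkcond /= -(big_ord_widen N g) // leq_subr.
rewrite /middiag /half_twist01 /twist summxE; apply: eq_bigr => -[l /= lN] _.
rewrite mxE mxE.
transitivity (rcoef s l * \sum_y (qint_fall s n l * s ^ (- (wt l * - weight y)) * V y (inord l) (inord j)
  ord0) * (Fm false ^+ l) (inord j) y).
  congr (_ * _); apply: eq_bigr => y _; rewrite [X in _ * X = _]mxE; congr (_ * _).
  rewrite mxE (bigD1 (inord l)) //= big1 ?addr0 => [|u ul]; last first.
    rewrite eE matE_exp_row0 //; case: eqP => [e|_]; rewrite ?mul0r //.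
    by case/eqP: ul; apply: val_inj; rewrite /= inordK.
  rewrite eE matE_exp_row0 // inordK // eqxx !mxE /oweight !weightE ?inordK //.
  by rewrite -mulrA.
case: ltnP => h; last first.
  rewrite big1 ?mulr0 // => y _; rewrite repFdual_exp_row //.
  by case: eqP => [e|_]; rewrite ?mulr0 //; have := ltn_ord y; lia.
have jl : (j + l < N)%N by lia.
rewrite (bigD1 (inord (j + l))) //= big1 ?addr0 => [|y yl]; last first.
  rewrite repFdual_exp_row //; case: eqP => [e|_]; rewrite ?mulr0 //.
  by case/eqP: yl; apply: val_inj; rewrite /= inordK.
rewrite repFdual_exp_row // weightE !inordK // eqxx.
have -> : V (inord (j + l)) (inord l) (inord j) ord0 = hwcoef V l j by rewrite /hwcoef addnC.
rewrite (hwcoef_nhwcoef s0 sroot V); last by lia.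
rewrite /g mulrN opprK.
have jl' : (j + l <= n)%N by lia.
have := twist_coef s0 sroot jl' => e.
have hA : qint_fall s n l != 0 by apply: qint_fall_neq0 => //; lia.
have hA' : qint_fall s n j != 0 by apply: qint_fall_neq0.
transitivity (rcoef s l * dual_rise s n j l * (qint_fall s n (l + j) / qint_fall s n j) * s ^ (wt l * wt (j
  + l)) * v ^+ (n.+2 * j + 2 * l) * nhwcoef s V l j).
  rewrite /hwnorm; field; by rewrite hA hA'.
by rewrite e; ring.
Qed.

Lemma nhwcoef_cup j : (j < N)%N -> nhwcoef s cup 0 j = v ^ (- n%:Z) * (j == 0%N)%:R.
Proof.
move=> jN; rewrite /nhwcoef hwnorm_0j // /hwcoef add0n.
have h0 : inord 0 = ord0 :> 'I_N by apply: val_inj; rewrite /= inordK.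
rewrite /cup_state h0 !mxE -val_eqE /= inordK //.
case: j jN => [|j] jN; last by rewrite /= mulr0n !mul0r mulr0.
by rewrite h0 !eqxx muln0 expr0 invr1 mulr1n !mulr1 mulN1r weightE /wt /= mulr0 subr0.
Qed.

(** The Pochhammer factor in [full_twist] is [bfac j / bfac k] by [bfac_split]; once [bfac] is
    divided out, a full twist is [kern] after multiplication by x^(2k). *)
Lemma nhwcoef_twists p j : (j < N)%N ->
  nhwcoef s (iter (2 * p) (half_twist12 s true true) cup) 0 j =
  kappa ^+ (2 * p) * v ^ (- n%:Z) * (bfac q x j * pcoef q N x p j).
Proof.
have q0 := q_neq0 s0; have qr := q_root sroot.
elim: p j => [|p IH] j jN.
  rewrite nhwcoef_cup // muln0 expr0 mul1r /=; case: j jN => [|j] jN; rewrite ?mulr0 //.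
  by rewrite /bfac big_ord0 mul1r.
have inv k : invariant s false true true false (iter k (half_twist12 s true true) cup).
  by apply: invariant_half_twists12 => //; apply: invariant_cup.
rewrite (_ : 2 * p.+1 = (2 * p).+2)%N; last by lia.
rewrite (full_twist q0 qr (nhwcoef_invariant s0 sroot (inv (2 * p).+1)) (nhwcoef_invariant s0 sroot (inv (2
  * p).+2))
  (fun i iN => nhwcoef_half_twist12 s0 sroot (iter (2 * p) (half_twist12 s true true) cup) iN)
  (fun i iN => nhwcoef_half_twist12 s0 sroot (iter (2 * p).+1 (half_twist12 s true true) cup) iN) jN).
rewrite (exprD _ 2 (2 * p) : kappa ^+ (2 * p).+2 = _) /= /kern !mulr_sumr.
apply: eq_bigr => k _; rewrite IH //.
case: (leqP k j) => kj; last by rewrite gb_small // !mul0r !mulr0.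
rewrite (bfac_split q0 x kj); ring.
Qed.

Lemma nhwcoef_cap_step V j : invariant s false true true false V -> (j < N)%N ->
  nhwcoef s (full_twist01 s V) 0 j = kappa ^- 2 * cap_step q N x (nhwcoef s V 0) j.
Proof.
move=> inv jN; have q0 := q_neq0 s0.
rewrite /full_twist01 nhwcoef_half_twist01 // middiag_half_twist01 // /cap_step !mulr_sumr; apply: eq_bigr
  => m _.
have -> : q ^- (m * j.+1).+1 = q^-1 * q ^- (m * j.+1) by rewrite [_ ^+ _.+1]exprS invfM.
have xj : x ^+ j != 0 by rewrite !expf_neq0.
have k0 : kappa != 0 by rewrite expfz_neq0.
have e (y k : F) : y ^+ j != 0 -> k != 0 ->
    k^-1 * y ^- j * (k^-1 * y ^+ j.+1) = k ^- 2 * y.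
  by move=> h1 h2; rewrite exprS; field; rewrite h1 h2.
transitivity (kappa^-1 * x ^- j * (kappa^-1 * x ^+ j.+1) *
  (gb m j * (q^-1 * q ^- (m * j.+1) * poch (x * q ^- m) (m - j) * nhwcoef s V 0 m))).
  by ring.
by rewrite e //; ring.
Qed.

Lemma inner_cap_half_twist01 V : invariant s false true true false V ->
  inner_cap (half_twist01 s false true V) ord0 ord0 = kappa^-1 * (x / q) * \sum_(m < N) q ^- m * nhwcoef s
    V 0 m.
Proof.
move=> inv; have q0 := q_neq0 s0; have qr := q_root sroot.
rewrite -mulrA -(cap_total q0 qr N x (nhwcoef s V 0)) mulr_sumr /inner_cap.
apply: eq_bigr => b _; rewrite -middiag_half_twist01 // /middiag inord_val //.
Qed.

(** Each full twist of the tensor is traded for one step of [mcoef]; i counts the twists already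
    moved into the linear form. *)
Lemma cap_steps m i V : invariant s false true true false V ->
  \sum_(j < N) q ^- j * mcoef q N x i j * nhwcoef s (iter m (@full_twist01 F s n) V) 0 j =
  (kappa ^- 2 * (x / q)) ^+ m * \sum_(j < N) q ^- j * mcoef q N x (m + i) j * nhwcoef s V 0 j.
Proof.
move=> inv; elim: m i => [|m IH] i; first by rewrite expr0 mul1r.
rewrite iterS.
under eq_bigr => j _ do rewrite (nhwcoef_cap_step (invariant_full_twists01 s0 sroot m inv) (ltn_ord j)) mulrCA.
rewrite -mulr_sumr cap_step_dual ?q_neq0 //.
set P := _ ^- 2; set Y := (_ / _).
have := IH i.+1; rewrite addnS addSn => ->.
rewrite -/P -/Y [(P * Y) ^+ m.+1]exprS; ring.
Qed.

(** Since N^2 - 1 = n^2 + 2n, the framing correction of the second region cancels its scalars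
    completely; from the first region s^(4np) survives. *)
Lemma jones_scalar m p :
  s ^ (- (((2 * m + 1)%:Z - (2 * p)%:Z) * (N%:Z ^+ 2 - 1))) *
  (kappa^-1 * (x / q) * (kappa ^- 2 * (x / q)) ^+ m * (kappa ^+ (2 * p) * v ^ (- n%:Z))) =
  (x / q) ^+ p.
Proof.
have -> : x / q = s ^ (4 * n%:Z).
  by rewrite exprS mulrC mulKf ?q_neq0 // -exprM exprnP; congr (_ ^ _); lia.
have -> : kappa ^- 2 = s ^ (2 * (n * n)%N%:Z) by rewrite /kappa; zpow s0; lia.
rewrite -expfzDr // /kappa /vq; zpow s0.
have -> : (N%:Z ^ 2%Z = (n%:Z + 1) * (n%:Z + 1)) by rewrite -exprnP expr2; lia.
lia.
Qed.

End TwistRegions.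

Lemma sqrt4q_root k : (0 < k)%N -> sqrt4q ^+ k != 1.
Proof.
move=> k0; rewrite /sqrt4q -rmorphXn -tofrac1 tofrac_eq.
apply/eqP => /(congr1 (fun p : {poly rat} => size p)).
by rewrite size_polyXn size_poly1; case: k k0.
Qed.

Lemma jones_double_twist n m p : let x := q ^+ n.+1 in
  colored_jones n.+1 (double_twist (- m%:Z) (- p%:Z)) =
  (x / q) ^+ p * \sum_(j < n.+1) q ^- j * bfac q x j * pcoef q n.+1 x p j * mcoef q n.+1 x m j.
Proof.
have s0 : sqrt4q != 0 by rewrite tofrac_eq0 polyX_eq0.
have sr := sqrt4q_root.
rewrite /= /colored_jones rt_ratio // writhe_double_twist half_twists01E.
have inv1 : invariant sqrt4q false true true false (iter (2 * p) (half_twist12 sqrt4q true true)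
  (@cup_state _ sqrt4q n.+1)).
  by apply: invariant_half_twists12 => //; apply: invariant_cup.
rewrite inner_cap_half_twist01 //; last exact: invariant_full_twists01.
have := cap_steps s0 sr m 0 inv1; rewrite addn0 /=.
under eq_bigr do rewrite mulr1.
move=> ->.
under eq_bigr => j _ do rewrite nhwcoef_twists // mulrCA.
rewrite -mulr_sumr -(jones_scalar s0 n m p) !mulrA; congr (_ * _).
apply: eq_bigr => j _; ring.
Qed.

(** * Nested sums over chains *)

Section SeqSums.
Context {F : fieldType} (N : nat).
Implicit Types (f g : seq nat -> F) (s t : seq nat).

(** Lists replace tuples so that a sum over all variables can be cut at a concatenation. *)
Fixpoint seqsum l f : F :=
  if l is l'.+1 then \sum_(k < N) seqsum l' (fun s => f (val k :: s)) else f [::].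

Lemma eq_seqsum l f g : (forall s, size s = l -> f s = g s) -> seqsum l f = seqsum l g.
Proof.
elim: l f g => [|l IH] f g h /=; first exact: h.
by apply: eq_bigr => k _; apply: IH => s sl; apply: h; rewrite /= sl.
Qed.

Lemma seqsum_mull l c f : seqsum l (fun s => c * f s) = c * seqsum l f.
Proof.
elim: l f => [|l IH] f //=; rewrite mulr_sumr.
by apply: eq_bigr => k _; rewrite IH.
Qed.

Lemma seqsum_sum l n (f : 'I_n -> seq nat -> F) :
  seqsum l (fun s => \sum_(k < n) f k s) = \sum_(k < n) seqsum l (f k).
Proof.
elim: l f => [|l IH] f //=; rewrite exchange_big /=.
by apply: eq_bigr => k _; rewrite IH.
Qed.

Lemma seqsum_cat a b f : seqsum (a + b) f = seqsum a (fun s => seqsum b (fun t => f (s ++ t))).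
Proof. by elim: a f => [|a IH] f //=; apply: eq_bigr => k _; rewrite IH. Qed.

Lemma seqsum_rcons l f : seqsum l.+1 f = \sum_(k < N) seqsum l (fun s => f (rcons s k)).
Proof.
rewrite -seqsum_sum -addn1 seqsum_cat; apply: eq_seqsum => s _ /=.
by apply: eq_bigr => k _; rewrite cats1.
Qed.

Lemma seqsum_tuple l f : \sum_(t : l.-tuple 'I_N) f [seq val x | x <- t] = seqsum l f.
Proof.
elim: l f => [|l IH] f.
  rewrite (bigD1 [tuple]) //= big1 ?addr0 // => t.
  by case/negP; apply/eqP/val_inj; rewrite /= (tuple0 t).
rewrite (reindex (fun p : 'I_N * l.-tuple 'I_N => [tuple of p.1 :: p.2])) /=; last first.
  exists (fun u : l.+1.-tuple 'I_N => (thead u, [tuple of behead u])) => [[k u] _|u _] /=.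
    by rewrite theadE; congr (_, _); apply: val_inj.
  by rewrite [RHS]tuple_eta; apply: val_inj.
rewrite -(pair_bigA _ (fun k (t : l.-tuple _) => f (val k :: [seq val x | x <- t]))) /=.
by apply: eq_bigr => k _; rewrite -IH.
Qed.

End SeqSums.

Section ChainSums.
Context {F : fieldType} (q : F).
Context (q0 : q != 0).
Context (qroot : forall n, (0 < n)%N -> q ^+ n != 1).
Notation gb := (gb q).
Implicit Types (f g : seq nat -> F) (s t : seq nat).

(** Sum over chains s_1 <= ... <= s_l <= a, weighted by the Gaussian binomials of consecutive
    entries including a. It is unrolled from the largest entry, hence the [rcons]. *)
Fixpoint chainsum l a f : F :=
  if l is l'.+1 then
    \sum_(k < a.+1) gb a k * chainsum l' k (fun s => f (rcons s k))
  else f [::].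

Lemma eq_chainsum l a f g : (forall s, size s = l -> f s = g s) -> chainsum l a f = chainsum l a g.
Proof.
elim: l a f g => [|l IH] a f g h /=; first exact: h.
by apply: eq_bigr => k _; rewrite (IH _ _ (fun s => g (rcons s k))) // => s sl; apply: h; rewrite size_rcons sl.
Qed.

Lemma chainsum_mull l a c f : chainsum l a (fun s => c * f s) = c * chainsum l a f.
Proof.
elim: l a f => [|l IH] a f //=; rewrite mulr_sumr.
by apply: eq_bigr => k _; rewrite IH mulrCA.
Qed.

Lemma chainsum_sum l a n (f : 'I_n -> seq nat -> F) :
  chainsum l a (fun s => \sum_(k < n) f k s) = \sum_(k < n) chainsum l a (f k).
Proof.
elim: l a f => [|l IH] a f //=; rewrite exchange_big /=.
by apply: eq_bigr => k _; rewrite IH mulr_sumr.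
Qed.

Lemma csum0 l f : chainsum l 0 f = f (nseq l 0%N).
Proof.
elim: l f => [|l IH] f //=; rewrite big_ord_recl big_ord0 gbn0 // mul1r addr0 IH.
by congr f; elim: l {IH} => //= l ->.
Qed.

Definition addl s t := [seq (x.1 + x.2)%N | x <- zip s t].

(* The chain version of [gb_vandermonde], by which two consecutive blocks of
   summation variables merge into one. *)
Lemma chainsum_vandermonde l a b f :
  chainsum l a (fun s => chainsum l b (fun t =>
    q ^ (\sum_(r < l) (nth 0%N s r)%:Z *
           ((nth 0%N (rcons t b) r.+1)%:Z - (nth 0%N (rcons t b) r)%:Z)) * f (addl s t))) =
  chainsum l (a + b) f.
Proof.
elim: l a b f => [|l IH] a b f /=; first by rewrite big_ord0 expr0z mul1r.
rewrite -(gb_vandermonde q0 qroot a b (fun r => chainsum l r (fun s => f (rcons s r)))).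
apply: eq_bigr => -[k /= ka] _; congr (_ * _).
rewrite chainsum_sum; apply: eq_bigr => -[j /=]; rewrite ltnS => jb _.
rewrite chainsum_mull; congr (_ * _).
rewrite -IH -chainsum_mull; apply: eq_chainsum => s ss.
rewrite -chainsum_mull; apply: eq_chainsum => t st.
rewrite mulrA; congr (_ * f _); last first.
  by rewrite /addl zip_rcons ?map_rcons ?ss ?st.
have sz : size (rcons t j) = l.+1 by rewrite size_rcons st.
have -> : \sum_(r < l.+1) (nth 0%N (rcons s k) r)%:Z *
      ((nth 0%N (rcons (rcons t j) b) r.+1)%:Z - (nth 0%N (rcons (rcons t j) b) r)%:Z) =
    \sum_(r < l) (nth 0%N s r)%:Z *
      ((nth 0%N (rcons t j) r.+1)%:Z - (nth 0%N (rcons t j) r)%:Z) +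
    k%:Z * (b%:Z - j%:Z).
  rewrite big_ord_recr /=; congr (_ + _ * (_%:Z - _%:Z)); last first.
  - by rewrite nth_rcons sz ltnSn nth_rcons st ltnn eqxx.
  - by rewrite nth_rcons sz ltnn eqxx.
  - by rewrite nth_rcons ss ltnn eqxx.
  apply: eq_bigr => -[r /= rl] _.
  by rewrite !(nth_rcons _ (rcons t j)) sz nth_rcons ss rl !ltnS rl ltnW.
rewrite expfzDr // mulrC; congr (_ * _).
rewrite exprnP; congr (_ ^ _).
by rewrite PoszM -subzn.
Qed.

Lemma csumS l a f :
  chainsum l.+1 a f = \sum_(k < a.+1) gb a k * chainsum l k (fun s => f (rcons s k)).
Proof. by []. Qed.

(** The same chains unrolled from the lowest entry u, from which the others are then measured; the
    induction uses trinomial revision. *)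
Lemma chainsum_bottom l w f :
  chainsum l.+1 w f =
  \sum_(u < w.+1) gb w u * chainsum l (w - u) (fun s => f (val u :: [seq (u + x)%N | x <- s])).
Proof.
elim: l w f => [|l IH] w f; first by [].
transitivity (\sum_(k < w.+1) \sum_(u < w.+1) gb w k * gb k u *
    chainsum l (k - u) (fun s => f (rcons (val u :: [seq (u + x)%N | x <- s]) k))).
  rewrite csumS; apply: eq_bigr => k _.
  rewrite IH -(@big_gb _ q k w.+1 (fun u => chainsum l (k - u) (fun s => f (rcons (u :: [seq (u + x)%N | x
    <- s]) k))) (ltn_ord k)) mulr_sumr.
  by apply: eq_bigr => u _; rewrite mulrA.
rewrite exchange_big /=; apply: eq_bigr => -[u /= uw] _.
rewrite (gb_conv q0 qroot u (fun k => chainsum l (k - u) (fun s => f (u :: rcons [seq (u + x)%N | x <- s]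
  k))) (ltnSn w)).
congr (_ * _); apply: eq_bigr => t _; rewrite addKn; congr (_ * _).
by apply: eq_chainsum => s _; rewrite map_rcons.
Qed.

Context (N : nat).

Definition gbchain l z s : F :=
  \prod_(i < l) gb (nth 0%N (z :: s) i.+1) (nth 0%N (z :: s) i).

Lemma seqsum_gbchain_top l w z f : (w < N)%N ->
  seqsum N l (fun s => gbchain l z s * gb w (last z s) * f s) =
  gb w z * chainsum l (w - z) (fun s => f [seq (z + x)%N | x <- s]).
Proof.
elim: l w f => [|l IH] w f wN; first by rewrite /= /gbchain big_ord0 mul1r.
rewrite seqsum_rcons csumS.
transitivity (\sum_(k < N) gb w k * gb k z *
    chainsum l (k - z) (fun s => f (rcons [seq (z + x)%N | x <- s] k))).
  apply: eq_bigr => -[k /= kN] _; rewrite -mulrA -(IH k (fun s => f (rcons s k)) kN) -seqsum_mull.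
  apply: eq_seqsum => s ss; rewrite last_rcons /gbchain big_ord_recr /=.
  rewrite nth_rcons ss ltnn eqxx.
  have -> : nth 0%N (z :: rcons s k) l = last z s.
    by rewrite (last_nth 0%N) ss -rcons_cons nth_rcons /= ss ltnSn.
  rewrite [X in X * gb k _](_ : _ = gbchain l z s) /gbchain; first by ring.
  apply: eq_bigr => -[i /= il] _.
  by rewrite -rcons_cons !nth_rcons /= ss ltnS (ltnW il) il.
rewrite (gb_conv q0 qroot z (fun k => chainsum l (k - z) (fun s => f (rcons [seq (z + x)%N | x <- s] k))) wN).
congr (_ * _); apply: eq_bigr => t _; rewrite addKn; congr (_ * _).
by apply: eq_chainsum => s _; rewrite map_rcons.
Qed.

(** Measured from the variable z before it, a block with last variable w is a chain with top w -
    z. *)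
Lemma seqsum_gbchain l z f :
  seqsum N l.+1 (fun s => gbchain l.+1 z s * f s) =
  \sum_(w < N) gb w z *
     chainsum l (w - z) (fun s => f [seq (z + x)%N | x <- rcons s (w - z)%N]).
Proof.
rewrite seqsum_rcons; apply: eq_bigr => -[w /= wN] _.
transitivity (gb w z * chainsum l (w - z) (fun s => f (rcons [seq (z + x)%N | x <- s] w))).
  rewrite -(@seqsum_gbchain_top l w z (fun s => f (rcons s w))) //; apply: eq_seqsum => s ss.
  rewrite /gbchain big_ord_recr /= nth_rcons ss ltnn eqxx; congr (_ * _ * _).
    apply: eq_bigr => -[i /= il] _.
    by rewrite -rcons_cons !nth_rcons /= ss ltnS (ltnW il) il.
  congr (gb _ _).
  by rewrite (last_nth 0%N) ss -rcons_cons nth_rcons /= ss ltnSn.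
case: (leqP z w) => zw; last by rewrite gb_small // !mul0r.
by congr (_ * _); apply: eq_chainsum => s _; rewrite map_rcons subnKC.
Qed.

End ChainSums.

Local Arguments chainsum : simpl never.

(** * Exponents in the multisum *)

Lemma binS2D a b :
  'C((a + b).+1, 2)%:Z = 'C(a.+1, 2)%:Z + 'C(b.+1, 2)%:Z + a%:Z * b%:Z.
Proof. by rewrite !binS !bin1 bin2D; lia. Qed.

Lemma telescope_ord (V : zmodType) n (g : nat -> V) :
  \sum_(s < n) (g s - g s.+1) = g 0%N - g n.
Proof.
elim: n => [|n IH]; first by rewrite big_ord0 subrr.
by rewrite big_ord_recr IH /= addrA subrK.
Qed.

Lemma sum_delta (R : nzRingType) n c (g : nat -> R) :
  \sum_(i < n) (val i == c)%:R * g i = if (c < n)%N then g c else 0.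
Proof.
case: ltnP => h; last first.
  rewrite big1 // => i _; case: (val i =P c) => [e|_]; rewrite ?mul0r //.
  by have := ltn_ord i; rewrite -[nat_of_ord i]/(val i) e ltnNge h.
rewrite (bigD1 (Ordinal h)) //= eqxx mul1r big1 ?addr0 // => i.
by rewrite -val_eqE /= => /negbTE->; rewrite mul0r.
Qed.

Section Exponents.
Context (m : nat) (m0 : (0 < m)%N) (N : nat).
Notation M := (2 * m + 1)%N.
Implicit Types (n c : nat -> nat) (l : nat -> int).

Lemma sum_middle (V : zmodType) (g : nat -> V) :
  \sum_(r < 2 * m) g r = \sum_(s < m) (g (m + s)%N + g (m - s.+1)%N).
Proof.
rewrite mul2n -addnn big_split_ord /= addrC big_split /=; congr (_ + _).
rewrite (reindex_inj rev_ord_inj) /=; apply: eq_bigr => s _; congr g.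
Qed.

(* [epsilon m i j], extended by 0 to the pairs excluded from the product;
   for [j = m] the four terms cancel. *)
Definition epsres i j : int :=
  let s := (i %% M)%N in let r := (j %% M)%N in
  if s == 0%N then 0 else
  (s + r == M)%N%:R + (s + r == 2 * m)%N%:R - (s == r)%:R - (s == r.+1)%:R.

Lemma epsres_l b i j : epsres (b * M + i) j = epsres i j.
Proof. by rewrite /epsres modnMDl. Qed.

Lemma epsres_r b i j : epsres i (b * M + j) = epsres i j.
Proof. by rewrite /epsres modnMDl. Qed.

(** As k <= 2m+1, each of the four conditions has at most one solution i < k; the vanishing of [n 0]
    covers the excluded residue 0. *)
Lemma epsres_sum k r n : n 0%N = 0%N -> (0 < r <= 2 * m)%N -> (k <= M)%N ->
  \sum_(i < k) epsres i r * (n i)%:Z =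
    (if (M - r < k)%N then (n (M - r)%N)%:Z else 0) +
    (if (2 * m - r < k)%N then (n (2 * m - r)%N)%:Z else 0) -
    (if (r < k)%N then (n r)%:Z else 0) -
    (if (r.+1 < k)%N then (n r.+1)%:Z else 0).
Proof.
move=> n0 /andP[r0 r2] kM.
rewrite -!(sum_delta _ _ (fun i => (n i)%:Z)) -big_split -!sumrB /=.
apply: eq_bigr => -[i /= ik] _.
rewrite /epsres (modn_small (leq_trans ik kM)) modn_small; last by lia.
case: eqP => [->|i0]; first by rewrite n0 !mulr0; ring.
rewrite -!mulrDl -!mulrBl; congr ((_%:R + _%:R - _ - _) * _); lia.
Qed.

Lemma epsres_sum0 k n : n 0%N = 0%N -> (k <= M)%N ->
  \sum_(i < k) epsres i M * (n i)%:Z =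
    (if (2 * m < k)%N then (n (2 * m)%N)%:Z else 0) -
    (if (1 < k)%N then (n 1%N)%:Z else 0).
Proof.
move=> n0 kM.
rewrite -!(sum_delta _ _ (fun i => (n i)%:Z)) -!sumrB /=.
apply: eq_bigr => -[i /= ik] _.
rewrite /epsres (modn_small (leq_trans ik kM)) modnn /= addn0.
case: eqP => [->|i0]; first by rewrite n0 !mulr0; ring.
rewrite -!mulrBl (_ : (i == M) = false) ?add0r ?subr0 //.
by have := leq_trans ik kM; lia.
Qed.

Definition marked r := ((r %% M == m) || (r %% M == 0))%N.

(* Exponent of [q] contributed by the variables [n 1, ..., n k]; [l] is the
   linear form by which the preceding blocks act on them, [n 0] the variable
   preceding them. *)
Definition prefix_exp k l n : int := \sum_(r < k)
  ((n r.+1)%:Z * (l r.+1 + \sum_(i < r.+1) epsres i r.+1 * (n i)%:Z) +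
   (marked r.+1)%:R * (N%:Z * (n r.+1)%:Z + 'C((n r.+1).+1, 2)%:Z) +
   gamma m r.+1 * (n r.+1)%:Z - (n r)%:Z * (n r.+1)%:Z).

Definition signs k n : nat := \sum_(r < k) marked r.+1 * n r.+1.

Lemma prefix_expD b k n : prefix_exp (b * M + k) (fun=> 0) n =
  prefix_exp (b * M) (fun=> 0) n +
  prefix_exp k (fun r => \sum_(i < b * M) epsres i r * (n i)%:Z) (fun i => n (b * M + i)%N).
Proof.
rewrite /prefix_exp big_split_ord /=; congr (_ + _); apply: eq_bigr => r _.
rewrite -!addnS /marked /gamma !modnMDl; congr (_ * _ + _ + _ - _).
rewrite add0r big_split_ord /=; congr (_ + _).
  by apply: eq_bigr => i _; rewrite epsres_r.
by apply: eq_bigr => i _; rewrite epsres_r epsres_l.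
Qed.

Lemma signsD b k n :
  signs (b * M + k) n = (signs (b * M) n + signs k (fun i => n (b * M + i)%N))%N.
Proof.
rewrite /signs big_split_ord /=; congr (_ + _)%N; apply: eq_bigr => r _.
by rewrite -!addnS /marked modnMDl.
Qed.

(* The exponent of a block, written symmetrically around its middle variable. *)
Definition chain_exp n : int :=
  'C((n m).+1, 2)%:Z + N%:Z * (n m)%:Z + \sum_(s < m)
   ((n (m + s).+1)%:Z * ((n (m - s)%N)%:Z + (n (m - s.+1)%N)%:Z)
    - (n (m + s)%N)%:Z * (n (m + s).+1)%:Z - (n (m - s)%N)%:Z * (n (m - s.+1)%N)%:Z
    + (n (m - s.+1)%N)%:Z - (n (m + s).+1)%:Z).

Lemma gammaE r : (0 < r <= 2 * m)%N ->
  gamma m r = if (r < m)%N then 1 else if r == m then 0 else -1.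
Proof.
move=> /andP[r0 r2]; rewrite /gamma modn_small; last lia.
case: (ltngtP r m) => h.
- by rewrite (_ : (0 < r <= m - 1)%N); last lia.
- by rewrite ifF ?ifT //; lia.
- by rewrite !ifF //; lia.
Qed.

(** Inside a block the conditions for -1 have no solution i < j, and those for 1 have solutions only
    when j > m. Pairing the indices m + s + 1 and m - s gives the symmetric form; the remaining
    linear terms telescope. *)
Lemma prefix_exp_block l n :
  prefix_exp (2 * m) l n = chain_exp n - (n 0%N)%:Z - (n (2 * m)%N)%:Z * (n 0%N)%:Z +
    \sum_(r < 2 * m) (n r.+1)%:Z * l r.+1.
Proof.
(* Index 0 is excluded from the epsilon terms but present in [chain_exp]; this is the origin of the
   correction by the product of [n (2 * m)] and [n 0]. *)
pose n' i := if i == 0%N then 0%N else n i.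
pose h r := (n r.+1)%:Z * (if (m < r.+1)%N then (n' (M - r.+1)%N)%:Z + (n' (2 * m - r.+1)%N)%:Z else 0) +
  (r.+1 == m)%:R * (N%:Z * (n r.+1)%:Z + 'C((n r.+1).+1, 2)%:Z) +
   (if (r.+1 < m)%N then 1 else if r.+1 == m then 0 else -1) * (n r.+1)%:Z - (n r)%:Z * (n r.+1)%:Z.
have -> : prefix_exp (2 * m) l n = \sum_(r < 2 * m) h r + \sum_(r < 2 * m) (n r.+1)%:Z * l r.+1.
  rewrite -big_split /=; apply: eq_bigr => -[r /= rm] _.
  rewrite gammaE; last by rewrite rm.
  rewrite /marked modn_small; last lia.
  rewrite orbF.
  have -> : \sum_(i < r.+1) epsres i r.+1 * (n i)%:Z =
     if (m < r.+1)%N then (n' (M - r.+1)%N)%:Z + (n' (2 * m - r.+1)%N)%:Z else 0.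
    transitivity (\sum_(i < r.+1) epsres i r.+1 * (n' i)%:Z).
      by apply: eq_bigr => -[[|i] /= hi] _ //; rewrite /epsres mod0n !mul0r.
    rewrite epsres_sum //; try lia.
    rewrite ltnn [(r.+2 < _)%N]ltnNge leqnSn /= !subr0.
    case: (ltnP m r.+1) => h1; first by rewrite !ifT //; lia.
    by rewrite !ifF ?addr0 //; lia.
  rewrite /h; ring.
congr (_ + _); rewrite sum_middle /chain_exp.
transitivity (\sum_(s < m) (((n (m + s).+1)%:Z * ((n (m - s)%N)%:Z + (n (m - s.+1)%N)%:Z)
    - (n (m + s)%N)%:Z * (n (m + s).+1)%:Z - (n (m - s)%N)%:Z * (n (m - s.+1)%N)%:Z
    + (n (m - s.+1)%N)%:Z - (n (m + s).+1)%:Z) +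
    (val s == 0)%N%:R * (N%:Z * (n (m - s)%N)%:Z + 'C((n (m - s)%N).+1, 2)%:Z - (n (m - s)%N)%:Z) -
    (val s == m.-1)%:R * ((n (m + s).+1)%:Z * (n 0%N)%:Z) +
    ((n (m - s)%N)%:Z - (n (m - s.+1)%N)%:Z))).
  apply: eq_bigr => -[s /= sm] _; rewrite /h.
  have e1 : (m - s.+1).+1 = (m - s)%N by lia.
  have e2 : (M - (m + s).+1 = m - s)%N by lia.
  have e3 : (2 * m - (m + s).+1 = m - s.+1)%N by lia.
  have i1 : (m < (m + s).+1)%N by lia.
  have i2 : (m < m - s)%N = false by lia.
  have i3 : ((m + s).+1 < m)%N = false by lia.
  have i4 : ((m + s).+1 == m) = false by lia.
  rewrite e1 e2 e3 i1 i2 i3 i4.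
  have -> : (n' (m - s)%N)%:Z = (n (m - s)%N)%:Z by rewrite /n' ifF //; lia.
  have -> : (n' (m - s.+1)%N)%:Z = (n (m - s.+1)%N)%:Z - (s == m.-1)%:R * (n 0%N)%:Z.
    rewrite /n'; case: eqP => [e|e].
      by rewrite (_ : s == m.-1) ?e ?mul1r ?subrr //; lia.
    by rewrite (_ : s == m.-1 = false) ?mul0r ?subr0 //; lia.
  case: (posnP s) => [->|s0].
    by rewrite subn0 eqxx ltnn mulr0n mulr1n; ring.
  have j1 : (m - s == m)%N = false by lia.
  have j2 : (m - s < m)%N by lia.
  rewrite j1 j2 !mulr0n; ring.
rewrite big_split sumrB big_split /=.
rewrite (telescope_ord _ (fun s => (n (m - s)%N)%:Z)).
rewrite (sum_delta _ _ (fun s => N%:Z * (n (m - s)%N)%:Z + 'C((n (m - s)%N).+1, 2)%:Z - (n (m - s)%N)%:Z)).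
rewrite (sum_delta _ _ (fun s => (n (m + s).+1)%:Z * (n 0%N)%:Z)).
rewrite m0 prednK // leqnn !subn0 subnn.
have -> : (m + m.-1).+1 = (2 * m)%N by lia.
ring.
Qed.

(** The terms linear in z telescope along the upper half m, ..., 2m of the indices, and the middle
    variable cancels against the cross term of the binomial. *)
Lemma chain_exp_shift z n c : (forall r, (r <= 2 * m)%N -> n r = z + c r)%N ->
  chain_exp n = chain_exp c + 'C(z.+1, 2)%:Z + N%:Z * z%:Z + z%:Z * (c (2 * m)%N)%:Z.
Proof.
move=> nE; rewrite /chain_exp nE ?leq_pmull // binS2D PoszD.
have -> : \sum_(s < m)
   ((n (m + s).+1)%:Z * ((n (m - s)%N)%:Z + (n (m - s.+1)%N)%:Z)
    - (n (m + s)%N)%:Z * (n (m + s).+1)%:Z - (n (m - s)%N)%:Z * (n (m - s.+1)%N)%:Z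
    + (n (m - s.+1)%N)%:Z - (n (m + s).+1)%:Z) =
  \sum_(s < m)
   ((c (m + s).+1)%:Z * ((c (m - s)%N)%:Z + (c (m - s.+1)%N)%:Z)
    - (c (m + s)%N)%:Z * (c (m + s).+1)%:Z - (c (m - s)%N)%:Z * (c (m - s.+1)%N)%:Z
    + (c (m - s.+1)%N)%:Z - (c (m + s).+1)%:Z) -
  z%:Z * \sum_(s < m) ((c (m + s)%N)%:Z - (c (m + s.+1)%N)%:Z).
  rewrite mulr_sumr -sumrB; apply: eq_bigr => -[s /= sm] _.
  rewrite !nE ?PoszD ?addnS; try lia.
rewrite (telescope_ord _ (fun s => (c (m + s)%N)%:Z)) addn0.
have -> : (m + m = 2 * m)%N by lia.
ring.
Qed.

(* The interaction of two blocks is the polarization of [chain_exp], up to the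
   exponent in [chainsum_vandermonde]. *)
Lemma chain_exp_add k n : n 0%N = 0%N -> k 0%N = 0%N -> k M = 0%N ->
  \sum_(r < 2 * m) (n r.+1)%:Z * (\sum_(i < M) epsres i r.+1 * (k i)%:Z) =
  chain_exp (fun r => k r + n r)%N - chain_exp k - chain_exp n - (k (2 * m)%N)%:Z * (n (2 * m)%N)%:Z
  + \sum_(r < 2 * m) (k r)%:Z * ((n r.+1)%:Z - (n r)%:Z).
Proof.
move=> n0 k0 kM.
have -> : \sum_(r < 2 * m) (n r.+1)%:Z * (\sum_(i < M) epsres i r.+1 * (k i)%:Z) =
  \sum_(r < 2 * m) (n r.+1)%:Z * ((k (M - r.+1)%N)%:Z + (k (2 * m - r.+1)%N)%:Z - (k r.+1)%:Z - (k r.+2)%:Z).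
  apply: eq_bigr => -[r /= rm] _; rewrite epsres_sum //.
  congr (_ * (_ + _ - _ - _)).
  - by rewrite ifT //; lia.
  - by rewrite ifT //; lia.
  - by rewrite ifT //; lia.
  - by case: ltnP => // h; rewrite (_ : r.+2 = M) ?kM //; lia.
rewrite (sum_middle (fun r => (n r.+1)%:Z * ((k (M - r.+1)%N)%:Z + (k (2 * m - r.+1)%N)%:Z - (k r.+1)%:Z -
  (k r.+2)%:Z))).
rewrite (sum_middle (fun r => (k r)%:Z * ((n r.+1)%:Z - (n r)%:Z))).
rewrite /chain_exp binS2D PoszD.
pose g s := (k (m + s)%N)%:Z * (n (m + s)%N)%:Z + (n (m + s)%N)%:Z * (k (m + s).+1)%:Z
  + (n (m - s)%N)%:Z * (k (m + s)%N)%:Z - (n (m - s)%N)%:Z * (k (m - s)%N)%:Z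
  - (n (m - s)%N)%:Z * (k (m - s).+1)%:Z.
have gE : \sum_(s < m) (g s - g s.+1) = (k m)%:Z * (n m)%:Z - (k (2 * m)%N)%:Z * (n (2 * m)%N)%:Z.
  rewrite telescope_ord /g !subn0 !subnn !addn0 n0.
  have -> : (m + m = 2 * m)%N by lia.
  by rewrite -(addn1 (2 * m)) kM; ring.
have -> : (k (2 * m)%N)%:Z * (n (2 * m)%N)%:Z =
  (k m)%:Z * (n m)%:Z - \sum_(s < m) (g s - g s.+1) by rewrite gE; ring.
set A := \sum_(s < m) _; set B := \sum_(s < m) _; set C := \sum_(s < m) _.
set D := \sum_(s < m) _; set E := \sum_(s < m) _; set G := \sum_(s < m) _.
suff : A = B - C - D + E + G by move=> ->; ring.
rewrite /A /B /C /D /E /G -!sumrB -!big_split /=; apply: eq_bigr => -[s /= sm] _.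
have e1 : (m - s.+1).+1 = (m - s)%N by lia.
have e2 : (M - (m + s).+1 = m - s)%N by lia.
have e3 : (2 * m - (m + s).+1 = m - s.+1)%N by lia.
have e4 : (M - (m - s) = (m + s).+1)%N by lia.
have e5 : (2 * m - (m - s) = m + s)%N by lia.
rewrite /g !(addnS m) !PoszD e1 e2 e3 e4 e5; ring.
Qed.

End Exponents.

(** * Linear forms by which blocks act on later variables *)

Section Couplings.
Context (m : nat) (m0 : (0 < m)%N) (N : nat).
Notation M := (2 * m + 1)%N.
Implicit Types (n c k : nat -> nat).

(* Invariant under translation of [k], see [coupling_shift]: this lets each
   block be measured from the last variable of the block before it. *)
Definition coupling k r : int := \sum_(i < M) epsres m i r * (k i)%:Z.

Lemma coupling_mod k r : coupling k (r %% M) = coupling k r.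
Proof.
apply: eq_bigr => i _; congr (_ * _).
by rewrite {2}(divn_eq r M) epsres_r.
Qed.

Lemma eq_coupling k n r : (forall i, (0 < i < M)%N -> k i = n i) -> coupling k r = coupling n r.
Proof.
move=> h; apply: eq_bigr => -[[|i] /= iM] _; last by rewrite h.
by rewrite /epsres mod0n !mul0r.
Qed.

(** Over a period of i the values 1 and -1 balance: when a solution for 1 falls on the excluded
    residue 0, so does one for -1. *)
Lemma coupling_cst r : coupling (fun i => (0 < i)%N) r = 0.
Proof.
rewrite -coupling_mod; have := ltn_pmod r (_ : 0 < M)%N.
rewrite {1}addn1 => /(_ isT); move: (r %% M)%N => {}r rM.
case: (posnP r) => [->|r0].
  transitivity (coupling (fun i => (0 < i)%N) M).
    by rewrite -[RHS]coupling_mod modnn.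
  rewrite /coupling (@epsres_sum0 m m0 M (fun i => (0 < i)%N)) // !ifT //; lia.
rewrite /coupling (@epsres_sum m m0 M r (fun i => (0 < i)%N)) //; last by rewrite r0; lia.
have e1 : (M - r < M)%N by lia.
have e2 : (2 * m - r < M)%N by lia.
have e3 : (0 < M - r)%N by lia.
rewrite e1 e2 e3 rM r0 /=; case: (ltnP r.+1 M) => h.
  by have -> : (0 < 2 * m - r)%N by lia.
by have -> : (0 < 2 * m - r)%N = false by lia.
Qed.

Lemma coupling_shift z k n r : (forall i, (0 < i < M)%N -> n i = z + k i)%N ->
  coupling n r = coupling k r.
Proof.
move=> h; rewrite (@eq_coupling n (fun i => z * (0 < i) + k i)%N); last first.
  by move=> i hi; rewrite h //; case/andP: hi => -> _; rewrite muln1.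
rewrite -[RHS]add0r -(mulr0 z%:Z) -(coupling_cst r) mulr_sumr -big_split /=.
by apply: eq_bigr => i _; rewrite PoszD PoszM; ring.
Qed.

(** The sum over a period of the other index vanishes as well: after reversal of the order, the four
    shifted sums telescope. *)
Lemma coupling_sum k : k 0%N = 0%N -> k M = 0%N ->
  \sum_(r < 2 * m) coupling k r.+1 = - coupling k M.
Proof.
move=> k0 kM.
transitivity (\sum_(r < 2 * m) ((k (2 * m - r)%N)%:Z + (k (2 * m - r.+1)%N)%:Z - (k r.+1)%:Z - (k r.+2)%:Z)).
  apply: eq_bigr => -[r /= rm] _; rewrite /coupling epsres_sum //.
  congr (_ + _ - _ - _).
  - by rewrite ifT; [congr ((k _)%:Z)|]; lia.
  - by rewrite ifT //; lia.
  - by rewrite ifT //; lia.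
  - by case: ltnP => // h; rewrite (_ : r.+2 = M) ?kM //; lia.
rewrite !sumrB big_split /=.
rewrite (reindex_inj rev_ord_inj) /=.
rewrite [\sum_(i < 2 * m) (k (2 * m - i.+1)%N)%:Z](reindex_inj rev_ord_inj) /= -!big_split -!sumrB /=.
transitivity (\sum_(r < 2 * m) (((k r)%:Z + (k r.+1)%:Z) - ((k r.+1)%:Z + (k r.+2)%:Z))).
  apply: eq_bigr => -[r /= rm] _.
  have -> : (2 * m - (2 * m - r.+1))%N = r.+1 by lia.
  have -> : (2 * m - (2 * m - r.+1).+1)%N = r by lia.
  ring.
rewrite (telescope_ord _ (fun r => (k r)%:Z + (k r.+1)%:Z)) k0 -(addn1 (2 * m)) kM.
by rewrite /coupling epsres_sum0 // !ifT; try lia; ring.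
Qed.

Lemma signs_block n : signs m (2 * m) n = n m.
Proof.
rewrite /signs; have h : (m.-1 < 2 * m)%N by lia.
rewrite (bigD1 (Ordinal h)) //= prednK // /marked modn_small; last lia.
rewrite eqxx mul1n big1 ?addn0 // => -[r /= rm].
rewrite -val_eqE /= => rm'; rewrite modn_small; last lia.
by rewrite (_ : (r.+1 == m) = false) ?mul0n //; apply/eqP => e; move: rm'; rewrite -e eqxx.
Qed.

(** Removes the outermost layer of the symmetric form, with indices 0 and 2m+2; this drives the
    induction in [mkern_chainsum]. *)
Lemma chain_expS n : n 0%N = 0%N ->
  chain_exp m.+1 N n = chain_exp m N (fun r => n r.+1) +
    (n (2 * m.+1)%N)%:Z * ((n 1%N)%:Z - (n (2 * m).+1)%:Z - 1).
Proof.
move=> n0; have z0 : (n 0%N)%:Z = 0 by rewrite n0.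
rewrite /chain_exp big_ord_recr /= subnn subSn // subnn.
have -> : (m.+1 + m = (2 * m).+1)%N by lia.
have -> : (2 * m.+1 = (2 * m).+2)%N by lia.
set A := \sum_(i < m) _; set B := \sum_(i < m) _.
have -> : A = B.
  apply: eq_bigr => -[s /= sm] _.
  have -> : (m.+1 - s = (m - s).+1)%N by lia.
  have -> : (m.+1 - s.+1 = (m - s.+1).+1)%N by lia.
  by rewrite !addSn; ring.
rewrite z0; ring.
Qed.

End Couplings.

(** * Summation of the multisum block by block *)

Section ChainWeights.
Context {F : fieldType} (q : F) (q0 : q != 0).
Context (qroot : forall n, (0 < n)%N -> q ^+ n != 1).
Context (N : nat) (N0 : (0 < N)%N).
Notation x := (q ^+ N).
Notation gb := (gb q).
Notation poch := (poch q).
Notation chainsum := (chainsum q).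
Implicit Types (n c : nat -> nat) (s t y : seq nat).

(* Index 0 stands for the implicit bound [n_0 = 0]. *)
Definition chain s i := nth 0%N (0%N :: s) i.

Lemma chain_default s i : (size s < i)%N -> chain s i = 0%N.
Proof. by move=> h; rewrite /chain nth_default. Qed.

Lemma chain_rcons s a i : (i <= size s)%N -> chain (rcons s a) i = chain s i.
Proof. by move=> h; rewrite /chain -rcons_cons nth_rcons /= ltnS h. Qed.

Lemma chain_last s a : chain (rcons s a) (size s).+1 = a.
Proof. by rewrite /chain -rcons_cons nth_rcons /= ltnn eqxx. Qed.

Lemma chain_map z s i : (0 < i <= size s)%N ->
  chain [seq (z + x)%N | x <- s] i = (z + chain s i)%N.
Proof. by case: i => // i /= h; rewrite /chain /= (nth_map 0%N). Qed.

Definition chain_wt m n : F := (-1) ^+ n m * q ^ chain_exp m N n.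

Lemma chain_wtS m u a k c n : (0 < m)%N -> n 0%N = 0%N ->
  (forall r, (r <= 2 * m)%N -> n r.+1 = u + c r)%N -> n (2 * m.+1)%N = a ->
  c 0%N = 0%N -> c (2 * m)%N = k ->
  chain_wt m.+1 n = (-1) ^+ u *
    q ^ ('C(u.+1, 2)%:Z + N%:Z * u%:Z + u%:Z * k%:Z - k%:Z * a%:Z - a%:Z) * chain_wt m c.
Proof.
move=> m0 n0 nE na c0 ck; rewrite /chain_wt nE ?leq_pmull // exprD.
rewrite chain_expS // (chain_exp_shift m0 N nE) ck na (nE 0%N) // (nE (2 * m)%N) // c0 ck addn0.
rewrite mulrACA -!mulrA; congr (_ * (_ * _)).
by rewrite -expfzDr //; congr (q ^ _); rewrite PoszD; ring.
Qed.

Lemma mkernS m a : mkern q N x m.+1 a =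
  \sum_(k < N) gb a k * q ^- (k * a.+1) * poch (x * q ^+ k.+1) (a - k) * mkern q N x m k.
Proof. by []. Qed.

(** Induction on m. Let j be the variable below the top a. Removing a and measuring the rest from
    the lowest variable u leaves a chain of the same kind with top k = j - u; for fixed k the sum
    over j is a q-binomial sum and gives the Pochhammer factor of [mkern]. *)
Lemma mkern_chainsum m a : (0 < m)%N -> (a < N)%N ->
  q ^+ a * chainsum (2 * m).-1 a (fun s => chain_wt m (chain (rcons s a))) = mkern q N x m a.
Proof.
case: m => // m _; elim: m a => [|m IH] a aN.
  rewrite csumS /chainsum /= [RHS](bigD1 (Ordinal N0)) //= [X in _ = _ + X]big1 ?addr0 => [|k]; last first.
    by rewrite -val_eqE /= => /negbTE->; rewrite mulr0.
  rewrite gbn0 // mul0n expr0 invr1 !mulr1 mul1r subn0 expr1.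
  rewrite -gb_binomial // mulr_sumr; apply: eq_bigr => t _.
  rewrite mulrCA; congr (_ * _).
  rewrite /chain_wt /chain_exp /chain /= big_ord_recl big_ord0 /= addr0.
  rewrite mulrCA -mulrA; congr (_ * _).
  rewrite exprMn -exprM; zpow q0; rewrite binS bin1; lia.
rewrite mkernS (_ : (2 * m.+2).-1 = (2 * m.+1).-1.+2); last lia.
move: IH; set L := (2 * m.+1).-1 => IH; have eL : L.+1 = (2 * m.+1)%N by lia.
clearbody L.
transitivity (\sum_(k < N) gb a k * (q ^- (k * a) * q ^- k * mkern q N x m.+1 k * poch (x * q ^+ k.+1) (a -
  k))); last first.
  apply: eq_bigr => k _.
  by rewrite mulnS exprD invfM; ring.
rewrite (@big_gb _ q a N (fun k => q ^- (k * a) * q ^- k * mkern q N x m.+1 k * poch (x * q ^+ k.+1) (a -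
  k)) aN).
rewrite csumS.
transitivity (\sum_(j < a.+1) \sum_(k < a.+1) gb a j * gb j k * (
   (-1) ^+ (j - k) * q ^ ('C((j - k).+1, 2)%:Z + N%:Z * (j - k)%N%:Z + (j - k)%N%:Z * k%:Z - k%:Z * a%:Z) *
   chainsum L k (fun s => chain_wt m.+1 (chain (rcons s k))))).
  rewrite mulr_sumr; apply: eq_bigr => -[j /= ja] _.
  under [RHS]eq_bigr => k _ do rewrite -mulrA.
  rewrite -mulr_sumr mulrCA; congr (_ * _).
  pose h k := (-1) ^+ (j - k) * q ^ ('C((j - k).+1, 2)%:Z + N%:Z * (j - k)%N%:Z + (j - k)%N%:Z * k%:Z -
    k%:Z * a%:Z) *
     chainsum L k (fun s => chain_wt m.+1 (chain (rcons s k))).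
  rewrite (@big_gb _ q j _ h ja) chainsum_bottom //.
  (* The sum is indexed by k = j - u instead of the lowest variable u. *)
  rewrite (@gb_rev _ q j (fun u => chainsum _ (j - u) (fun s => chain_wt m.+2 (chain (rcons (rcons (u ::
    [seq (u + z)%N | z <- s]) j) a))))).
  rewrite mulr_sumr; apply: eq_bigr => -[k /=]; rewrite ltnS => kj _.
  rewrite mulrCA; congr (_ * _); rewrite subKn // /h -chainsum_mull -chainsum_mull.
  apply: eq_chainsum => s ss.
  rewrite (@chain_wtS m.+1 (j - k) a k (chain (rcons s k))) //; last first.
  - by rewrite -eL -ss chain_last.
  - rewrite (_ : (2 * m.+2)%N = (size (j - k :: rcons [seq (j - k + z)%N | z <- s] j)%N).+1).
      by rewrite -!rcons_cons chain_last.
    by rewrite /= size_rcons size_map ss; lia.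
  - have -> : rcons [seq (j - k + z)%N | z <- s] j = [seq (j - k + z)%N | z <- rcons s k].
      by rewrite map_rcons subnK.
    rewrite -eL => -[|r] rL; first by rewrite addn0.
    rewrite -[LHS]/(chain (rcons [seq (j - k + z)%N | z <- rcons s k] a) r.+1).
    by rewrite chain_rcons ?chain_map ?size_map ?size_rcons ?ss.
  have e X : q ^ X = q ^+ a * q ^ (X - a%:Z) by zpow q0; ring.
  by rewrite [in RHS]e; ring.
rewrite exchange_big; apply: eq_bigr => -[k ka] _; rewrite [nat_of_ord (Ordinal ka)]/=.
pose h j := (-1) ^+ (j - k) *
  q ^ ('C((j - k).+1, 2)%:Z + N%:Z * (j - k)%N%:Z + (j - k)%N%:Z * k%:Z - k%:Z * a%:Z) *
  chainsum L k (fun s => chain_wt m.+1 (chain (rcons s k))).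
rewrite (gb_conv q0 qroot k h (ltnSn a)); congr (_ * _).
rewrite -(gb_binomial qroot) -IH; last by lia.
rewrite mulr_sumr; apply: eq_bigr => t _; rewrite /h addKn.
set C := chainsum _ _ _.
have e : q ^- k * q ^+ k = 1 by rewrite mulVf ?expf_neq0.
have -> : q ^ ('C(t.+1, 2)%:Z + N%:Z * t%:Z + t%:Z * k%:Z - k%:Z * a%:Z) =
  q ^- (k * a) * (q ^- k * q ^+ k) * (q ^+ 'C(t, 2) * (x * q ^+ k.+1) ^+ t).
  rewrite e mulr1 exprMn -!exprM; zpow q0; rewrite binS bin1; lia.
ring.
Qed.

End ChainWeights.

Lemma chain_addl s t : size s = size t ->
  chain (addl s t) = (fun r => chain s r + chain t r)%N.
Proof.
move=> st; apply: functional_extensionality => -[|r] //.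
rewrite /chain /= /addl; case: (ltnP r (size s)) => h.
  by rewrite (nth_map (0%N, 0%N)) ?nth_zip //= size_zip -st minnn.
by rewrite !nth_default ?size_map ?size_zip -?st ?minnn.
Qed.

Section OneBlock.
Context {F : fieldType} (q : F) (q0 : q != 0).
Context (qroot : forall n, (0 < n)%N -> q ^+ n != 1).
Context (N : nat) (N0 : (0 < N)%N).
Context (m : nat) (m0 : (0 < m)%N).
Notation M := (2 * m + 1)%N.
Notation gb := (gb q).
Notation chainsum := (chainsum q).
Notation seqsum := (@seqsum F N).
Notation chain_wt := (chain_wt q N m).
Notation coupling := (coupling m).
Implicit Types (n c : nat -> nat) (s t y : seq nat) (l : nat -> int).

Lemma seqsum_gbchain_pred d z f : (0 < d)%N ->
  seqsum d (fun s => gbchain q d z s * f s) =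
  \sum_(w < N) gb w z *
     chainsum d.-1 (w - z) (fun s => f [seq (z + i)%N | i <- rcons s (w - z)%N]).
Proof. by case: d => // d _; rewrite seqsum_gbchain. Qed.

Definition blockwt d l n : F := (-1) ^+ signs m d n * q ^ prefix_exp m N d l n.

(** The interaction of K with the translated block splits in two: by [coupling_sum] the translation
    z contributes the inverse of the factor with [coupling K M], and [chain_exp_add] turns the rest
    into the weight of K + C and the exponent of [chainsum_vandermonde]. *)
Lemma block_exponent z al a s t (K := chain (rcons s al)) (C := chain (rcons t a))
    (n := nth 0%N (z :: [seq (z + i)%N | i <- rcons t a])) :
  size s = (2 * m).-1 -> size t = (2 * m).-1 ->
  chain_wt K * q ^ (z%:Z * coupling K M) * blockwt (2 * m) (coupling K) n =
  (-1) ^+ z * q ^ ('C(z.+1, 2)%:Z + N%:Z * z%:Z - z%:Z - z%:Z * z%:Z - al%:Z * a%:Z) *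
  (q ^ (\sum_(r < (2 * m).-1) (nth 0%N s r)%:Z *
           ((nth 0%N (rcons t a) r.+1)%:Z - (nth 0%N (rcons t a) r)%:Z)) *
   chain_wt (fun r => K r + C r)%N).
Proof.
move=> ss st.
have actE : ((2 * m).-1.+1 = 2 * m)%N by lia.
have K0 : K 0%N = 0%N by [].
have C0 : C 0%N = 0%N by [].
have KM : K M = 0%N by rewrite /K chain_default // size_rcons ss; lia.
have Kt : K (2 * m)%N = al by rewrite /K -actE -ss chain_last.
have Ct : C (2 * m)%N = a by rewrite /C -actE -st chain_last.
have nE r : (r <= 2 * m)%N -> n r = (z + C r)%N.
  case: r => [|r] rm; first by rewrite addn0.
  by rewrite /n /= (nth_map 0%N) // size_rcons st actE.
have VE : \sum_(r < (2 * m).-1) (nth 0%N s r)%:Z *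
    ((nth 0%N (rcons t a) r.+1)%:Z - (nth 0%N (rcons t a) r)%:Z) =
    \sum_(r < 2 * m) (K r)%:Z * ((C r.+1)%:Z - (C r)%:Z).
  rewrite -[in RHS]actE big_ord_recl K0 mul0r add0r; apply: eq_bigr => -[r /= rm] _.
  by rewrite /K /C /chain /bump /= (nth_rcons _ s) ss rm.
rewrite VE /blockwt signs_block // prefix_exp_block // (chain_exp_shift m0 N nE).
have -> : \sum_(r < 2 * m) (n r.+1)%:Z * coupling K r.+1 =
   - (z%:Z * coupling K M) + \sum_(r < 2 * m) (C r.+1)%:Z * coupling K r.+1.
  rewrite -mulrN -coupling_sum // mulr_sumr -big_split /=; apply: eq_bigr => r _.
  by rewrite nE ?PoszD ?mulrDl.
rewrite [\sum_(r < 2 * m) (C r.+1)%:Z * _](chain_exp_add m0 N) // Kt Ct.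
rewrite (nE 0%N) // (nE (2 * m)%N) // (nE m) ?leq_pmull // C0 Ct addn0 PoszD.
rewrite /chain_wt !exprD.
set A := chain_exp _ _ _; set B := chain_exp _ _ _; set D := chain_exp _ _ _; set V := \sum_(r < _) _.
set el := coupling K M.
have -> : q ^ (B + 'C(z.+1, 2)%:Z + N%:Z * z%:Z + z%:Z * a%:Z - z%:Z - (z%:Z + a%:Z) * z%:Z +
   (- (z%:Z * el) + (D - A - B - al%:Z * a%:Z + V))) =
   q ^ ('C(z.+1, 2)%:Z + N%:Z * z%:Z - z%:Z - z%:Z * z%:Z - al%:Z * a%:Z) * q ^ V *
   q ^ D * q ^ (- A) * q ^ (- (z%:Z * el)).
  by rewrite -!expfzDr //; congr (q ^ _); ring.
rewrite -!invr_expz; have h1 : q ^ A != 0 by rewrite expfz_neq0.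
have h2 : q ^ (z%:Z * el) != 0 by rewrite expfz_neq0.
by field; rewrite h1 h2.
Qed.

(** K is the entrywise sum of the blocks merged so far, each measured from the variable before it,
    and z is their last variable. The sum over the new block replaces K by its sum with that block,
    whose top w - z is added to al. Whatever follows enters through [Phi]. *)
Lemma block_sum z al (Phi : nat -> (nat -> int) -> F) :
  chainsum (2 * m).-1 al (fun s =>
    let K := chain (rcons s al) in
    chain_wt K * q ^ (z%:Z * coupling K M) *
    seqsum (2 * m) (fun y => gbchain q (2 * m) z y *
      (blockwt (2 * m) (coupling K) (nth 0%N (z :: y)) *
       Phi (last z y) (fun r => coupling K r + coupling (nth 0%N (z :: y)) r)))) =
  \sum_(w < N) gb w z *
    ((-1) ^+ z * q ^ ('C(z.+1, 2)%:Z + N%:Z * z%:Z - z%:Z - z%:Z * z%:Z - al%:Z * (w - z)%N%:Z) *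
     chainsum (2 * m).-1 (al + (w - z)) (fun s =>
       let K := chain (rcons s (al + (w - z))%N) in chain_wt K * Phi w (coupling K))).
Proof.
have d0 : (0 < 2 * m)%N by lia.
under eq_chainsum => s _ do rewrite /= seqsum_gbchain_pred // mulr_sumr.
rewrite chainsum_sum; apply: eq_bigr => -[w /= wN] _.
under eq_chainsum => s _ do rewrite mulrCA.
rewrite chainsum_mull; case: (leqP z w) => zw; last by rewrite gb_small // !mul0r.
congr (_ * _).
rewrite -(chainsum_vandermonde q0 qroot) -chainsum_mull; apply: eq_chainsum => s ss.
rewrite -!chainsum_mull; apply: eq_chainsum => t st.
have -> : chain (rcons (addl s t) (al + (w - z))%N) =
    (fun r => chain (rcons s al) r + chain (rcons t (w - z)) r)%N.
  by rewrite -chain_addl ?size_rcons ?ss ?st // /addl zip_rcons ?map_rcons ?ss ?st.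
rewrite mulrA block_exponent // -!mulrA.
congr (_ * (_ * (_ * (_ * (_ * Phi _ _))))).
  by rewrite map_rcons last_rcons subnKC.
apply: functional_extensionality => r.
rewrite [X in _ + X](@coupling_shift m m0 z (chain (rcons t (w - z)%N))).
  by rewrite /coupling -big_split; apply: eq_bigr => i _; rewrite PoszD mulrDr.
move=> [|i] // /andP[_ iM]; rewrite /= (nth_map 0%N) // size_rcons st; lia.
Qed.

End OneBlock.

Lemma sum_shift (V : nmodType) z N (g : nat -> V) :
  (forall a, (N <= z + a)%N -> g a = 0) ->
  \sum_(w < N) (if (z <= w)%N then g (w - z)%N else 0) = \sum_(a < N) g a.
Proof.
move=> g0.
transitivity (\sum_(w < z + N) (if (z <= w)%N then g (w - z)%N else 0)).
  rewrite addnC big_split_ord /= [X in _ = _ + X]big1 ?addr0 // => i _.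
  by case: leqP => // h; apply: g0; lia.
rewrite big_split_ord /= big1 ?add0r => [|i _]; last by rewrite leqNgt ltn_ord.
by apply: eq_bigr => i _; rewrite leq_addr addKn.
Qed.

Lemma sum_antidiagonal (R : nzRingType) z N (f : nat -> nat -> R) (X : nat -> R) :
  (forall al w, ~~ [&& z <= w, w < N & al + (w - z) < N]%N -> f al w = 0) ->
  \sum_(al < N) \sum_(w < N) f al w * X (al + (w - z))%N =
  \sum_(c < N) (\sum_(a < c.+1) f (c - a)%N (z + a)%N) * X c.
Proof.
move=> f0.
transitivity (\sum_(al < N) \sum_(a < N) f al (z + a)%N * X (al + a)%N).
  apply: eq_bigr => al _.
  rewrite -(@sum_shift _ z N (fun a => f al (z + a)%N * X (al + a)%N)); last first.
    by move=> a h; rewrite f0 ?mul0r //; lia.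
  apply: eq_bigr => w _; case: leqP => h; first by rewrite subnKC.
  by rewrite f0 ?mul0r //; lia.
transitivity (\sum_(c < N) \sum_(a < N) if (a <= c)%N then f (c - a)%N (z + a)%N * X c else 0).
  rewrite exchange_big [RHS]exchange_big /=; apply: eq_bigr => a _.
  rewrite -(@sum_shift _ a N (fun al => f al (z + a)%N * X (al + a)%N)).
    by apply: eq_bigr => c _; case: leqP => // h; rewrite subnK.
  by move=> al h; rewrite f0 ?mul0r //; lia.
apply: eq_bigr => c _; rewrite mulr_suml.
rewrite (big_ord_widen N (fun a => f (c - a)%N (z + a)%N * X c)) //.
by rewrite [RHS]big_mkcond; apply: eq_bigr => a _; rewrite ltnS.
Qed.

Section EndWeights.
Context {F : fieldType} (q : F) (q0 : q != 0).
Context (qroot : forall n, (0 < n)%N -> q ^+ n != 1).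
Context (N : nat) (N0 : (0 < N)%N).
Context (m : nat) (m0 : (0 < m)%N).
Notation x := (q ^+ N).
Notation gb := (gb q).
Notation pcoef := (pcoef q N x).
Implicit Types (n : nat -> nat) (s t y : seq nat) (l : nat -> int).

(* Total weight of [b] complete blocks whose last variable is [z] and whose
   translated top entries add up to [al]. *)
Definition end_wt b z al : F :=
  (-1) ^+ z * q ^ ('C(z.+1, 2)%:Z - z%:Z) * x ^+ z * q ^- (al * z) * gb z al * pcoef b z.

(** [gb_linear] expands the product of [gb z c] with the factor [gb z y] from the recursion of
    [pcoef]. Here y is the previous last variable and a the growth of the top entry. *)
Lemma end_wtS b z c : (z < N)%N ->
  end_wt b.+1 z c = \sum_(y < N) \sum_(a < c.+1)
    end_wt b y (c - a) *
    (gb (y + a) y * ((-1) ^+ y *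
       q ^ ('C(y.+1, 2)%:Z + N%:Z * y%:Z - y%:Z - y%:Z * y%:Z - (c - a)%N%:Z * a%:Z))) *
    (gb z (y + a) * ((-1) ^+ z *
       q ^ (N%:Z * z%:Z + 'C(z.+1, 2)%:Z - z%:Z - (y + a)%N%:Z * z%:Z))).
Proof.
move=> zN; rewrite /end_wt -[pcoef b.+1 z]/(\sum_(k < N) gb z k * q ^- (k * z.+1) * (x ^+ (2 * k) * pcoef b k)).
rewrite mulr_sumr; apply: eq_bigr => -[y /= yN] _.
set P := pcoef b y.
transitivity ((-1) ^+ z * q ^ ('C(z.+1, 2)%:Z - z%:Z) * x ^+ z * q ^- (c * z) * q ^- (y * z.+1) *
   x ^+ (2 * y) * P * (gb z y * gb z c)); first by ring.
rewrite gb_linear // mulr_sumr; apply: eq_bigr => -[a /=]; rewrite ltnS => ac _.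
case: (leqP (y + a) z) => yz; last by rewrite gb_small // !(mul0r, mulr0).
have sg : (-1) ^+ y * (-1) ^+ y = 1 :> F by rewrite -expr2 sqrr_sign.
transitivity (((-1) ^+ y * (-1) ^+ y) * (-1) ^+ z * (gb z (y + a) * gb (y + a) y * gb y (c - a) * P) *
   (q ^ ('C(z.+1, 2)%:Z - z%:Z) * x ^+ z * q ^- (c * z) * q ^- (y * z.+1) * x ^+ (2 * y) *
    q ^+ ((c - a) * (z - (y + a))))); first by rewrite sg; ring.
rewrite [RHS](_ : _ = ((-1) ^+ y * (-1) ^+ y) * (-1) ^+ z * (gb z (y + a) * gb (y + a) y * gb y (c - a) * P) *
   (q ^ ('C(y.+1, 2)%:Z - y%:Z) * x ^+ y * q ^- ((c - a) * y) *
   q ^ ('C(y.+1, 2)%:Z + N%:Z * y%:Z - y%:Z - y%:Z * y%:Z - (c - a)%N%:Z * a%:Z) *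
   q ^ (N%:Z * z%:Z + 'C(z.+1, 2)%:Z - z%:Z - (y + a)%N%:Z * z%:Z))); last by ring.
congr (_ * _); clear P sg.
have [u ->] : exists u, c = (u + a)%N by exists (c - a)%N; rewrite subnK.
have [w ->] : exists w, z = (w + (y + a))%N by exists (z - (y + a))%N; rewrite subnK.
rewrite !addnK -!exprM.
have t : 'C(y.+1, 2)%:Z + 'C(y.+1, 2)%:Z = y%:Z * y%:Z + y%:Z.
  by have := mul_bin_diag y.+1 1; rewrite bin1; lia.
zpow q0; lia.
Qed.

End EndWeights.

Lemma prefix_expS m N d l n : prefix_exp m N d.+1 l n = prefix_exp m N d l n +
  ((n d.+1)%:Z * (l d.+1 + \sum_(i < d.+1) epsres m i d.+1 * (n i)%:Z) +
   (marked m d.+1)%:R * (N%:Z * (n d.+1)%:Z + 'C((n d.+1).+1, 2)%:Z) +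
   gamma m d.+1 * (n d.+1)%:Z - (n d)%:Z * (n d.+1)%:Z).
Proof. exact: big_ord_recr. Qed.

Lemma signsS m d n : signs m d.+1 n = (signs m d n + marked m d.+1 * n d.+1)%N.
Proof. exact: big_ord_recr. Qed.

Lemma eq_prefix_exp m N d l n n' : (forall i, (i <= d)%N -> n i = n' i) ->
  prefix_exp m N d l n = prefix_exp m N d l n'.
Proof.
move=> h; apply: eq_bigr => -[r /= rd] _; rewrite !h ?(ltnW rd) //.
congr (_ * (_ + _) + _ + _ - _); apply: eq_bigr => -[i /= ir] _.
by rewrite h //; lia.
Qed.

Lemma eq_signs m d n n' : (forall i, (i <= d)%N -> n i = n' i) ->
  signs m d n = signs m d n'.
Proof. by move=> h; apply: eq_bigr => -[r /= rd] _; rewrite h. Qed.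

Lemma nth_cat_last s y z i :
  nth 0%N (z :: s ++ y) (size s + i) = nth 0%N (last z s :: y) i.
Proof.
by elim: s z => [|w s IH] z //=; rewrite addSn -IH.
Qed.

Lemma nth_cat_low s y z i : (i <= size s)%N ->
  nth 0%N (z :: s ++ y) i = nth 0%N (z :: s) i.
Proof. by move=> h; rewrite -cat_cons nth_cat /= ltnS h. Qed.

(** * Merging the complete blocks *)

Section Prefixes.
Context {F : fieldType} (q : F) (q0 : q != 0).
Context (qroot : forall n, (0 < n)%N -> q ^+ n != 1).
Context (N : nat) (N0 : (0 < N)%N).
Context (m : nat) (m0 : (0 < m)%N).
Notation M := (2 * m + 1)%N.
Notation gb := (gb q).
Notation chainsum := (chainsum q).
Notation seqsum := (@seqsum F N).
Notation chain_wt := (chain_wt q N m).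
Notation coupling := (coupling m).
Notation blockwt := (blockwt q N m).
Notation end_wt := (end_wt q N).
Implicit Types (n : nat -> nat) (s t y : seq nat) (l : nat -> int).

Lemma gbchain_cat a b z s y : size s = a ->
  gbchain q (a + b) z (s ++ y) = gbchain q a z s * gbchain q b (last z s) y.
Proof.
move=> <-; rewrite /gbchain big_split_ord; congr (_ * _); apply: eq_bigr => -[i /= ib] _.
  by rewrite -[nth _ (s ++ y) i]/(nth 0%N (z :: s ++ y) i.+1) !nth_cat_low // ltnW.
rewrite -[nth _ (s ++ y) _]/(nth 0%N (z :: s ++ y) (size s + i).+1) -addnS.
by rewrite !nth_cat_last.
Qed.

Lemma blockwt_cat b d s y : size s = (b * M)%N ->
  blockwt (b * M + d) (fun=> 0) (chain (s ++ y)) =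
  blockwt (b * M) (fun=> 0) (chain s) *
  blockwt d (fun r => \sum_(i < b * M) epsres m i r * (chain s i)%:Z) (nth 0%N (last 0%N s :: y)).
Proof.
move=> ss; rewrite /blockwt prefix_expD signsD.
have e1 i : (i <= b * M)%N -> chain (s ++ y) i = chain s i.
  by move=> h; rewrite /chain nth_cat_low ?ss.
have -> : (fun i => chain (s ++ y) (b * M + i)) = nth 0%N (last 0%N s :: y).
  by apply: functional_extensionality => i; rewrite -ss /chain nth_cat_last.
have -> : (fun r => \sum_(i < b * M) epsres m i r * (chain (s ++ y) i)%:Z) =
    (fun r => \sum_(i < b * M) epsres m i r * (chain s i)%:Z).
  apply: functional_extensionality => r; apply: eq_bigr => i _.
  by rewrite e1 // ltnW.
rewrite (eq_prefix_exp _ _ _ e1) (eq_signs _ e1) exprD expfzDr //; ring.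
Qed.

Lemma blockwt_last l n :
  blockwt M l n = blockwt (2 * m) l n * ((-1) ^+ n M *
    q ^ ((n M)%:Z * (l M + coupling n M) + N%:Z * (n M)%:Z + 'C((n M).+1, 2)%:Z - (n M)%:Z
         - (n (2 * m)%N)%:Z * (n M)%:Z)).
Proof.
rewrite /blockwt {1 2}addn1 signsS prefix_expS.
have -> : marked m (2 * m).+1 by rewrite /marked -(addn1 (2 * m)) modnn eqxx orbT.
have -> : gamma m (2 * m).+1 = -1 by rewrite /gamma -(addn1 (2 * m)) modnn.
rewrite mul1n exprD expfzDr // mulrACA !addn1; congr (_ * (_ * q ^ _)).
rewrite /coupling !addn1 mulr1n; ring.
Qed.

(** The last variable of a complete block is split off: its index is divisible by 2m+1, so it does
    not enter the linear form acting on later variables. *)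
Lemma seqsum_block z l (G : nat -> (nat -> int) -> F) :
  seqsum M (fun y => gbchain q M z y * (blockwt M l (nth 0%N (z :: y)) *
     G (last z y) (fun r => l r + coupling (nth 0%N (z :: y)) r))) =
  seqsum (2 * m) (fun y => gbchain q (2 * m) z y * (blockwt (2 * m) l (nth 0%N (z :: y)) *
    (fun w l' => \sum_(z' < N) gb z' w * ((-1) ^+ z' *
       q ^ (z'%:Z * l' M + N%:Z * z'%:Z + 'C(z'.+1, 2)%:Z - z'%:Z - w%:Z * z'%:Z) * G z' l'))
      (last z y) (fun r => l r + coupling (nth 0%N (z :: y)) r))).
Proof.
rewrite seqsum_cat; apply: eq_seqsum => y sy /=.
rewrite mulrA mulr_sumr; apply: eq_bigr => -[z' /= zN] _.
rewrite gbchain_cat // /gbchain big_ord_recl big_ord0 /= mulr1.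
have low i : (i <= 2 * m)%N -> nth 0%N (z :: y ++ [:: z']) i = nth 0%N (z :: y) i.
  by move=> h; rewrite nth_cat_low ?sy.
have top : nth 0%N (z :: y ++ [:: z']) M = z' by rewrite -sy nth_cat_last.
have mid : nth 0%N (z :: y ++ [:: z']) (2 * m) = last z y.
  by rewrite -sy -[X in nth _ _ X]addn0 nth_cat_last.
have el : coupling (nth 0%N (z :: y ++ [:: z'])) = coupling (nth 0%N (z :: y)).
  apply: functional_extensionality => r; apply: eq_coupling => i /andP[_ iM].
  by apply: low; lia.
rewrite blockwt_last el top mid /blockwt (eq_signs _ low) (eq_prefix_exp _ _ _ low) last_cat /=.
set e := q ^ (_ - _); rewrite -/e.
ring.
Qed.

(** Induction on b, with [G] standing for all that follows. The b blocks become one chain K, and [G]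
    sees only their last variable z and the linear form of K. *)
Lemma prefix_sum b (G : nat -> (nat -> int) -> F) :
  seqsum (b * M) (fun s => gbchain q (b * M) 0 s * (blockwt (b * M) (fun=> 0) (chain s) *
    G (last 0%N s) (fun r => \sum_(i < b * M) epsres m i r * (chain s i)%:Z))) =
  \sum_(z < N) \sum_(al < N) end_wt b z al * chainsum (2 * m).-1 al (fun s =>
    let K := chain (rcons s al) in
    chain_wt K * q ^ (z%:Z * coupling K M) * G z (coupling K)).
Proof.
elim: b G => [|b IH] G.
  rewrite mul0n /= /gbchain big_ord0 /blockwt /signs /prefix_exp !big_ord0 expr0 expr0z !mul1r.
  (* Without blocks, [end_wt] is concentrated at z = al = 0. *)
  rewrite (bigD1 (Ordinal N0)) //= (bigD1 (Ordinal N0)) //=.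
  rewrite big1 ?addr0 => [|al]; last first.
    rewrite -val_eqE /= => al0; rewrite /end_wt gb_small ?lt0n //.
    by rewrite mulr0 !mul0r.
  rewrite big1 ?addr0 => [|z]; last first.
    rewrite -val_eqE /= => /negbTE z0; rewrite big1 // => al _.
    by rewrite /end_wt /= z0 mulr0 mul0r.
  rewrite csum0 // /end_wt /= gbn0 //.
  rewrite [_ - _](_ : _ = 0) // expr0z mul0n !expr0 invr1 !mulr1 mul1r mul0r expr0z mulr1.
  have K0 : chain (rcons (nseq (2 * m).-1 0%N) 0%N) = (fun=> 0%N).
    apply: functional_extensionality => i.
    by rewrite /chain -rcons_cons nth_rcons -[_ :: _]/(nseq _.+1 0%N) nth_nseq !if_same.
  rewrite K0 /chain_wt expr0 mul1r.
  have -> : chain_exp m N (fun=> 0%N) = 0.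
    by rewrite /chain_exp big1 ?bin_small // mulr0 !addr0.
  rewrite expr0z mul1r; congr G; apply: functional_extensionality => r.
  by rewrite big_ord0 /coupling big1 // => i _; rewrite mulr0.
rewrite mulSnr seqsum_cat.
(* The next block depends on the earlier ones only through these arguments, so it can be absorbed
   into the [G] of the induction hypothesis. *)
pose G' z l := seqsum M (fun y => gbchain q M z y * (blockwt M l (nth 0%N (z :: y)) *
     G (last z y) (fun r => l r + coupling (nth 0%N (z :: y)) r))).
transitivity (seqsum (b * M) (fun s => gbchain q (b * M) 0 s * (blockwt (b * M) (fun=> 0) (chain s) *
    G' (last 0%N s) (fun r => \sum_(i < b * M) epsres m i r * (chain s i)%:Z)))).
  apply: eq_seqsum => s ss; rewrite mulrA -seqsum_mull; apply: eq_seqsum => y sy.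
  rewrite gbchain_cat // blockwt_cat // last_cat.
  have -> : (fun r => \sum_(i < b * M + M) epsres m i r * (chain (s ++ y) i)%:Z) =
     (fun r => \sum_(i < b * M) epsres m i r * (chain s i)%:Z + coupling (nth 0%N (last 0%N s :: y)) r).
    apply: functional_extensionality => r; rewrite big_split_ord /=; congr (_ + _).
      by apply: eq_bigr => i _; rewrite /chain nth_cat_low // ss ltnW.
    apply: eq_bigr => i _; rewrite epsres_l; congr (_ * _%:Z).
    by rewrite /chain -ss nth_cat_last.
  ring.
rewrite IH {IH}.
pose Phi w l := \sum_(z < N) gb z w * ((-1) ^+ z *
       q ^ (z%:Z * l M + N%:Z * z%:Z + 'C(z.+1, 2)%:Z - z%:Z - w%:Z * z%:Z) * G z l).
transitivity (\sum_(y < N) \sum_(al < N) end_wt b y al * \sum_(w < N) gb w y *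
    ((-1) ^+ y * q ^ ('C(y.+1, 2)%:Z + N%:Z * y%:Z - y%:Z - y%:Z * y%:Z - al%:Z * (w - y)%N%:Z) *
     chainsum (2 * m).-1 (al + (w - y)) (fun s =>
       let K := chain (rcons s (al + (w - y))%N) in chain_wt K * Phi w (coupling K)))).
  apply: eq_bigr => y _; apply: eq_bigr => al _; congr (_ * _).
  rewrite -(block_sum q0 qroot) //; apply: eq_chainsum => s _ /=; congr (_ * _).
  by rewrite /G' seqsum_block.
pose X z c := chainsum (2 * m).-1 c (fun s =>
    let K := chain (rcons s c) in chain_wt K * q ^ (z%:Z * coupling K M) * G z (coupling K)).
transitivity (\sum_(y < N) \sum_(z < N) \sum_(al < N) \sum_(w < N)
   (end_wt b y al * (gb w y * ((-1) ^+ y *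
       q ^ ('C(y.+1, 2)%:Z + N%:Z * y%:Z - y%:Z - y%:Z * y%:Z - al%:Z * (w - y)%N%:Z))) *
    (gb z w * ((-1) ^+ z *
       q ^ (N%:Z * z%:Z + 'C(z.+1, 2)%:Z - z%:Z - w%:Z * z%:Z)))) * X z (al + (w - y))%N).
  apply: eq_bigr => y _.
  rewrite [RHS]exchange_big; apply: eq_bigr => al _; rewrite [RHS]exchange_big mulr_sumr.
  apply: eq_bigr => w _.
  rewrite /Phi.
  under eq_chainsum => s _ do rewrite /= mulr_sumr.
  rewrite chainsum_sum !mulr_sumr; apply: eq_bigr => z _.
  rewrite /X -!chainsum_mull; apply: eq_chainsum => s _ /=.
  set K := chain _.
  have -> : q ^ (z%:Z * coupling K M + N%:Z * z%:Z + 'C(z.+1, 2)%:Z - z%:Z - w%:Z * z%:Z) =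
    q ^ (z%:Z * coupling K M) * q ^ (N%:Z * z%:Z + 'C(z.+1, 2)%:Z - z%:Z - w%:Z * z%:Z).
    by rewrite -expfzDr //; congr (q ^ _); ring.
  ring.
rewrite exchange_big; apply: eq_bigr => -[z zN] _; rewrite [nat_of_ord (Ordinal zN)]/=.
transitivity (\sum_(y < N) \sum_(c < N) (\sum_(a < c.+1) end_wt b y (c - a) *
    (gb (y + a) y * ((-1) ^+ y *
       q ^ ('C(y.+1, 2)%:Z + N%:Z * y%:Z - y%:Z - y%:Z * y%:Z - (c - a)%N%:Z * a%:Z))) *
    (gb z (y + a) * ((-1) ^+ z *
       q ^ (N%:Z * z%:Z + 'C(z.+1, 2)%:Z - z%:Z - (y + a)%N%:Z * z%:Z)))) * X z c).
  apply: eq_bigr => y _.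
  rewrite (@sum_antidiagonal _ y N (fun al w => end_wt b y al * (gb w y * ((-1) ^+ y *
       q ^ ('C(y.+1, 2)%:Z + N%:Z * y%:Z - y%:Z - y%:Z * y%:Z - al%:Z * (w - y)%N%:Z))) *
    (gb z w * ((-1) ^+ z *
       q ^ (N%:Z * z%:Z + 'C(z.+1, 2)%:Z - z%:Z - w%:Z * z%:Z)))) (X z)).
    apply: eq_bigr => c _; congr (_ * _); apply: eq_bigr => a _.
    by rewrite addKn.
  (* The binomials force al <= y <= w <= z < N, hence al + (w - y) <= w < N. *)
  move=> al w h.
  case: (leqP y w) => yw; last by rewrite gb_small // !(mul0r, mulr0).
  case: (leqP w z) => wz; last by rewrite (@gb_small _ _ z) // !(mul0r, mulr0).
  case: (leqP al y) => aly; first by case/negP: h; apply/and3P; split; lia.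
  by rewrite /end_wt gb_small // !(mul0r, mulr0).
rewrite exchange_big; apply: eq_bigr => c _; by rewrite -mulr_suml (end_wtS q0 qroot N0 m0).
Qed.

End Prefixes.

Section Total.
Context {F : fieldType} (q : F) (q0 : q != 0).
Context (qroot : forall n, (0 < n)%N -> q ^+ n != 1).
Context (N : nat) (N0 : (0 < N)%N).
Context (m : nat) (m0 : (0 < m)%N).
Notation M := (2 * m + 1)%N.
Notation x := (q ^+ N).
Notation gb := (gb q).

(** No block follows the incomplete one, so [Phi] ignores the linear form and the chain sum left
    over is [mkern m A] up to q^A. The condition on [c] removes the terms with z + a >= N. *)
Lemma total_sum p (c : nat -> F) : (forall w, (N <= w)%N -> c w = 0) ->
  seqsum N (p * M + 2 * m) (fun s => gbchain q (p * M + 2 * m) 0 s *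
    (blockwt q N m (p * M + 2 * m) (fun=> 0) (chain s) *
     (q ^+ last 0%N s * c (last 0%N s)))) =
  \sum_(z < N) \sum_(A < N) x ^+ (2 * z) * pcoef q N x p z * mkern q N x m A *
    \sum_(a < A.+1) c (z + a)%N * gb (z + a)%N z * gb z (A - a)%N *
      q ^- ((A - a) * (z + a).+1).
Proof.
move=> c0.
pose Phi w (l : nat -> int) := q ^+ w * c w.
pose G z l := seqsum N (2 * m) (fun y => gbchain q (2 * m) z y *
  (blockwt q N m (2 * m) l (nth 0%N (z :: y)) *
     Phi (last z y) (fun r => l r + coupling m (nth 0%N (z :: y)) r))).
rewrite seqsum_cat.
transitivity (seqsum N (p * M) (fun s => gbchain q (p * M) 0 s *
    (blockwt q N m (p * M) (fun=> 0) (chain s) *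
     G (last 0%N s) (fun r => \sum_(i < p * M) epsres m i r * (chain s i)%:Z)))).
  apply: eq_seqsum => s ss; rewrite mulrA -seqsum_mull; apply: eq_seqsum => y sy.
  by rewrite gbchain_cat // blockwt_cat // last_cat /Phi; ring.
rewrite prefix_sum //; apply: eq_bigr => -[z zN] _; rewrite [nat_of_ord (Ordinal zN)]/=.
pose X A := chainsum q (2 * m).-1 A (fun s => chain_wt q N m (chain (rcons s A))).
transitivity (\sum_(al < N) \sum_(w < N) (end_wt q N p z al * (gb w z *
    ((-1) ^+ z * q ^ ('C(z.+1, 2)%:Z + N%:Z * z%:Z - z%:Z - z%:Z * z%:Z - al%:Z * (w - z)%N%:Z) *
     (q ^+ w * c w)))) * X (al + (w - z))%N).
  apply: eq_bigr => al _; rewrite block_sum // mulr_sumr; apply: eq_bigr => w _.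
  rewrite /X /=; set S := (RHS).
  under eq_chainsum => s _ do rewrite mulrC.
  by rewrite chainsum_mull /S /Phi; ring.
rewrite (@sum_antidiagonal _ z N (fun al w => end_wt q N p z al * (gb w z *
    ((-1) ^+ z * q ^ ('C(z.+1, 2)%:Z + N%:Z * z%:Z - z%:Z - z%:Z * z%:Z - al%:Z * (w - z)%N%:Z) *
     (q ^+ w * c w)))) X); last first.
  move=> al w h.
  case: (leqP z w) => zw; last by rewrite gb_small // !(mul0r, mulr0).
  case: (leqP N w) => wN; first by rewrite c0 // !(mul0r, mulr0).
  case: (leqP al z) => alz; first by case/negP: h; apply/and3P; split; lia.
  by rewrite /end_wt gb_small // !(mul0r, mulr0).
apply: eq_bigr => -[A AN] _; rewrite [nat_of_ord (Ordinal AN)]/=.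
rewrite -(mkern_chainsum q0 qroot N0 m0 AN) -/(X A) mulr_suml mulr_sumr.
apply: eq_bigr => -[a /=]; rewrite ltnS => aA _; rewrite addKn /end_wt.
have sg : (-1) ^+ z * (-1) ^+ z = 1 :> F by rewrite -expr2 sqrr_sign.
set P := pcoef _ _ _ _ _; move: (X A) (c _) => Y C.
transitivity (((-1) ^+ z * (-1) ^+ z) * (P * gb (z + a) z * gb z (A - a) * Y * C) *
  (q ^ ('C(z.+1, 2)%:Z - z%:Z) * x ^+ z * q ^- ((A - a) * z) *
   q ^ ('C(z.+1, 2)%:Z + N%:Z * z%:Z - z%:Z - z%:Z * z%:Z - (A - a)%N%:Z * a%:Z) * q ^+ (z + a))); first by
     ring.
rewrite sg [RHS](_ : _ = 1 * (P * gb (z + a) z * gb z (A - a) * Y * C) *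
  (x ^+ (2 * z) * q ^+ A * q ^- ((A - a) * (z + a).+1))); last by ring.
congr (_ * _); clear P sg.
have [u ->] : exists u, A = (u + a)%N by exists (A - a)%N; rewrite subnK.
rewrite addnK -!exprM.
have t : 'C(z.+1, 2)%:Z + 'C(z.+1, 2)%:Z = z%:Z * z%:Z + z%:Z.
  by have := mul_bin_diag z.+1 1; rewrite bin1; lia.
zpow q0; lia.
Qed.

End Total.

(** * The residue conditions in epsilon *)

Section Residues.
Context (m : nat) (m0 : (0 < m)%N).
Notation M := (2 * m + 1)%N.
Implicit Types (n : nat -> nat).

Lemma dvdn_lt_double d k : (0 < k < d + d)%N -> (d %| k)%N = (k == d).
Proof.
move=> /andP[k0 kd]; apply/idP/eqP => [|->//] /dvdnP[[|[|t]] e].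
- by move: k0; rewrite e.
- by rewrite e mul1n.
- by move: kd; rewrite e !mulSn addnA; lia.
Qed.

(** As the residue s of i is not 0, the sums s + r and s + r + 1 lie strictly between 0 and twice
    the modulus, so divisibility becomes equality; the wrap-around of r + 1 would require s = 0. *)
Lemma epsilonE i j : ~~ (M %| i)%N -> (j != m %[mod M])%N ->
  epsilon m i j = epsres m i j.
Proof.
rewrite (modn_small (_ : m < M)%N); last lia.
move=> i0 jm; rewrite /epsilon /epsres.
have iM := ltn_pmod i (_ : 0 < M)%N; have jM := ltn_pmod j (_ : 0 < M)%N.
have M0 : (0 < M)%N by lia.
move: iM jM => /(_ M0) iM /(_ M0) jM.
rewrite [(i %% M)%N == 0%N](negbTE i0).
have -> : (j == - i%:Z %[mod M])%Z = (i %% M + j %% M == M)%N.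
  rewrite eqz_mod_dvd opprK -PoszD -[RHS]dvdn_lt_double; last first.
    by move: i0; rewrite /dvdn; lia.
  by rewrite [RHS]/dvdn modnDm addnC.
have -> : (j == - i%:Z - 1 %[mod M])%Z = (i %% M + j %% M == 2 * m)%N.
  rewrite eqz_mod_dvd (_ : j%:Z - (- i%:Z - 1) = (i + j + 1)%N%:Z); last lia.
  rewrite -[RHS](eqn_add2r 1) -[RHS]dvdn_lt_double; last first.
    by move: i0; rewrite /dvdn; lia.
  by rewrite [RHS]/dvdn -modnDml modnDm modnDml.
have -> : (j == i %[mod M])%Z = (i %% M == j %% M)%N.
  by rewrite !modz_nat eqz_nat eq_sym.
have -> : (j == i%:Z - 1 %[mod M])%Z = (i %% M == (j %% M).+1)%N.
  rewrite eqz_mod_dvd (_ : j%:Z - (i%:Z - 1) = (j.+1)%:Z - i%:Z); last lia.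
  have e : (j.+1 %% M = (j %% M).+1 %% M)%N by rewrite -(addn1 j) -modnDml (addn1 (j %% M)).
  rewrite -eqz_mod_dvd !modz_nat eqz_nat eq_sym e.
  case: (ltnP (j %% M).+1 M) => h; first by rewrite (modn_small h).
  have -> : (j %% M).+1 = M by lia.
  by rewrite modnn -[LHS]/(M %| i)%N (negbTE i0) ltn_eqF.
move: (i %% M)%N (j %% M)%N iM jM i0 jm => s r sM rM _ rm.
(* A condition for 1 and one for -1 can hold together only when j has residue m, by parity; that
   residue is excluded. *)
do 4 case: eqP => ? /=; lia.
Qed.

End Residues.

(** * The summand *)

Lemma prod_exprz (F : fieldType) (y : F) (I : Type) (r : seq I) (P : pred I) (f : I -> int) :
  y != 0 -> \prod_(i <- r | P i) y ^ f i = y ^ (\sum_(i <- r | P i) f i).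
Proof. by move=> y0; rewrite (big_morph _ (fun a b => expfzDr a b y0) (expr0z y)). Qed.

Section SummandExponents.
Context (m : nat) (m0 : (0 < m)%N).
Notation M := (2 * m + 1)%N.
Implicit Types (n : nat -> nat).

Lemma epsres_dvd i j : (M %| i)%N -> epsres m i j = 0.
Proof. by rewrite /epsres => /eqP->. Qed.

Lemma epsres_middle i j : (j %% M = m)%N -> epsres m i j = 0.
Proof.
rewrite /epsres => ->; case: ifP => // _.
have -> : (i %% M + m == M)%N = (i %% M == m.+1)%N by lia.
have -> : (i %% M + m == 2 * m)%N = (i %% M == m)%N by lia.
ring.
Qed.

Lemma big_upper_triangle L (f : nat -> nat -> int) : (forall j, f 0%N j = 0) ->
  \sum_(1 <= i < L.+1) \sum_(i.+1 <= j < L.+1) f i j =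
  \sum_(r < L) \sum_(i < r.+1) f i r.+1.
Proof.
move=> f0; elim: L => [|L IH]; first by rewrite big_geq // big_ord0.
rewrite big_nat_recr //= [X in _ + X]big_geq // addr0 big_ord_recr -IH /=.
rewrite [X in _ + X]big_ord_recl f0 add0r -(big_mkord xpredT (fun i => f i.+1 L.+1)).
rewrite -(big_add1 _ _ 0 L.+1 xpredT (fun i => f i L.+1)) -big_split /=.
by apply: eq_big_nat => i /andP[_ iL]; rewrite big_nat_recr.
Qed.

Lemma epsilon_sum L n :
  \sum_(1 <= i < L.+1 | ~~ (M %| i)%N)
    \sum_(i.+1 <= j < L.+1 | (j != m %[mod M])%N)
      epsilon m i j * (n i)%:Z * (n j)%:Z =
  \sum_(r < L) (n r.+1)%:Z * (\sum_(i < r.+1) epsres m i r.+1 * (n i)%:Z).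
Proof.
transitivity (\sum_(1 <= i < L.+1) \sum_(i.+1 <= j < L.+1) epsres m i j * (n i)%:Z * (n j)%:Z).
  rewrite big_mkcond; apply: eq_bigr => i _; case: ifPn => [i0|]; last first.
    by rewrite negbK => i0; rewrite big1 // => j _; rewrite epsres_dvd ?mul0r.
  rewrite big_mkcond; apply: eq_bigr => j _; case: ifPn => [jm|]; first by rewrite epsilonE.
  rewrite negbK (modn_small (_ : m < M)%N); last lia.
  by move=> /eqP jm; rewrite epsres_middle ?mul0r.
rewrite (@big_upper_triangle _ (fun i j => epsres m i j * (n i)%:Z * (n j)%:Z)); last first.
  by move=> j; rewrite epsres_dvd ?mul0r.
apply: eq_bigr => r _; rewrite mulr_sumr; apply: eq_bigr => i _; ring.
Qed.

(** The products over single indices stop at L, while [prefix_exp] includes L+1. This index is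
    unmarked and has [gamma] -1, so n_(L+1) is the whole difference. *)
Lemma prefix_exp_last N L n : n 0%N = 0%N -> marked m L.+1 = false -> gamma m L.+1 = -1 ->
  prefix_exp m N L.+1 (fun=> 0) n + (n L.+1)%:Z =
  \sum_(r < L.+1) (n r.+1)%:Z * (\sum_(i < r.+1) epsres m i r.+1 * (n i)%:Z) +
  \sum_(r < L) (marked m r.+1)%:R * (N%:Z * (n r.+1)%:Z + 'C((n r.+1).+1, 2)%:Z) +
  \sum_(r < L) (- ((n r.+1)%:Z * (n r.+2)%:Z) + gamma m r.+1 * (n r.+1)%:Z).
Proof.
move=> n0 mL gL; rewrite /prefix_exp sumrB !big_split /=.
under [X in X + _ + _ - _]eq_bigr do rewrite add0r.
rewrite [X in _ + X + _ - _]big_ord_recr [X in _ + X - _]big_ord_recr mL gL /=.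
rewrite [X in _ - X]big_ord_recl n0 /= sumrN.
under [X in - (_ + X)]eq_bigr do rewrite /bump /=.
ring.
Qed.

End SummandExponents.

Section Summand.
Context {F : fieldType} (q : F) (q0 : q != 0).
Context (qroot : forall n, (0 < n)%N -> q ^+ n != 1).
Notation poch := (poch q).

(** Factor by factor, 1 - q^(1-N+w) = - q^(1-N+w) (1 - q^N / q^(w+1)); the sign and the binomial
    exponent absorb the monomials, apart from q^(-N w). *)
Lemma poch_bfac N w : poch (q ^ (1 - N%:Z)) w * (-1) ^+ w * q ^ (- 'C(w.+1, 2)%:Z) =
  (q ^+ N) ^- w * bfac q (q ^+ N) w.
Proof.
elim: w => [|w IH].
  have -> : - 'C(1, 2)%:Z = 0 by [].
  by rewrite poch0 /bfac big_ord0 !expr0 expr0z invr1 !mulr1.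
rewrite pochSr /bfac big_ord_recr -/(bfac q (q ^+ N) w) /=.
have -> : q ^ (- 'C(w.+2, 2)%:Z) = q ^ (- 'C(w.+1, 2)%:Z) * q ^- w.+1.
  by rewrite exprnN -expfzDr //; congr (q ^ _); rewrite binS bin1; lia.
transitivity (poch (q ^ (1 - N%:Z)) w * (-1) ^+ w * q ^ (- 'C(w.+1, 2)%:Z) *
  (- (1 - q ^ (1 - N%:Z) * q ^+ w) * q ^- w.+1)); first by rewrite [(-1) ^+ _]exprS; ring.
rewrite IH [(q ^+ N) ^+ w.+1]exprS invfM.
have e1 : q ^ (1 - N%:Z) * q ^+ w * q ^- w.+1 = q ^- N by zpow q0; lia.
have e2 : q ^- N * q ^+ N = 1 by rewrite mulVf ?expf_neq0.
have -> : - (1 - q ^ (1 - N%:Z) * q ^+ w) * q ^- w.+1 = q ^- N * (1 - q ^+ N * q ^- w.+1).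
  transitivity (q ^ (1 - N%:Z) * q ^+ w * q ^- w.+1 - q ^- w.+1); first by ring.
  transitivity (q ^- N - q ^- N * q ^+ N * q ^- w.+1); last by ring.
  by rewrite e1 e2 mul1r.
ring.
Qed.

Lemma summandE m N L (s : seq nat) (n := fun i => nth 0%N s i.-1) :
  (0 < m)%N -> size s = L.+1 -> (L.+1 %% (2 * m + 1) = 2 * m)%N ->
  (if sorted leq s then
    poch (q ^ (1 - N%:Z)) (n L.+1) * (-1) ^+ n L.+1 * q ^ (- 'C((n L.+1).+1, 2)%:Z) *
    (\prod_(1 <= i < L.+2 | ~~ ((2 * m + 1) %| i)%N)
       \prod_(i.+1 <= j < L.+2 | (j != m %[mod (2 * m + 1)])%N)
         q ^ (epsilon m i j * (n i)%:Z * (n j)%:Z)) *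
    (\prod_(1 <= i < L.+1 | (i == m %[mod (2 * m + 1)])%N || (i == (2 * m + 1) %[mod (2 * m + 1)])%N)
       ((-1) ^+ n i * q ^+ (N * n i + 'C((n i).+1, 2)))) *
    (\prod_(1 <= i < L.+1)
       (q ^ (- ((n i)%:Z * (n i.+1)%:Z) + gamma m i * (n i)%:Z)
        * (poch q (n i.+1) / (poch q (n i.+1 - n i) * poch q (n i)))))
  else 0) =
  gbchain q L.+1 0 s * (blockwt q N m L.+1 (fun=> 0) (chain s) *
    (q ^+ last 0%N s * ((q ^+ N) ^- last 0%N s * bfac q (q ^+ N) (last 0%N s)))).
Proof.
move=> m0 ss Lm.
have gE : gbchain q L.+1 0 s = \prod_(r < L) gb q (nth 0%N s r.+1) (nth 0%N s r).
  by rewrite /gbchain big_ord_recl /= gbn0 // mul1r.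
case: ifP => [srt|]; last first.
  move=> /negbT nsrt; rewrite gE.
  (* A descent of s gives a vanishing Gaussian binomial. *)
  have [r rL lt_r] : exists2 r : 'I_L, (r < L)%N & (nth 0%N s r.+1 < nth 0%N s r)%N.
    apply/exists_inP; apply: contraR nsrt; rewrite negb_exists => /forallP h.
    apply/(sortedP 0%N) => r; rewrite ss ltnS => rL.
    by have := h (Ordinal rL); rewrite /= rL /= -leqNgt.
  by rewrite (bigD1 r) //= gb_small // !mul0r.
have lastE : last 0%N s = n L.+1 by rewrite (last_nth 0%N) ss.
rewrite lastE poch_bfac gE.
have -> : \prod_(1 <= i < L.+2 | ~~ ((2 * m + 1) %| i)%N)
    \prod_(i.+1 <= j < L.+2 | (j != m %[mod (2 * m + 1)])%N)
      q ^ (epsilon m i j * (n i)%:Z * (n j)%:Z) =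
    q ^ (\sum_(r < L.+1) (n r.+1)%:Z * (\sum_(i < r.+1) epsres m i r.+1 * (chain s i)%:Z)).
  transitivity (q ^ (\sum_(r < L.+1) (n r.+1)%:Z * (\sum_(i < r.+1) epsres m i r.+1 * (n i)%:Z))).
    rewrite -(epsilon_sum m0) -prod_exprz //; apply: eq_bigr => i _.
    by rewrite -prod_exprz.
  congr (q ^ _); apply: eq_bigr => r _; congr (_ * _); apply: eq_bigr => -[[|i] ir] _ //.
  by rewrite epsres_dvd ?mul0r.
rewrite [X in _ * _ * _ * X = _]big_split /=.
have -> : \prod_(1 <= i < L.+1) q ^ (- ((n i)%:Z * (n i.+1)%:Z) + gamma m i * (n i)%:Z) =
    q ^ (\sum_(r < L) (- ((n r.+1)%:Z * (n r.+2)%:Z) + gamma m r.+1 * (n r.+1)%:Z)).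
  by rewrite -prod_exprz // big_add1 big_mkord.
have -> : \prod_(1 <= i < L.+1 | (i == m %[mod (2 * m + 1)])%N || (i == (2 * m + 1) %[mod (2 * m + 1)])%N)
       ((-1) ^+ n i * q ^+ (N * n i + 'C((n i).+1, 2))) =
    (-1) ^+ signs m L (chain s) *
    q ^ (\sum_(r < L) (marked m r.+1)%:R * (N%:Z * (n r.+1)%:Z + 'C((n r.+1).+1, 2)%:Z)).
  rewrite big_mkcond big_add1 big_mkord -prod_exprz // /signs -prodrXr -big_split /=.
  apply: eq_bigr => r _; rewrite /marked modnn [(m %% _)%N]modn_small; last lia.
  case: ifP => _; last by rewrite mul0n mul0r expr0 expr0z mulr1.
  by rewrite mul1n mulr1n mul1r.
have -> : \prod_(1 <= i < L.+1) (poch q (n i.+1) / (poch q (n i.+1 - n i) * poch q (n i))) =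
    \prod_(r < L) gb q (nth 0%N s r.+1) (nth 0%N s r).
  rewrite big_add1 big_mkord; apply: eq_bigr => -[r rL] _; rewrite gbE //.
  by move/(sortedP 0%N): srt; apply; rewrite ss.
have mL : marked m L.+1 = false.
  by rewrite /marked Lm; apply/norP; split; apply/eqP; lia.
have gL : gamma m L.+1 = -1.
  by rewrite /gamma Lm; rewrite ifF ?ifT //; lia.
have := prefix_exp_last N (erefl : chain s 0 = 0%N) mL gL.
rewrite -[chain s L.+1]/(n L.+1) => e.
rewrite /blockwt signsS mL mul0n addn0.
move: e; rewrite -[\sum_(r < L) _%:R * _]/(\sum_(r < L) (marked m r.+1)%:R *
  (N%:Z * (n r.+1)%:Z + 'C((n r.+1).+1, 2)%:Z)).
rewrite -[\sum_(r < L) (- (_ * _) + _)]/(\sum_(r < L)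
  (- ((n r.+1)%:Z * (n r.+2)%:Z) + gamma m r.+1 * (n r.+1)%:Z)).
rewrite -[\sum_(r < L.+1) (chain s _)%:Z * _]/(\sum_(r < L.+1) (n r.+1)%:Z *
  (\sum_(i < r.+1) epsres m i r.+1 * (chain s i)%:Z)).
set A := \sum_(r < L.+1) _; set B := \sum_(r < L) _; set C := \sum_(r < L) _ => e.
set X := \prod_(r < L) _.
have {}e : q ^ A * q ^ B * q ^ C = q ^ prefix_exp m N L.+1 (fun=> 0) (chain s) * q ^+ n L.+1.
  by rewrite -!expfzDr // -e expfzDr.
transitivity ((q ^ A * q ^ B * q ^ C) * (X * (-1) ^+ signs m L (chain s) *
  ((q ^+ N) ^- n L.+1 * bfac q (q ^+ N) (n L.+1)))); first by ring.
by rewrite e; ring.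
Qed.

End Summand.

Lemma indet_neq0 : q != 0.
Proof. by rewrite expf_neq0 // tofrac_eq0 polyX_eq0. Qed.

Lemma indet_root n : (0 < n)%N -> q ^+ n != 1.
Proof. by move=> n0; rewrite /q -exprM sqrt4q_root // muln_gt0. Qed.

Lemma qpoch_poch a n : qpoch a n = poch q a n.
Proof. by rewrite /qpoch big_mkord. Qed.

Lemma multisum_collapse (m p N : nat) : (0 < m)%N -> (0 < N)%N ->
  forall L, L = (p * (2 * m + 1) + 2 * m)%N ->
  \sum_(t : L.-tuple 'I_N | sorted leq [seq val x | x <- t])
    (let n := part t in
    qpoch (q ^ (1 - N%:Z)) (n L) * (-1) ^+ n L * q ^ (- 'C((n L).+1, 2)%:Z) *
    (\prod_(1 <= i < L.+1 | ~~ ((2 * m + 1) %| i)%N)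
       \prod_(i.+1 <= j < L.+1 | (j != m %[mod (2 * m + 1)])%N)
         q ^ (epsilon m i j * (n i)%:Z * (n j)%:Z)) *
    (\prod_(1 <= i < L | (i == m %[mod (2 * m + 1)])%N || (i == (2 * m + 1) %[mod (2 * m + 1)])%N)
       ((-1) ^+ n i * q ^+ (N * n i + 'C((n i).+1, 2)))) *
    (\prod_(1 <= i < L)
       (q ^ (- ((n i)%:Z * (n i.+1)%:Z) + gamma m i * (n i)%:Z)
        * qbin (n i.+1) (n i)))) =
  \sum_(z < N) \sum_(A < N) (q ^+ N) ^+ (2 * z) * pcoef q N (q ^+ N) p z * mkern q N (q ^+ N) m A *
    \sum_(a < A.+1) (q ^+ N) ^- (z + a) * bfac q (q ^+ N) (z + a) * gb q (z + a)%N z *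
      gb q z (A - a)%N * q ^- ((A - a) * (z + a).+1).
Proof.
move=> m0 N0 L LE.
have q0 := indet_neq0; have qr := indet_root.
have c0 w : (N <= w)%N -> (q ^+ N) ^- w * bfac q (q ^+ N) w = 0.
  by move=> h; rewrite (bfac_ge q0 (erefl (q ^+ N))) ?mulr0.
rewrite -(total_sum q0 qr N0 m0 p c0) -LE.
case: L LE => [|L] LE; first by move: LE; lia.
have Lm : (L.+1 %% (2 * m + 1) = 2 * m)%N by rewrite LE modnMDl modn_small //; lia.
rewrite big_mkcond -seqsum_tuple; apply: eq_bigr => t _.
rewrite -(summandE q0 qr N m0 _ Lm); last by rewrite size_map size_tuple.
case: ifP => // _; rewrite /= qpoch_poch; congr (_ * _).
by apply: eq_bigr => i _; rewrite /qbin !qpoch_poch.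
Qed.

Theorem theorem1p1 (m p : nat) (hm : (0 < m)%N) (hp : (0 < p)%N)
    (N : nat) (hN : (1 <= N)%N) :
  let M := (2 * m + 1)%N in
  let L := (M * p - 1)%N in
  colored_jones N (double_twist (- m%:Z) (- p%:Z)) =
  q ^+ ((p - 1) * (N - 1)) *
  \sum_(t : L.-tuple 'I_N | sorted leq [seq val x | x <- t])
    let n := part t in
    qpoch (q ^ (1 - N%:Z)) (n L) * (-1) ^+ n L * q ^ (- 'C((n L).+1, 2)%:Z) *
    (\prod_(1 <= i < L.+1 | ~~ (M %| i)%N)
       \prod_(i.+1 <= j < L.+1 | (j != m %[mod M])%N)
         q ^ (epsilon m i j * (n i)%:Z * (n j)%:Z)) *
    (\prod_(1 <= i < L | (i == m %[mod M])%N || (i == M %[mod M])%N)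
       ((-1) ^+ n i * q ^+ (N * n i + 'C((n i).+1, 2)))) *
    (\prod_(1 <= i < L)
       (q ^ (- ((n i)%:Z * (n i.+1)%:Z) + gamma m i * (n i)%:Z)
        * qbin (n i.+1) (n i))).
Proof.
move=> M L.
(* From here on p is one less: the variables form p complete blocks and one of length 2m. *)
case: p hp @L => // p _ L; case: N hN => // n _.
have LE : L = (p * M + 2 * m)%N by rewrite /L /M; lia.
rewrite (multisum_collapse hm (ltn0Sn n) LE) jones_double_twist.
have q0 := indet_neq0; have qr := indet_root.
have e := kern_pairing q0 qr (erefl (q ^+ n.+1))
  (fun k => (q ^+ n.+1) ^+ (2 * k) * pcoef q n.+1 (q ^+ n.+1) p k)
  (mkern q n.+1 (q ^+ n.+1) m) (ltn0Sn n).
(* One of the p+1 factors x/q is the one in [kern_pairing]; the others make up the prefactor. *)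
rewrite -e exprSr -mulrA subn1 subn1 /=; congr (_ * (_ * _)).
  by rewrite exprS mulrC mulKf // -exprM mulnC.
apply: eq_bigr => j _; congr (_ * _).
exact: (mcoef_kern q0 qr (q ^+ n.+1) m (ltn_ord j)).
Qed.
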